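(* Let $n\geqslant2$. (1) The geometrical realization of the poset $\operatorname{Top}_n\setminus\{\hat0,\hat1\}$ is homotopy equivalent to the wedge of $(n-1)!$ many $(2n-4)$-dimensional spheres. (2) The geometrical realization of the poset $\operatorname{TopSep}_n\setminus\{\hat1\}$ is homotopy equivalent to $S^{n-2}$.
   Context: For a finite set $X$ of cardinality $n$, $\operatorname{Top}_n$ is the set of all topologies on $X$, partially ordered by strength: $\mathcal{T}_1\leqslant\mathcal{T}_2$ if every open set of $\mathcal{T}_1$ is open in $\mathcal{T}_2$. Its greatest element $\hat1$ is the discrete topology and its least element $\hat0$ is the indiscrete topology. $\operatorname{TopSep}_n\subset\operatorname{Top}_n$ is the subposet of all topologies satisfying the Kolmogorov $T_0$ axiom (for any $x\neq y$ in $X$ there is an open set containing exactly one of $x,y$). The geometrical realization of a finite poset is the geometrical realization of its order complex, i.e. the simplicial complex whose vertices are the elements of the poset and whose simplices are the chains. *)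

(* Defs.v *)
From HB Require Import structures.
From mathcomp Require Import all_boot all_order all_algebra.

Set Implicit Arguments.
Unset Strict Implicit.
Unset Printing Implicit Defensive.

Import Order.TTheory GRing.Theory Num.Theory.

Fact top_display : Order.disp_t. Proof. exact: Order.Disp tt tt. Qed.

Section FiniteTopologies.
Variable X : finType.

Definition is_topology (T : {set {set X}}) : bool :=
  [&& set0 \in T, [set: X] \in T,
      [forall S : {set {set X}}, (S \subset T) ==> (cover S \in T)]
    & [forall U in T, forall V in T, U :&: V \in T]].

Record top := Top { opens : {set {set X}}; topP : is_topology opens }.

HB.instance Definition _ := [isSub for opens].
HB.instance Definition _ := [Finite of top by <:].

Definition top_le : rel top := fun T1 T2 => opens T1 \subset opens T2.

Lemma top_le_refl : reflexive top_le.
Proof. by move=> T; exact: subxx. Qed.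

Lemma top_le_anti : antisymmetric top_le.
Proof.
move=> T1 T2 /andP[le12 le21]; apply: val_inj; apply/eqP.
by rewrite eqEsubset; apply/andP.
Qed.

Lemma top_le_trans : transitive top_le.
Proof. by move=> T2 T1 T3; exact: subset_trans. Qed.

HB.instance Definition _ := Order.Le_isPOrder.Build
  top_display top top_le_refl top_le_anti top_le_trans.

Fact indiscrete_subproof : is_topology [set set0; [set: X]].
Proof.
apply/and4P; split; rewrite ?inE ?eqxx ?orbT //.
  apply/forallP => S; apply/implyP => /subsetP sST.
  have [TS|TnS] := boolP ([set: X] \in S).
    by rewrite !inE orbC -subTset (bigcup_max [set: X]).
  rewrite !inE -subset0; apply/orP; left; apply/bigcupsP => U US.
  by move: (sST U US) (US); rewrite !inE => /orP[/eqP->//|/eqP->]; rewrite (negPf TnS).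
apply/forall_inP => U; rewrite !inE => HU.
apply/forall_inP => V; rewrite !inE => HV.
by case/orP: HU => /eqP->; rewrite ?set0I ?setTI ?eqxx.
Qed.

Definition indiscrete := Top indiscrete_subproof.

Fact discrete_subproof : is_topology [set: {set X}].
Proof.
apply/and4P; split; rewrite ?inE //.
  by apply/forallP => S; rewrite inE implybT.
by apply/forall_inP => U _; apply/forall_inP => V _; rewrite inE.
Qed.

Definition discrete := Top discrete_subproof.

Lemma indiscrete_le (T : top) : (indiscrete <= T)%O.
Proof.
apply/subsetP => U; case/and4P: (topP T) => T0 TT _ _.
by rewrite !inE => /orP[] /eqP->.
Qed.

Lemma le_discrete (T : top) : (T <= discrete)%O.
Proof. by apply/subsetP => U; rewrite inE. Qed.

HB.instance Definition _ := Order.hasBottom.Build _ top indiscrete_le.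
HB.instance Definition _ := Order.hasTop.Build _ top le_discrete.

Definition kolmogorov (T : top) : bool :=
  [forall x, forall y, (x != y) ==>
    [exists U in opens T, (x \in U) != (y \in U)]].

End FiniteTopologies.

Section OrderComplex.
Context {d : Order.disp_t}.

Definition subposet (P : finPOrderType d) (A : pred P) := {x : P | A x}.

HB.instance Definition _ P A := SubFinite.on (@subposet P A).
HB.instance Definition _ P A :=
  [SubChoice_isSubPOrder of @subposet P A by <: with d].

Definition order_complex (P : finPOrderType d) : {set {set P}} :=
  [set C : {set P} | [forall x in C, forall y in C, (x >=< y)%O]].

End OrderComplex.

From mathcomp Require Import all_classical all_reals all_analysis homotopy.
Import numFieldNormedType.Exports.
Local Open Scope classical_set_scope.
Local Open Scope ring_scope.

(* The complex is given by its set of simplices; its realization is made of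
   barycentric coordinates, so the empty simplex is irrelevant. *)
Definition realization (R : realType) (V : finType) (K : {set {set V}})
    : topologicalType :=
  set_type [set f : {ptws V -> R} |
    [/\ forall v, 0 <= f v, \sum_v f v = 1 & [set v | f v != 0]%SET \in K]].

Definition homotopic (R : realType) (X Y : topologicalType) (f g : X -> Y) :=
  exists H : X * R -> Y,
    [/\ {within [set: X] `*` `[0, 1], continuous H},
        forall x, H (x, 0) = f x & forall x, H (x, 1) = g x].

Definition homotopy_equivalent (R : realType) (X Y : topologicalType) :=
  exists (f : X -> Y) (g : Y -> X),
    [/\ continuous f, continuous g,
        homotopic R (g \o f) id & homotopic R (f \o g) id].

(* The norm of 'rV[R]_d.+1 is the sup norm, hence the explicit equation; the
   topology it induces is the Euclidean one. *)
Definition unit_sphere (R : realType) (d : nat) : set 'rV[R]_d.+1 :=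
  [set x | \sum_i x 0 i ^+ 2 = 1].

Definition sphere (R : realType) (d : nat) : topologicalType :=
  set_type (@unit_sphere R d).

Fact sphere_pt_subproof (R : realType) (d : nat) :
  delta_mx 0 0 \in @unit_sphere R d.
Proof.
rewrite inE /unit_sphere /= (bigD1 0) //= mxE !eqxx expr1n.
by rewrite big1 ?addr0 // => i i0; rewrite mxE (negPf i0) andbF expr0n.
Qed.

Definition sphere_pt (R : realType) (d : nat) : sphere R d :=
  exist (fun x => x \in @unit_sphere R d) _ (sphere_pt_subproof R d).

Definition sphere_wedge (R : realType) (k d : nat) : topologicalType :=
  wedge (fun _ : 'I_k => sphere_pt R d).

(* Main.v *)
(* A topology on a finite set amounts to its specialization preorder, and the
   realization of a poset of preorders is homeomorphic to a space of functions t on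
   pairs of points, with values in [0, 1] and maximum 1, whose strict superlevel sets
   form the chain in question.

   For partial orders, a function t is sent to the direction of the vector of heights
   i |-> sum_k t (k, i), which is not constant; a vector x, up to constants, is sent back
   to (i, j) |-> max 0 (x j - x i), normalized. The composites are homotopic to the
   identity, which gives the sphere.

   For all proper preorders, the space F(X) is a disjoint union of open cells and of a
   closed set D that can be contracted to a point within itself, so that collapsing D
   yields a homotopy equivalence with a wedge of spheres. This goes by induction on X.
   Let N be a new point added to Y. If for some a in Y both t (N, a) and t (a, N)
   exceed all other values of t, then t is determined by these two numbers and by its
   restriction to Y, which lies in the cone over F(Y): each cell of F(Y) thus gives, for
   each a, one new cell with two more dimensions. The rest of the space is contracted
   by pushing the cones over D to their boundary, then by separating N from Y and
   identifying the points of Y. *)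

(* The obstacle is that the contraction of D has to be defined and continuous on all of F(X), cells
   included. In the cone over F(Y), the rays over D and those over the cells meet at the apex, and
   the apex must end on F(Y) while F(Y) stays fixed. A ray over a cell therefore has to come back
   through the apex, whereas a ray over D has to avoid it at the final time. A bump function,
   positive only inside D and equal to 1 at the pole, interpolates between the two behaviors. This
   is why the induction carries a neighborhood of the pole within D, and not just a contraction. No
   cofibration or attaching map is involved. F(X) is compact and the wedge is Hausdorff, so maps and
   homotopies descend to the quotient as soon as they are compatible with it pointwise. The cells
   are given by coordinates that leave every bounded set near D, and the inverse stereographic
   projection sends infinity to the base point. The induction starts with two points, where the
   space consists of the pole and one cell of dimension 0. Passing from m to m + 1 points multiplies
   the number of cells by m, whence (n-1)! cells of dimension 2(n-2). *)
Require Import Defs.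
From mathcomp Require Import all_boot all_order all_algebra.
From mathcomp Require Import all_classical all_reals all_analysis homotopy.
From mathcomp Require Import ring lra.

Set Implicit Arguments.
Unset Strict Implicit.
Unset Printing Implicit Defensive.

Import Order.TTheory GRing.Theory Num.Theory.
Import numFieldNormedType.Exports.
Local Open Scope classical_set_scope.
Local Open Scope ring_scope.

(** * Convergence and quotient maps *)

Section Convergence.
Variable R : realType.

Lemma cvg_set_type (X : topologicalType) (S : set X) (T : Type)
    (G : set_system T) (FG : Filter G) (f : T -> set_type S) (y : set_type S) :
  (fun z => set_val (f z)) @ G --> set_val y -> f @ G --> y.
Proof.
move=> h U [_ [[W oW <-] Wy] sWU].
have nW : nbhs (set_val y) W by apply: open_nbhs_nbhs.
by apply: (@filterS _ G FG _ _ _ (h W nW)) => z Wz; apply: sWU.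
Qed.

Lemma cvg_set_val (X : topologicalType) (S : set X) (T : Type)
    (G : set_system T) (FG : Filter G) (f : T -> set_type S) (y : set_type S) :
  f @ G --> y -> (fun z => set_val (f z)) @ G --> set_val y.
Proof.
move=> h; apply: (cvg_comp _ _ h).
exact: (@initial_continuous (set_type S) X set_val).
Qed.

Lemma cvg_pairT (A B : topologicalType) (T : Type) (F : set_system T)
    (FF : Filter F) (f : T -> A) (g : T -> B) (a : A) (b : B) :
  f @ F --> a -> g @ F --> b -> (fun z => (f z, g z)) @ F --> ((a, b) : A * B).
Proof. by move=> fa gb; exact: cvg_pair fa gb. Qed.

Lemma cvg_ptws (V : Type) (T : Type) (G : set_system T) (FG : Filter G)
    (f : T -> {ptws V -> R}) (y : {ptws V -> R}) :
  (forall a, (fun z => f z a) @ G --> y a) -> f @ G --> y.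
Proof.
move=> h; apply/cvg_sup => a.
move=> U [_ [[W oW <-] Wy] sWU].
have nW : nbhs (y a) W by apply: open_nbhs_nbhs.
by apply: (@filterS _ G FG _ _ _ (h a W nW)) => z Wz; apply: sWU.
Qed.

Lemma ptws_cvg (V : eqType) (T : Type) (G : set_system T) (FG : Filter G)
    (f : T -> {ptws V -> R}) (y : {ptws V -> R}) a :
  f @ G --> y -> (fun z => f z a) @ G --> y a.
Proof.
move=> h; apply: (cvg_comp f (fun g : {ptws V -> R} => g a) h).
exact: (@proj_continuous V (fun=> R) a y).
Qed.

Lemma cvg_coord (V : eqType) (S : set {ptws V -> R}) (T : Type)
    (G : set_system T) (FG : Filter G) (f : T -> set_type S) (y : set_type S) a :
  f @ G --> y -> (fun z => set_val (f z) a) @ G --> set_val y a.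
Proof.
move=> fy; apply: (@ptws_cvg V T G FG (fun z => set_val (f z)) (set_val y) a).
exact: (@cvg_set_val _ S T G FG f y fy).
Qed.

Lemma coord_cvg (V : eqType) (S : set {ptws V -> R}) (T : Type)
    (G : set_system T) (FG : Filter G) (f : T -> set_type S) (y : set_type S) :
  (forall a, (fun z => set_val (f z) a) @ G --> set_val y a) -> f @ G --> y.
Proof.
move=> fy; apply: cvg_set_type.
exact: (@cvg_ptws V T G FG (fun z => set_val (f z)) _ fy).
Qed.

Lemma cvg_maxr (T : Type) (G : set_system T) (FG : Filter G) (f g : T -> R) a b :
  f @ G --> a -> g @ G --> b -> (fun z => Num.max (f z) (g z)) @ G --> Num.max a b.
Proof.
move=> fa gb; apply: (@continuous2_cvg _ _ _ _ G FG f g (fun x y : R => Num.max x y) a b _ fa gb).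
exact: (@continuous_max R (R * R)%type fst snd (a, b) (@cvg_fst _ _ _ _ _) (@cvg_snd _ _ _ _ _)).
Qed.

Lemma cvg_minr (T : Type) (G : set_system T) (FG : Filter G) (f g : T -> R) a b :
  f @ G --> a -> g @ G --> b -> (fun z => Num.min (f z) (g z)) @ G --> Num.min a b.
Proof.
move=> fa gb; apply: (@continuous2_cvg _ _ _ _ G FG f g (fun x y : R => Num.min x y) a b _ fa gb).
exact: (@continuous_min R (R * R)%type fst snd (a, b) (@cvg_fst _ _ _ _ _) (@cvg_snd _ _ _ _ _)).
Qed.

Lemma cvg_bigmaxr (I : Type) (r : seq I) (P : pred I) (T : Type) (G : set_system T)
    (FG : Filter G) (f : I -> T -> R) (a : I -> R) (x0 : R) :
  (forall i, f i @ G --> a i) ->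
  (fun z => \big[Num.max/x0]_(i <- r | P i) f i z) @ G
     --> \big[Num.max/x0]_(i <- r | P i) a i.
Proof.
move=> fa; elim: r => [|i r IH].
  rewrite big_nil; under eq_fun do rewrite big_nil; exact: cvg_cst.
rewrite big_cons; under eq_fun do rewrite big_cons.
by case: (P i) => //; apply: cvg_maxr.
Qed.

Lemma cvg_sumr (I : Type) (r : seq I) (P : pred I) (T : Type) (G : set_system T)
    (FG : Filter G) (f : I -> T -> R) (a : I -> R) :
  (forall i, f i @ G --> a i) ->
  (fun z => \sum_(i <- r | P i) f i z) @ G --> \sum_(i <- r | P i) a i.
Proof.
move=> fa; elim: r => [|i r IH].
  rewrite big_nil; under eq_fun do rewrite big_nil; exact: cvg_cst.
rewrite big_cons; under eq_fun do rewrite big_cons.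
by case: (P i) => //; apply: cvgD.
Qed.

Lemma compact_set_type (X : topologicalType) (S : set X) :
  compact S -> compact [set: set_type S].
Proof.
move=> cS F PF FT.
have PF' : ProperFilter (set_val @ F) by exact: fmap_proper_filter.
have SF : (set_val @ F) S.
  by apply: (@filterS _ F _ setT (set_val @^-1` S)) => // z _; exact: (set_mem (svalP z)).
have [x [Sx clx]] := cS _ PF' SF.
pose y : set_type S := exist _ x (mem_set Sx).
exists y; split=> // A B FA [_ [[W oW <-] Wy] sWB].
have [] := clx (set_val @` A) W.
- by apply: (@filterS _ F _ A (set_val @^-1` (set_val @` A))) => // z Az; exists z.
- exact: open_nbhs_nbhs.
by move=> _ [[z Az <-] Wz]; exists z; split => //; exact: sWB.
Qed.

Lemma hausdorff_set_type (X : topologicalType) (S : set X) :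
  hausdorff_space X -> hausdorff_space (set_type S).
Proof.
move=> hX x y cl; apply: val_inj; apply: hX => A B /= nA nB.
have [z [Az Bz]] := cl (set_val @^-1` A) (set_val @^-1` B)
  ((@initial_continuous (set_type S) X set_val) x _ nA)
  ((@initial_continuous (set_type S) X set_val) y _ nB).
by exists (set_val z).
Qed.

End Convergence.

Section Quotients.
Variable R : realType.

(** Compactness of [A] makes [q] a proper map, so its product with the identity of [T] is still a
    quotient map, whatever [T] is. With [T] the time parameter, homotopies descend along [q]. *)
Lemma compact_quotient_joint (A B C T : topologicalType) (q : A -> B)
    (k : A * T -> C) (K : B * T -> C) :
  compact [set: A] -> hausdorff_space B -> continuous q ->
  (forall b, exists a, q a = b) -> continuous k ->
  (forall a t, K (q a, t) = k (a, t)) -> continuous K.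
Proof.
move=> /compact_near_coveringP cA hB cq sq ck Kk [b t] W /= nW.
(* Compactness reduces this to a neighborhood of each [a]: over [b] it is continuity of [k];
   elsewhere the premise fails, since [q a] and [b] are separated. *)
have H : \forall bt \near (b, t), forall a, [set: A] a -> q a = bt.1 -> W (k (a, bt.2)).
  apply: (cA _ (nbhs (b, t)) (fun bt a => q a = bt.1 -> W (k (a, bt.2)))) => a _.
  have [qab|qab] := pselect (q a = b).
    have : nbhs (k (a, t)) W by rewrite -Kk qab.
    move=> /ck[[U V] /= [nU nV] UV].
    exists (U, [set bt | V bt.2]) => /=.
      by split=> //; exact: (@cvg_snd _ _ (nbhs b) (nbhs t) _ V nV).
    by move=> [a' [b' t']] /= [Ua' Vt'] _; exact: (UV (a', t')).
  have [U [V [[nU nV] UV0]]] : exists U V, (nbhs (q a) U /\ nbhs b V) /\ U `&` V = set0.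
    apply: contrapT => h; apply: qab; apply: hB => U V nU nV.
    by apply/set0P/eqP => UV0; apply: h; exists U, V.
  exists (q @^-1` U, [set bt | V bt.1]) => /=.
    split; first exact: cq.
    exact: (@cvg_fst _ _ (nbhs b) (nbhs t) _ V nV).
  move=> [a' [b' t']] /= [Ua' Vb'] qa'; exfalso.
  have : (U `&` V) b' by split=> //; rewrite -qa'.
  by rewrite UV0.
apply: filterS H => -[b' t'] /= H.
by have [a qa] := sq b'; rewrite -qa Kk; apply: H.
Qed.

Lemma compact_quotient (A B C : topologicalType) (q : A -> B) (f : B -> C) :
  compact [set: A] -> hausdorff_space B -> continuous q ->
  (forall b, exists a, q a = b) -> continuous (f \o q) -> continuous f.
Proof.
move=> cA hB cq sq cfq.
have cK : continuous (f \o fst : B * R -> C).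
  apply: (@compact_quotient_joint _ _ _ _ q (f \o q \o fst)) => // -[a t].
  by apply: continuous_comp; [exact: cvg_fst|exact: cfq].
move=> b; apply: (@cvg_comp _ _ _ (fun x => (x, 0 : R)) (f \o fst) _ _ _ _ (cK (b, 0))).
by apply: cvg_pairT; [exact: cvg_id|exact: cvg_cst].
Qed.

Lemma homotopic_continuous (X Y : topologicalType) (f g : X -> Y) (H : X * R -> Y) :
  continuous H -> (forall x, H (x, 0) = f x) -> (forall x, H (x, 1) = g x) ->
  homotopic R f g.
Proof. by move=> cH H0 H1; exists H; split => //; exact: continuous_subspaceT. Qed.

Lemma homotopy_equivalent_homeo (A B C : topologicalType) (phi : A -> B) (psi : B -> A) :
  continuous phi -> continuous psi -> cancel phi psi -> cancel psi phi ->
  homotopy_equivalent R B C -> homotopy_equivalent R A C.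
Proof.
move=> cphi cpsi phiK psiK [f [g [cf cg [H [cH H0 H1]] [K [cK K0 K1]]]]].
exists (f \o phi), (psi \o g); split.
- by move=> x; apply: continuous_comp; [exact: cphi|exact: cf].
- by move=> x; apply: continuous_comp; [exact: cg|exact: cpsi].
- exists (fun z => psi (H (phi z.1, z.2))); split => [|x|x] /=; last 2 first.
  + by rewrite H0.
  + by rewrite H1 phiK.
  apply/subspace_continuousP => -[x u] [_ u01].
  have /subspace_continuousP/(_ (phi x, u)) := cH.
  move=> /(_ (conj I u01)) Hc.
  apply: (@cvg_comp _ _ _ (fun z => H (phi z.1, z.2)) psi _ _ _ _ (cpsi _)).
    apply: (@cvg_comp _ _ _ (fun z => (phi z.1, z.2)) H _
      (within ([set: B] `*` `[0, 1]) (nbhs (phi x, u)))) Hc.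
    move=> P [[U V] /= [nU nV] UVP].
    exists (phi @^-1` U, V) => /=; first by split => //; exact: cphi.
    by move=> [y v] /= [Uy Vv] [_ v01]; apply: (UVP (phi y, v)).
- exists K; split => // x; rewrite ?K1 // K0 /=.
  by rewrite psiK.
Qed.

(* [D] is contracted within itself, so that collapsing it to a point has the
   end of the contraction as homotopy inverse. *)
Lemma homotopy_equivalent_collapse (A B : topologicalType) (q : A -> B)
    (D : set A) (b0 : B) (p : A) (h : A * R -> A) :
  compact [set: A] -> hausdorff_space B -> continuous q ->
  (forall b, exists a, q a = b) ->
  (forall a, D a -> q a = b0) ->
  (forall a a', q a = q a' -> D a \/ a = a') ->
  continuous h -> (forall a, h (a, 0) = a) ->
  (forall a u, D a -> D (h (a, u))) -> (forall a, D a -> h (a, 1) = p) ->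
  homotopy_equivalent R A B.
Proof.
move=> cA hB cq sq qD qI ch h0 hD h1.
(* [s] is a mere choice, without continuity. What is built from it below is continuous because,
   after composition with [q], it no longer involves [s]. *)
have [s sK] := choice sq.
have hs a : h (s (q a), 1) = h (a, 1).
  have [Ds|->//] := qI _ _ (sK (q a)).
  have [Da|<-//] := qI _ _ (esym (sK (q a))).
  by rewrite !h1.
have qhs a u : q (h (s (q a), u)) = q (h (a, u)).
  have [Ds|->//] := qI _ _ (sK (q a)).
  have [Da|<-//] := qI _ _ (esym (sK (q a))).
  by rewrite (qD _ (hD _ u Ds)) (qD _ (hD _ u Da)).
exists q, (fun b => h (s b, 1)); split=> //.
- apply: (@compact_quotient _ _ _ q) => // a.
  rewrite (_ : _ \o q = fun a => h (a, 1)); last by apply/funext => a'; exact: hs.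
  apply: (@cvg_comp _ _ _ (fun x => (x, 1 : R)) h _ _ _ _ (ch (a, 1))).
  by apply: cvg_pairT; [exact: cvg_id|exact: cvg_cst].
- apply: (@homotopic_continuous _ _ _ _ (fun z => h (z.1, 1 - z.2))) => [[a u]|a|a] /=.
  + apply: (@cvg_comp _ _ _ (fun z => (z.1, 1 - z.2)) h _ _ _ _ (ch (a, 1 - u))).
    apply: cvg_pairT; first exact: cvg_fst.
    by apply: cvgB; [exact: cvg_cst|exact: cvg_snd].
  + by rewrite subr0 hs.
  + by rewrite subrr h0.
- apply: (@homotopic_continuous _ _ _ _ (fun z => q (h (s z.1, 1 - z.2)))) => [|b|b] /=.
  + apply: (@compact_quotient_joint A B B R q (fun z => q (h (z.1, 1 - z.2)))) => //;
      last by move=> a u; exact: qhs.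
    move=> [a u].
    apply: (@cvg_comp _ _ _ (fun z => h (z.1, 1 - z.2)) q _ _ _ _ (cq _)).
    apply: (@cvg_comp _ _ _ (fun z => (z.1, 1 - z.2)) h _ _ _ _ (ch (a, 1 - u))).
    apply: cvg_pairT; first exact: cvg_fst.
    by apply: cvgB; [exact: cvg_cst|exact: cvg_snd].
  + by rewrite subr0.
  + by rewrite subrr h0 sK.
Qed.

End Quotients.

(** * Realizations as spaces of functions *)

Section Levels.
Variable R : realType.

Lemma closed_le_fun (X : topologicalType) (f g : X -> R) :
  continuous f -> continuous g -> closed [set x | f x <= g x].
Proof.
move=> cf cg.
have -> : [set x | f x <= g x] = (fun x => g x - f x) @^-1` [set y | 0 <= y].
  by rewrite eqEsubset; split => x /=; rewrite subr_ge0.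
apply: closed_comp; last exact: closed_ge.
by move=> x _; apply: cvgB; [exact: cg|exact: cf].
Qed.

Lemma closed_forall (X : topologicalType) (J : Type) (P : J -> X -> Prop) :
  (forall i, closed [set x | P i x]) -> closed [set x | forall i, P i x].
Proof.
move=> cP.
have -> : [set x | forall i, P i x] = \bigcap_i [set x | P i x].
  by rewrite eqEsubset; split => x h i; [move=> _; exact: h|exact: (h i I)].
by apply: closed_bigI => i _.
Qed.

Lemma continuous_ptws_eval (V : finType) (v : V) :
  continuous (fun f : {ptws V -> R} => f v).
Proof. exact: (@proj_continuous V (fun=> R) v). Qed.

Lemma hausdorff_ptws (V : finType) : hausdorff_space {ptws V -> R}.
Proof. by apply: hausdorff_product => _; exact: Rhausdorff. Qed.

Lemma compact_realization d (Q : finPOrderType d) :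
  compact [set: realization R (order_complex Q)].
Proof.
apply: compact_set_type.
pose box := [set f : {ptws Q -> R} | forall v, [set` `[0 : R, 1]] (f v)].
have cbox : compact box.
  by apply: (@tychonoff Q (fun=> R) (fun=> [set` `[0 : R, 1]])) => _; exact: segment_compact.
apply: (subclosed_compact _ cbox); last first.
  move=> f [f0 f1 _] v /=; rewrite in_itv /= f0 /= -f1 (bigD1 v) //= lerDl.
  exact: sumr_ge0.
(* Being supported on a chain becomes a closed condition when written as the vanishing of products
   over incomparable pairs. *)
have -> : [set f : {ptws Q -> R} | [/\ forall v, 0 <= f v, \sum_v f v = 1
              & [set v | f v != 0]%SET \in order_complex Q]] =
    [set f | forall v, 0 <= f v] `&` [set f | 1 <= \sum_v f v] `&`
    [set f | \sum_v f v <= 1] `&`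
    [set f | forall vw : Q * Q,
      (if (vw.1 >=< vw.2)%O then 0 else f vw.1 * f vw.2) <= 0 :> R].
  rewrite eqEsubset; split => f.
    case=> f0 f1; rewrite inE => /forall_inP fC; split; first by split; [split|]; rewrite /= ?f1.
    case=> x y /=; case: ifPn => // nxy.
    have [->|fx0] := eqVneq (f x) 0; first by rewrite mul0r.
    have [->|fy0] := eqVneq (f y) 0; first by rewrite mulr0.
    have xC : x \in [set v | f v != 0]%SET by rewrite inE.
    have yC : y \in [set v | f v != 0]%SET by rewrite inE.
    by have /forall_inP/(_ _ yC) := fC x xC; rewrite (negPf nxy).
  case=> [[[f0 f1]] f1' fC]; split => //; first by apply/eqP; rewrite eq_le f1 f1'.
  rewrite inE; apply/forall_inP => x; rewrite inE => fx0; apply/forall_inP => y.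
  rewrite inE => fy0; have := fC (x, y) => /=; case: ifPn => // _.
  rewrite real_leNgt ?num_real // => /negP[].
  by rewrite mulr_gt0 // lt_neqAle eq_sym ?fx0 ?fy0 f0.
have csum : continuous (fun f : {ptws Q -> R} => \sum_v f v).
  move=> f; exact: (@cvg_sumr R Q (index_enum Q) predT _ (nbhs f) _
    (fun v (g : {ptws Q -> R}) => g v) (fun v => f v) (fun v => @continuous_ptws_eval Q v f)).
have ccst (c : R) : continuous (fun f : {ptws Q -> R} => c).
  by move=> f; exact: (@cvg_cst R c _ (nbhs f) _).
do 3 ?apply: closedI.
- apply: closed_forall => v; apply: closed_le_fun => //.
  exact: (@continuous_ptws_eval Q v).
- exact: closed_le_fun.
- exact: closed_le_fun.
- apply: closed_forall => -[x y]; apply: closed_le_fun => //=.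
  case: (x >=< y)%O => // f.
  exact: (cvgM (@continuous_ptws_eval Q x f) (@continuous_ptws_eval Q y f)).
Qed.

Variable A : finType.

(* Nonnegative functions of maximum 1 all of whose nonempty strict superlevel
   sets satisfy [P]: barycentric coordinates on chains of such sets. *)
Definition levels (P : pred {set A}) : set {ptws A -> R} :=
  [set f | [/\ forall a, 0 <= f a <= 1, exists a, f a = 1 &
    forall s a, 0 <= s < f a -> P [set b | s < f b]%SET]].

Lemma levelsP (P : pred {set A}) (f : set_type (levels P)) :
  [/\ forall a, 0 <= set_val f a <= 1, exists a, set_val f a = 1 &
    forall s a, 0 <= s < set_val f a -> P [set b | s < set_val f b]%SET].
Proof. exact: set_mem (svalP f). Qed.

Section Realization.
Context (d : Order.disp_t) (Q : finPOrderType d).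
Variables (S : Q -> {set A}) (P : pred {set A}).
Hypothesis S_inj : injective S.
Hypothesis S_neq0 : forall x, S x != finset.set0.
Hypothesis S_comp : forall x y, (x >=< y)%O = (S x \subset S y) || (S y \subset S x).
Hypothesis S_P : forall B, P B <-> exists x, S x = B.

Let K := realization R (order_complex Q).

(** A combination of indicator functions of the sets [S x]. On a chain, the weights are the jumps
    between consecutive levels of the result. *)
Definition bary (t : Q -> R) : {ptws A -> R} :=
  fun a => \sum_(x | a \in S x) t x.

Definition chain_supported (t : Q -> R) :=
  (forall x, 0 <= t x) /\ (forall x y, t x != 0 -> t y != 0 -> (x >=< y)%O).

Lemma chain_supported_val (t : K) : chain_supported (set_val t).
Proof.
have [t0 _] := set_mem (svalP t).
rewrite inE => /forall_inP tC; split=> // x y tx ty.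
have xC : x \in [set v | set_val t v != 0]%SET by rewrite inE.
have yC : y \in [set v | set_val t v != 0]%SET by rewrite inE.
by have /forall_inP/(_ _ yC) := tC x xC.
Qed.

Lemma chain_smallest (t : Q -> R) (C : pred Q) x0 : chain_supported t ->
  t x0 != 0 -> C x0 ->
  exists x, [/\ t x != 0, C x & forall y, t y != 0 -> C y -> S x \subset S y].
Proof.
move=> [t0 tC] tx0 Cx0.
have := @arg_minnP Q x0 (fun x => (t x != 0) && C x) (fun x => #|S x|).
rewrite tx0 Cx0 => /(_ isT) [x /andP[tx Cx] xmin].
exists x; split=> // y ty Cy.
have := tC _ _ tx ty; rewrite S_comp => /orP[//|yx].
have /eqP -> // : S y == S x by rewrite eqEcard yx xmin // ty Cy.
Qed.

Lemma chain_largest (t : Q -> R) (C : pred Q) x0 : chain_supported t ->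
  t x0 != 0 -> C x0 ->
  exists x, [/\ t x != 0, C x & forall y, t y != 0 -> C y -> S y \subset S x].
Proof.
move=> [t0 tC] tx0 Cx0.
have := @arg_maxnP Q x0 (fun x => (t x != 0) && C x) (fun x => #|S x|).
rewrite tx0 Cx0 => /(_ isT) [x /andP[tx Cx] xmax].
exists x; split=> // y ty Cy.
have := tC _ _ tx ty; rewrite S_comp => /orP[xy|//].
have le : (#|S y| <= #|S x|)%N by apply: xmax; rewrite ty Cy.
have /eqP -> // : S x == S y by rewrite eqEcard xy le.
Qed.

Lemma bary_sum_le (t : Q -> R) (B C : pred Q) : (forall x, 0 <= t x) ->
  (forall x, t x != 0 -> B x -> C x) -> \sum_(x | B x) t x <= \sum_(x | C x) t x.
Proof.
move=> t0 BC; rewrite (bigID B C) /= [X in X <= _](_ : _ = \sum_(x | C x && B x) t x).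
  by rewrite lerDl; apply: sumr_ge0.
rewrite (bigID C B) /= [X in _ + X]big1 ?addr0; last first.
  move=> x /andP[Bx Cx]; apply/eqP; apply: contraNT Cx => tx; exact: BC.
by apply: eq_bigl => x; rewrite andbC.
Qed.

(** On the smallest set of the chain that contains [b], [bary t] is at least its value at [b]. A
    superlevel set is thus a union of members of the chain, hence the largest of these members. *)
Lemma bary_levels_sub (t : Q -> R) : chain_supported t ->
  forall s a, 0 <= s < bary t a -> P [set b | s < bary t b]%SET.
Proof.
move=> tC s a /andP[s0 sa].
have Ex b : s < bary t b ->
    exists x, [/\ t x != 0, b \in S x & S x \subset [set b | s < bary t b]%SET].
  move=> sb.
  have [x0 /andP[tx0 bx0]] : exists x, (t x != 0) && (b \in S x).
    apply/existsP; apply: contraTT sb => /existsPn h.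
    rewrite -leNgt /bary big1 // => x bx; apply/eqP.
    by have := h x; rewrite bx andbT negbK.
  have [x [tx bx xmin]] := @chain_smallest t (fun x => b \in S x) x0 tC tx0 bx0.
  exists x; split=> //; apply/fintype.subsetP => c cx; rewrite inE (lt_le_trans sb) //.
  apply: bary_sum_le => [|y ty yb]; first by case: tC.
  by apply: (fintype.subsetP (xmin y ty yb)).
have [x0 [tx0 _ x0S]] := Ex a sa.
have [x [tx xS xmax]] :=
  @chain_largest t (fun x => S x \subset [set b | s < bary t b]%SET) x0 tC tx0 x0S.
apply/S_P; exists x; apply/eqP; rewrite finset.eqEsubset xS; apply/fintype.subsetP => b.
rewrite inE => /Ex[y [ty b_y yS]].
exact: (fintype.subsetP (xmax y ty yS)).
Qed.

(** A point of the smallest set of the chain receives every weight. *)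
Lemma bary_max (t : Q -> R) x0 : chain_supported t -> t x0 != 0 ->
  exists a, bary t a = \sum_x t x.
Proof.
move=> tC tx0.
have [x [tx _ xmin]] := @chain_smallest t predT x0 tC tx0 isT.
have /set0Pn[a ax] := S_neq0 x; exists a; have [t0 _] := tC.
apply/eqP; rewrite eq_le; apply/andP; split; apply: bary_sum_le => // y ty _.
by apply: (fintype.subsetP (xmin y ty isT)).
Qed.

Lemma bary_levels (t : Q -> R) : chain_supported t -> \sum_x t x = 1 ->
  bary t \in levels P.
Proof.
move=> tC t1; have [t0 _] := tC.
apply/mem_set; split.
- move=> a; rewrite /bary sumr_ge0 //= -t1; exact: bary_sum_le.
- have [x0 tx0] : exists x, t x != 0.
    apply/existsP; apply: contraT => /existsPn h; move: t1.
    rewrite big1 => [/eqP|x _]; first by rewrite eq_sym oner_eq0.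
    by apply/eqP; have := h x; rewrite negbK.
  by have [a] := bary_max tC tx0; rewrite t1 => <-; exists a.
- exact: bary_levels_sub.
Qed.

(** Let [S x] be largest among the sets whose weights differ, with [t' x < t x], and let [a] be a
    point of [S x] in no smaller set of the chain of [t]. Then [bary t a] is the weight of the sets
    that contain [S x], so it is the least value on [S x]. These sets weigh less for [t'], so the
    chain of [t'] has a member through [a] that misses some [b] in [S x]; this makes [bary t']
    smaller at [b] than at [a], a contradiction. *)
Lemma bary_inj (t t' : Q -> R) : chain_supported t -> chain_supported t' ->
  bary t = bary t' -> t =1 t'.
Proof.
move=> tC tC' tt'; apply/eqfunP/negPn/negP => /forallPn /= [x0 ne0].
have [x nx xmax] := @arg_maxnP Q x0 (fun x => t x != t' x) (fun x => #|S x|) ne0.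
wlog lt : t t' tC tC' tt' {x0 ne0} nx xmax / t' x < t x.
  move=> H; case: (ltgtP (t' x) (t x)) => h; first exact: (H t t').
  - apply: (H t' t) => //; first by rewrite eq_sym.
    by move=> y; rewrite eq_sym; exact: xmax.
  - by rewrite h eqxx in nx.
have [t0 tch] := tC; have [t0' tch'] := tC'.
have tx : t x != 0 by rewrite gt_eqF // (le_lt_trans (t0' x)).
have [a [ax aP]] : exists a, a \in S x /\ forall y, t y != 0 -> a \in S y -> S x \subset S y.
  have [/existsP[y0 /andP[ty0 y0x]]|/existsPn h] :=
      boolP [exists y, (t y != 0) && (S y \proper S x)].
    have [y [ty yx ymax]] := @chain_largest t (fun y => S y \proper S x) y0 tC ty0 y0x.
    have [_ [a ax ay]] := properP yx; exists a; split=> // z tz az.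
    have := tch _ _ tx tz; rewrite S_comp => /orP[//|zx].
    apply: contraNT ay => xz.
    have zpx : S z \proper S x by rewrite properE zx.
    exact: (fintype.subsetP (ymax z tz zpx)).
  have /set0Pn[a ax] := S_neq0 x; exists a; split => // z tz az.
  have := tch _ _ tx tz; rewrite S_comp => /orP[//|zx].
  by apply: contraT => xz; have := h z; rewrite tz properE zx xz.
have tbig y : S x \proper S y -> t y = t' y.
  move=> /proper_card; apply: contraTeq => /xmax h; by rewrite -leqNgt.
have ta : bary t a = \sum_(y | S x \subset S y) t y.
  apply/eqP; rewrite eq_le; apply/andP; split; apply: bary_sum_le => // y ty.
  by move=> xy; exact: (fintype.subsetP xy).
have lt' : \sum_(y | S x \subset S y) t' y < \sum_(y | S x \subset S y) t y.
  rewrite (bigD1 x) //= [X in _ < X](bigD1 x) //=.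
  rewrite [X in _ < _ + X](eq_bigr t'); first by rewrite ltrD2r.
  move=> y /andP[xy yx]; apply: tbig; rewrite properE xy /=.
  apply: contra yx => yx; apply/eqP/S_inj/eqP; by rewrite finset.eqEsubset xy yx.
have [y [t'y ay nxy]] : exists y, [/\ t' y != 0, a \in S y & ~~ (S x \subset S y)].
  apply: contrapT => h; move: lt'; rewrite -ta tt' ltNge => /negP[].
  apply: bary_sum_le => // y t'y ay; apply: contrapT => /negP nxy; apply: h; by exists y.
have [b bx nby] : exists2 b, b \in S x & b \notin S y by exact/fintype.subsetPn.
have : bary t' a <= bary t' b.
  rewrite -tt' ta; apply: bary_sum_le => // z _ xz; exact: (fintype.subsetP xz).
rewrite leNgt => /negP[].
rewrite /bary [X in _ < X](bigD1 y) //=.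
apply: (@le_lt_trans _ _ (\sum_(i | (a \in S i) && (i != y)) t' i)); last first.
  by rewrite ltrDr lt_neqAle eq_sym t'y t0'.
apply: bary_sum_le => // z t'z bz.
have zy : z != y by apply: contraNneq nby => <-.
rewrite zy andbT; have := tch' _ _ t'y t'z; rewrite S_comp => /orP[yz|zy'].
  exact: (fintype.subsetP yz).
by rewrite (fintype.subsetP zy' _ bz) in nby.
Qed.

(** The layer-cake decomposition: the least positive value of [f] becomes the weight of its support
    and is subtracted there. No maximum is prescribed, since subtraction changes it; the last clause
    guarantees that the sets used later lie strictly inside this support. *)
Lemma bary_surj (f : A -> R) : (forall a, 0 <= f a) ->
  (forall s a, 0 <= s < f a -> P [set b | s < f b]%SET) ->
  exists t, [/\ chain_supported t, forall a, f a = bary t a &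
    forall x a, t x != 0 -> a \in S x -> 0 < f a].
Proof.
have [m] := ubnP #|[set a | 0 < f a]%SET|.
elim: m f => // m IH f ltm f0 fP.
have [/existsP[a0 fa0]|/existsPn h] := boolP [exists a, 0 < f a]; last first.
  exists (fun=> 0); split.
  - by split => // x y; rewrite eqxx.
  - move=> a; rewrite /bary big1 //; apply/eqP; rewrite eq_le f0 andbT leNgt; exact: h.
  - by move=> x a; rewrite eqxx.
have [x Sx] : exists x, S x = [set b | 0 < f b]%SET.
  by apply/S_P; apply: (fP 0 a0); rewrite lexx.
have [a1 fa1 a1min] := @arg_minP _ R A a0 (fun a => 0 < f a) f fa0.
pose c := f a1; pose g a := f a - (if 0 < f a then c else 0).
have g0 a : 0 <= g a.
  rewrite /g; case: ifPn => [fa|_]; last by rewrite subr0.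
  by rewrite subr_ge0 a1min.
have gs s a : 0 <= s -> (s < g a) = (s + c < f a).
  move=> s0; rewrite /g; case: ifPn => fa; first by rewrite ltrBrDr.
  rewrite subr0; have -> : f a = 0 by apply/eqP; rewrite eq_le f0 andbT leNgt.
  have c0 : 0 < c by [].
  by rewrite !ltNge s0 addr_ge0 // ltW.
have [t [[t0 tch] tf tS]] : exists t, [/\ chain_supported t, forall a, g a = bary t a &
    forall x a, t x != 0 -> a \in S x -> 0 < g a].
  apply: IH => //.
    rewrite -ltnS; apply: leq_trans ltm; rewrite ltnS; apply: proper_card; apply/properP.
    have c0 : 0 < c by [].
    split; first by apply/fintype.subsetP => a; rewrite !inE gs // add0r => /(lt_trans c0).
    by exists a1; rewrite !inE // gs // add0r ltxx.
  move=> s a /andP[s0]; rewrite gs // => sc.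
  have -> : [set b | s < g b]%SET = [set b | s + c < f b]%SET.
    by apply/setP => b; rewrite !inE gs.
  apply: (fP _ a); rewrite sc andbT addr_ge0 //; exact: f0.
have c0 : 0 < c by [].
have tx : t x = 0.
  apply/eqP; apply: contraT => /(tS x a1); rewrite Sx inE fa1 => /(_ isT).
  by rewrite gs // add0r ltxx.
have sub y : t y != 0 -> S y \subset S x.
  move=> ty; apply/fintype.subsetP => a ay; rewrite Sx inE.
  by have := tS _ _ ty ay; rewrite gs // add0r; exact: lt_trans.
exists (fun y => if y == x then c else t y); split.
- split=> [y|y z]; first by case: ifP => // _; exact: ltW.
  case: (y =P x) => [->|_] ty; case: (z =P x) => [->|_] tz; rewrite S_comp ?subxx //.
  + by rewrite (sub _ tz) orbT.
  + by rewrite (sub _ ty).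
  + by rewrite -S_comp tch.
- move=> a; have := tf a; rewrite /g /bary => E.
  case: ifPn E => fa E.
    have ax : a \in S x by rewrite Sx inE.
    rewrite (bigD1 x) //= eqxx; move/eqP: E; rewrite subr_eq => /eqP ->.
    rewrite addrC (bigD1 x) //= tx add0r; congr (_ + _).
    by apply: eq_bigr => y /andP[_ /negPf ->].
  move: E; rewrite subr0 => ->; apply: eq_bigr => y ay.
  case: (y =P x) => // yx; by move: ay; rewrite yx Sx inE (negPf fa).
- move=> y a; case: (y =P x) => [-> _|_ ty ay]; first by rewrite Sx inE.
  by have := tS _ _ ty ay; rewrite gs // add0r; exact: lt_trans.
Qed.

Lemma sum_val (t : K) : \sum_x set_val t x = 1.
Proof. by have [] := set_mem (svalP t). Qed.

Definition to_levels (t : K) : set_type (levels P) :=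
  exist (fun f => f \in levels P) _ (bary_levels (chain_supported_val t) (sum_val t)).

Lemma to_levels_continuous : continuous to_levels.
Proof.
move=> t; apply: (@coord_cvg R A (levels P) K (nbhs t) _ to_levels (to_levels t)) => a.
apply: (@cvg_sumr R Q (index_enum Q) (fun x => a \in S x) K (nbhs t) _
  (fun x (z : K) => set_val z x) (fun x => set_val t x)) => x.
exact: (@cvg_coord R Q _ K (nbhs t) _ id t x cvg_id).
Qed.

Lemma to_levels_bij : exists psi : set_type (levels P) -> K,
  cancel to_levels psi /\ cancel psi to_levels.
Proof.
have inj : injective to_levels.
  move=> t t' /(congr1 set_val) /= /(bary_inj (chain_supported_val t) (chain_supported_val t')) tt'.
  by apply: val_inj; apply/funext.
have surj : forall f, exists t, to_levels t = f.
  move=> f; have [f01 [a0 fa0] fP] := levelsP f.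
  have f0 a : 0 <= set_val f a by have /andP[] := f01 a.
  have [t [tC tf tS]] := bary_surj f0 fP.
  have [t0 tch] := tC.
  have [x0 tx0] : exists x, t x != 0.
    apply/existsP; apply: contraT => /existsPn h; have : bary t a0 = 1 by rewrite -tf.
    rewrite /bary big1 => [/eqP|x _]; first by rewrite eq_sym oner_eq0.
    by apply/eqP; have := h x; rewrite negbK.
  have t1 : \sum_x t x = 1.
    have [a ta] := bary_max tC tx0; apply/eqP; rewrite eq_le.
    rewrite -{1}ta -tf; have /andP[_ ->] /= := f01 a.
    by rewrite -fa0 tf; exact: bary_sum_le.
  have tK : (t : {ptws Q -> R}) \in [set f : {ptws Q -> R} | [/\ forall v, 0 <= f v,
      \sum_v f v = 1 & [set v | f v != 0]%SET \in order_complex Q]].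
    apply/mem_set; split => //; rewrite inE.
    apply/forall_inP => x; rewrite inE => tx; apply/forall_inP => y; rewrite inE => ty.
    exact: tch.
  exists (exist _ (t : {ptws Q -> R}) tK); apply: val_inj => /=.
  by apply/funext => a; rewrite -tf.
have [psi psiK] := choice surj.
by exists psi; split => // t; apply: inj; rewrite psiK.
Qed.

Lemma compact_levels : compact [set: set_type (levels P)].
Proof.
have [psi [_ psiK]] := to_levels_bij.
have -> : [set: set_type (levels P)] = to_levels @` setT.
  by rewrite eqEsubset; split=> // f _; exists (psi f).
apply: continuous_compact; last exact: compact_realization.
apply: continuous_subspaceT; exact: to_levels_continuous.
Qed.

Lemma hausdorff_levels (P' : pred {set A}) : hausdorff_space (set_type (levels P')).
Proof. by apply: hausdorff_set_type; exact: hausdorff_ptws. Qed.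

(** The inverse of [to_levels] is continuous, as the inverse of a continuous bijection from a
    compact space to a Hausdorff one. Compactness is passed on to the premise, for the collapse of
    the proper preorders. *)
Lemma homotopy_equivalent_levels (C : topologicalType) :
  (compact [set: set_type (levels P)] -> homotopy_equivalent R (set_type (levels P)) C) ->
  homotopy_equivalent R (realization R (order_complex Q)) C.
Proof.
move=> /(_ compact_levels); have [psi [phiK psiK]] := to_levels_bij.
apply: (@homotopy_equivalent_homeo _ _ _ _ to_levels psi) => //.
  exact: to_levels_continuous.
apply: (@compact_quotient R _ _ _ to_levels) => //.
- exact: compact_realization.
- exact: hausdorff_levels.
- exact: to_levels_continuous.
- by move=> f; exists (psi f).
- rewrite (_ : psi \o to_levels = id); first by move=> t; exact: cvg_id.
  by apply/funext => t /=; rewrite phiK.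
Qed.

End Realization.
End Levels.

(** * Topologies as preorders *)

Section Specialization.
Variable X : finType.
Implicit Types (T : top X) (U : {set X}).

(** Oriented so that the open sets are the up-sets. *)
Definition specializes T (i j : X) := [forall U in opens T, (i \in U) ==> (j \in U)].

Lemma specializesP T i j :
  reflect (forall U, U \in opens T -> i \in U -> j \in U) (specializes T i j).
Proof.
apply: (iffP forall_inP) => h U; first by move=> UT; apply/implyP; exact: h.
by move=> UT; apply/implyP; exact: h.
Qed.

Lemma specializes_refl T i : specializes T i i.
Proof. by apply/specializesP. Qed.

Lemma specializes_trans T i j k :
  specializes T i j -> specializes T j k -> specializes T i k.
Proof.
by move=> /specializesP ij /specializesP jk; apply/specializesP => U UT /(ij U UT) /(jk U UT).
Qed.

Lemma mem_opens T U :
  (U \in opens T) = [forall i, forall j, specializes T i j ==> (i \in U) ==> (j \in U)].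
Proof.
have /and4P[_ TT /forallP TU /forall_inP TI] := topP T.
apply/idP/idP => [UT|/forallP h].
  apply/forallP => i; apply/forallP => j; apply/implyP => /specializesP ij.
  by apply/implyP; exact: ij.
(* The smallest open set that contains [i], as an intersection of finitely many open sets. *)
pose N i := [set j | specializes T i j]%SET.
have NT i : N i \in opens T.
  have -> : N i = \bigcap_(V in opens T | i \in V) V.
    apply/setP => j; rewrite inE; apply/specializesP/bigcapP => [ij V /andP[]|ij V VT iV].
      exact: ij.
    by apply: ij; rewrite VT.
  apply: (big_ind (fun V => V \in opens T)) => // [V W VT WT|V /andP[]//].
  by have /forall_inP := TI V VT; exact.
have -> : U = finset.cover [set N i | i in U]%SET.
  apply/setP => j; apply/idP/bigcupP => [jU|[_ /imsetP[i iU ->]]].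
    by exists (N j); [apply/imsetP; exists j|rewrite inE specializes_refl].
  by rewrite inE => ij; have /forallP/(_ j) := h i; rewrite ij iU.
have /implyP := TU [set N i | i in U]%SET; apply.
by apply/fintype.subsetP => _ /imsetP[i _ ->].
Qed.

(** The reversal of the order is harmless: an order complex depends only on comparability. *)
Lemma le_top_specializes T1 T2 :
  (T1 <= T2)%O = [forall i, forall j, specializes T2 i j ==> specializes T1 i j].
Proof.
apply/fintype.subsetP/idP => [le12|/forallP h U].
  apply/forallP => i; apply/forallP => j; apply/implyP => /specializesP ij.
  by apply/specializesP => U /le12; exact: ij.
rewrite !mem_opens => /forallP UT; apply/forallP => i; apply/forallP => j.
apply/implyP => ij; have /forallP/(_ j)/implyP := UT i; apply.
by have /forallP/(_ j)/implyP := h i; apply.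
Qed.

Section Alexandrov.
Variable r : rel X.
Hypotheses (rr : reflexive r) (rt : transitive r).

Definition up_sets : {set {set X}} :=
  [set U : {set X} | [forall i, forall j, r i j ==> (i \in U) ==> (j \in U)]]%SET.

Lemma mem_up_sets U :
  reflect (forall i j, r i j -> i \in U -> j \in U) (U \in up_sets).
Proof.
rewrite inE; apply: (iffP forallP) => [h i j ij iU|h i].
  by have /forallP/(_ j) := h i; rewrite ij iU.
by apply/forallP => j; apply/implyP => ij; apply/implyP; exact: h.
Qed.

Fact alexandrov_subproof : is_topology up_sets.
Proof.
apply/and4P; split.
- by apply/mem_up_sets => i j _; rewrite inE.
- by apply/mem_up_sets => i j _; rewrite inE.
- apply/forallP => S; apply/implyP => /fintype.subsetP SU; apply/mem_up_sets => i j ij.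
  move=> /bigcupP[V VS iV]; apply/bigcupP; exists V => //.
  by have /mem_up_sets := SU V VS; apply; first exact: ij.
apply/forall_inP => U /mem_up_sets hU; apply/forall_inP => V /mem_up_sets hV.
by apply/mem_up_sets => i j ij; rewrite !inE => /andP[/(hU _ _ ij) -> /(hV _ _ ij) ->].
Qed.

Definition alexandrov := Top alexandrov_subproof.

Lemma specializes_alexandrov i j : specializes alexandrov i j = r i j.
Proof.
apply/specializesP/idP => [h|ij U /mem_up_sets]; last by apply.
have := h [set k | r i k]%SET; rewrite !inE; apply; last exact: rr.
by apply/forallP => k; apply/forallP => l; apply/implyP => kl; apply/implyP;
  rewrite !inE => ik; exact: rt kl.
Qed.

End Alexandrov.

Lemma eq_bot_specializes T : (T == \bot)%O = [forall i, forall j, specializes T i j].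
Proof.
rewrite eq_le le0x andbT le_top_specializes; apply/forallP/forallP => h i; apply/forallP => j.
  have /forallP/(_ j)/implyP := h i; apply; apply/specializesP => U.
  by rewrite !inE => /orP[] /eqP ->; rewrite inE.
by have /forallP/(_ j) -> := h i; rewrite implybT.
Qed.

Lemma eq_top_specializes T :
  (T == \top)%O = [forall i, forall j, specializes T i j ==> (i == j)].
Proof.
rewrite eq_le lex1 /= le_top_specializes; apply/forallP/forallP => h i; apply/forallP => j.
  apply/implyP => ij; have /forallP/(_ j) := h i; rewrite ij /= => /specializesP.
  by move=> /(_ [set i]%SET); rewrite !inE eqxx => /(_ isT isT) /eqP ->.
have /forallP/(_ j)/implyP := h i => {}h; apply/implyP => ij.
by rewrite (eqP (h ij)) specializes_refl.
Qed.

Lemma kolmogorov_specializes T : kolmogorov T =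
  [forall i, forall j, specializes T i j ==> specializes T j i ==> (i == j)].
Proof.
apply/forallP/forallP => h i; apply/forallP => j; have /forallP/(_ j) := h i.
  move=> /implyP ne; apply/implyP => /specializesP ij; apply/implyP => /specializesP ji.
  apply: contraT => /ne /exists_inP[U UT]; case: (boolP (i \in U)) => [/ij -> //|].
  by case: (boolP (j \in U)) => [/ji ->|].
move=> /implyP ne; apply/implyP => nij; apply: contraT => /exists_inPn h'.
have ij : specializes T i j.
  by apply/specializesP => U /h'; rewrite negbK => /eqP ->.
have ji : specializes T j i.
  by apply/specializesP => U /h'; rewrite negbK => /eqP ->.
by have := ne ij; rewrite ji (negPf nij).
Qed.

End Specialization.

(** * Preorders as sets of off-diagonal pairs, and functions with such superlevel sets *)

Section OffDiagonal.
Variable Y : finType.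

(* A preorder, encoded by its pairs of distinct elements. *)
Definition preorder_set (B : {set Y * Y}) :=
  [forall i, (i, i) \notin B] &&
  [forall i, forall j, forall k,
    (i != k) ==> ((i, j) \in B) ==> ((j, k) \in B) ==> ((i, k) \in B)].

Lemma preorder_setP (B : {set Y * Y}) :
  reflect ((forall i, (i, i) \notin B) /\
           (forall i j k, i != k -> (i, j) \in B -> (j, k) \in B -> (i, k) \in B))
          (preorder_set B).
Proof.
apply: (iffP andP) => -[Birr Btr]; split.
- exact/forallP.
- move=> i j k ik ij jk.
  by have /forallP/(_ j)/forallP/(_ k) := forallP Btr i; rewrite ik ij jk.
- exact/forallP.
apply/forallP => i; apply/forallP => j; apply/forallP => k.
by apply/implyP => ik; apply/implyP => ij; apply/implyP => jk; exact: (Btr _ j).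
Qed.

(** The empty set of pairs is the discrete topology, the set of all pairs the indiscrete one. *)
Definition proper_preorder (B : {set Y * Y}) :=
  [&& B != finset.set0, preorder_set B & [exists i, exists j, (i != j) && ((i, j) \notin B)]].

Definition strict_order (B : {set Y * Y}) :=
  [&& B != finset.set0, preorder_set B &
      [forall i, forall j, ((i, j) \in B) ==> ((j, i) \notin B)]].

Section Levels.
Variable R : realType.
Implicit Type f : Y * Y -> R.

(** A reversed ultrametric inequality, which says that all superlevel sets are transitive. It spares
    [i = k] because the diagonal is 0 by convention. *)
Definition fuzzy_preorder f := [/\ forall p, 0 <= f p, forall i, f (i, i) = 0 &
  forall i j k, i != k -> Num.min (f (i, j)) (f (j, k)) <= f (i, k)].

Lemma fuzzy_preorder_level f s : fuzzy_preorder f -> 0 <= s ->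
  preorder_set [set p | s < f p]%SET.
Proof.
move=> [f0 fd ft] s0; apply/preorder_setP; split=> [i|i j k ik].
  by rewrite inE fd -leNgt.
by rewrite !inE => ij jk; apply: lt_le_trans (ft i j k ik); rewrite lt_min ij.
Qed.

Lemma level_fuzzy_preorder f : (forall p, 0 <= f p) ->
  (forall s p, 0 <= s < f p -> preorder_set [set p | s < f p]%SET) ->
  fuzzy_preorder f.
Proof.
move=> f0 fP; split=> // [i|i j k ik].
  apply/eqP; rewrite eq_le f0 andbT leNgt; apply/negP => fi.
  have /preorder_setP[/(_ i)] := fP 0 (i, i) (introT andP (conj (lexx 0) fi)).
  by rewrite inE fi.
(* Otherwise the superlevel set at height [f (i, k)] would contain both steps but not their
   composite. *)
rewrite leNgt lt_min; apply/negP => /andP[ij jk].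
have /preorder_setP[_ /(_ i j k ik)] := fP (f (i, k)) (i, j) (introT andP (conj (f0 _) ij)).
by rewrite !inE ij jk ltxx => /(_ isT isT).
Qed.

Lemma levels_proper_preorderP (f : {ptws Y * Y -> R}) :
  levels proper_preorder f <-> [/\ fuzzy_preorder f, forall p, f p <= 1,
    exists p, f p = 1 & exists i j, i != j /\ f (i, j) = 0].
Proof.
split=> [[f01 [p fp] fP]|[fu f1 fp1 [i [j [ij fij]]]]].
  have f0 q : 0 <= f q by have /andP[] := f01 q.
  split.
  - by apply: level_fuzzy_preorder => // s q /fP /and3P[].
  - by move=> q; have /andP[] := f01 q.
  - by exists p.
  have /and3P[_ _ /existsP[i /existsP[j /andP[ij]]]] :
      proper_preorder [set q | 0 < f q]%SET by apply: (fP 0 p); rewrite lexx fp ltr01.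
  rewrite inE -leNgt => fij; exists i, j; split => //; apply/eqP.
  by rewrite eq_le fij f0.
have [f0 _ _] := fu; split => // [q|s q /andP[s0 sq]]; first by rewrite f0 f1.
apply/and3P; split; last 2 first.
- exact: fuzzy_preorder_level.
- by apply/existsP; exists i; apply/existsP; exists j; rewrite ij inE fij -leNgt.
by apply/set0Pn; exists q; rewrite inE.
Qed.

Lemma levels_strict_orderP (f : {ptws Y * Y -> R}) :
  levels strict_order f <-> [/\ fuzzy_preorder f, forall p, f p <= 1,
    exists p, f p = 1 & forall i j, Num.min (f (i, j)) (f (j, i)) = 0].
Proof.
split=> [[f01 [p fp] fP]|[fu f1 fp1 fa]].
  have f0 q : 0 <= f q by have /andP[] := f01 q.
  split.
  - by apply: level_fuzzy_preorder => // s q /fP /and3P[].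
  - by move=> q; have /andP[] := f01 q.
  - by exists p.
  move=> i j; apply/eqP; rewrite eq_le le_min !f0 !andbT leNgt lt_min.
  apply/negP => /andP[fij fji].
  have /and3P[_ _ /forallP/(_ i)/forallP/(_ j)] :
      strict_order [set q | 0 < f q]%SET by apply: (fP 0 (i, j)); rewrite lexx fij.
  by rewrite !inE fij fji.
have [f0 _ _] := fu; split => // [q|s q /andP[s0 sq]]; first by rewrite f0 f1.
apply/and3P; split.
- by apply/set0Pn; exists q; rewrite inE.
- exact: fuzzy_preorder_level.
apply/forallP => i; apply/forallP => j; rewrite !inE -leNgt; apply/implyP => ij.
rewrite leNgt; apply/negP => ji.
by have := fa i j; apply/eqP; rewrite gt_eqF // lt_min !(le_lt_trans s0).
Qed.

End Levels.
End OffDiagonal.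

(** * Transfer from topologies on X to functions on the pairs of a relabelled set Y *)

Section TopologyLevels.
Variables (R : realType) (X Y : finType) (e : Y -> X).
Hypothesis e_bij : bijective e.

Definition specialization_set (T : top X) : {set Y * Y} :=
  [set p | (p.1 != p.2) && specializes T (e p.1) (e p.2)]%SET.

Let e_inj : injective e := bij_inj e_bij.

Lemma mem_specialization_set T i j :
  ((i, j) \in specialization_set T) = (i != j) && specializes T (e i) (e j).
Proof. by rewrite inE. Qed.

Lemma specialization_set_sub T1 T2 :
  (specialization_set T2 \subset specialization_set T1) = (T1 <= T2)%O.
Proof.
have [e' eK e'K] := e_bij.
rewrite le_top_specializes; apply/fintype.subsetP/forallP => [h i|h [i j]].
  apply/forallP => j; have [->|ij] := eqVneq i j; first by rewrite !specializes_refl.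
  have := h (e' i, e' j); rewrite !mem_specialization_set !e'K (inj_eq (can_inj e'K)) ij.
  by move/implyP.
rewrite !mem_specialization_set => /andP[-> /=]; apply/implyP.
by have /forallP := h (e i).
Qed.

Lemma specialization_set_inj : injective specialization_set.
Proof.
move=> T1 T2 E; apply/eqP; rewrite eq_le -!specialization_set_sub E.
by rewrite !fintype.subxx.
Qed.

Lemma preorder_setE (B : {set Y * Y}) :
  preorder_set B <-> exists T, specialization_set T = B.
Proof.
have [e' eK e'K] := e_bij; split=> [/preorder_setP[Birr Btr]|[T <-]].
  pose r : rel X := fun i j => (i == j) || ((e' i, e' j) \in B).
  have rr : reflexive r by move=> i; rewrite /r eqxx.
  have rt : transitive r.
    move=> j i k; rewrite /r => /predU1P[->//|ij] /predU1P[<-|jk]; first by rewrite ij orbT.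
    have [//|ik] := eqVneq i k; apply: (Btr _ (e' j)) => //.
    by rewrite (inj_eq (can_inj e'K)).
  exists (alexandrov r); apply/setP => -[i j].
  rewrite mem_specialization_set (specializes_alexandrov rr rt) /r !eK (inj_eq e_inj).
  by have [->|ij] := eqVneq i j => //=; rewrite (negPf (Birr j)).
apply/preorder_setP; split=> [i|i j k ik]; first by rewrite mem_specialization_set eqxx.
rewrite !mem_specialization_set ik => /andP[_ ij] /andP[_ jk].
exact: specializes_trans ij jk.
Qed.

Lemma specialization_set_eq0 T : (specialization_set T == finset.set0) = (T == \top)%O.
Proof.
rewrite -(inj_eq specialization_set_inj); congr (_ == _); apply/esym/setP => -[i j].
rewrite mem_specialization_set finset.in_set0; apply/negbTE; rewrite negb_and negbK.
have := eq_top_specializes (\top%O : top X); rewrite eqxx.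
move=> /esym/forallP/(_ (e i))/forallP/(_ (e j)).
by rewrite (inj_eq e_inj); case: (specializes _ _ _); case: eqP.
Qed.

Lemma specialization_set_neqT T :
  [exists i, exists j, (i != j) && ((i, j) \notin specialization_set T)] = (T != \bot)%O.
Proof.
have [e' eK e'K] := e_bij.
rewrite eq_bot_specializes; apply/existsP/forallPn => -[i].
  case/existsP => j; rewrite mem_specialization_set => /andP[-> ij].
  by exists (e i); apply/forallPn; exists (e j).
case/forallPn => j ij; exists (e' i); apply/existsP; exists (e' j).
rewrite mem_specialization_set !e'K negb_and negbK ij orbT andbT.
by rewrite (inj_eq (can_inj e'K)); apply: contraNneq ij => ->; exact: specializes_refl.
Qed.

Lemma specialization_set_anti T :
  [forall i, forall j, ((i, j) \in specialization_set T) ==>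
     ((j, i) \notin specialization_set T)] = kolmogorov T.
Proof.
have [e' eK e'K] := e_bij.
rewrite kolmogorov_specializes; apply/forallP/forallP => h i; apply/forallP => j.
  have /forallP/(_ (e' j)) := h (e' i); rewrite !mem_specialization_set !e'K.
  rewrite !(inj_eq (can_inj e'K)) (eq_sym j).
  by case: (i =P j) => //= _; do 2 case: (specializes _ _ _).
have /forallP/(_ (e j)) := h (e i); rewrite !mem_specialization_set.
rewrite (inj_eq e_inj) (eq_sym j).
by case: (i =P j) => //= _; do 2 case: (specializes _ _ _).
Qed.

Lemma homotopy_equivalent_top_levels (A : pred (top X)) (P : pred {set Y * Y})
    (C : topologicalType) :
  (forall T, A T = P (specialization_set T)) ->
  (forall B, P B -> (B != finset.set0) && preorder_set B) ->
  (compact [set: set_type (@levels R _ P)] ->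
    homotopy_equivalent R (set_type (@levels R _ P)) C) ->
  homotopy_equivalent R (realization R (order_complex (subposet A))) C.
Proof.
move=> AP P0.
apply: (@homotopy_equivalent_levels R _ _ (subposet A) (fun x => specialization_set (val x))).
- by move=> x y /specialization_set_inj/val_inj.
- by move=> x; have := valP x; rewrite AP => /P0/andP[].
- move=> x y; rewrite !specialization_set_sub orbC.
  by rewrite /Order.comparable -!leEsub.
- move=> B; split=> [PB|[x <-]]; last by rewrite -AP; exact: valP.
  have /andP[_ /preorder_setE[T TB]] := P0 _ PB.
  by have AT : A T by [rewrite AP TB]; exists (Sub T AT); rewrite SubK.
Qed.

Lemma homotopy_equivalent_proper_top (C : topologicalType) :
  (compact [set: set_type (@levels R _ (@proper_preorder Y))] ->
    homotopy_equivalent R (set_type (@levels R _ (@proper_preorder Y))) C) ->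
  homotopy_equivalent R (realization R (order_complex
    (subposet (fun T : top X => (T != \bot)%O && (T != \top)%O)))) C.
Proof.
apply: homotopy_equivalent_top_levels => [T|B /and3P[-> ->]//].
rewrite /proper_preorder specialization_set_eq0 specialization_set_neqT andbC.
have -> // : preorder_set (specialization_set T) by apply/preorder_setE; exists T.
Qed.

Lemma homotopy_equivalent_kolmogorov (C : topologicalType) :
  homotopy_equivalent R (set_type (@levels R _ (@strict_order Y))) C ->
  homotopy_equivalent R (realization R (order_complex
    (subposet (fun T : top X => kolmogorov T && (T != \top)%O)))) C.
Proof.
move=> h; apply: homotopy_equivalent_top_levels (fun=> h) => [T|B /and3P[-> ->]//].
rewrite /strict_order specialization_set_eq0 specialization_set_anti andbC.
have -> // : preorder_set (specialization_set T) by apply/preorder_setE; exists T.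
Qed.

End TopologyLevels.

(** * Normalization *)

Section Normalization.
Variables (R : realType) (A : finType).
Implicit Type f : A -> R.

(** The default 0 matters: it makes the value nonnegative even where [f] is negative, as in
    [excess]. *)
Definition maxf f := \big[Num.max/0]_a f a.

Lemma le_maxf f a : f a <= maxf f.
Proof. exact: le_bigmax. Qed.

Lemma maxf_ge0 f : 0 <= maxf f.
Proof. exact: bigmax_ge_id. Qed.

Lemma maxf_le f c : 0 <= c -> (forall a, f a <= c) -> maxf f <= c.
Proof. by move=> c0 fc; apply/bigmax_leP; split. Qed.

Lemma maxf_attained f : 0 < maxf f -> exists a, f a = maxf f.
Proof.
move=> m0; apply: contrapT => h.
have : maxf f < maxf f; last by rewrite ltxx.
apply/bigmax_ltP; split => // a _; rewrite lt_neqAle le_maxf andbT.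
by apply/eqP => fa; apply: h; exists a.
Qed.

Lemma maxfE f c a : f a = c -> 0 <= c -> (forall a, f a <= c) -> maxf f = c.
Proof. by move=> fa c0 fc; apply/eqP; rewrite eq_le maxf_le //= -fa le_maxf. Qed.

Lemma cvg_maxf (T : Type) (G : set_system T) (FG : Filter G) (f : T -> A -> R) (l : A -> R) :
  (forall a, (fun z => f z a) @ G --> l a) -> (fun z => maxf (f z)) @ G --> maxf l.
Proof. by move=> fl; apply: cvg_bigmaxr. Qed.

Variable P : pred {set A}.

(** Radial projection onto the functions of maximum 1, made total by the default [p]. At the apex of
    a cone, the direction is thus [p] by convention. *)
Definition normalize (p : set_type (levels P)) f : set_type (levels P) :=
  insubd p ((fun a => f a / maxf f) : {ptws A -> R}).

Definition normalizable f := levels P ((fun a => f a / maxf f) : {ptws A -> R}).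

Lemma val_normalize p f a : normalizable f -> set_val (normalize p f) a = f a / maxf f.
Proof.
by rewrite /normalizable => /mem_set fP; rewrite /normalize set_valE val_insubd fP.
Qed.

Lemma maxf_levels (x : set_type (levels P)) : maxf (set_val x) = 1.
Proof.
have [x01 [a xa] _] := levelsP x; apply: (maxfE xa) => // b.
by have /andP[] := x01 b.
Qed.

Lemma normalize_id p (x : set_type (levels P)) : normalize p (set_val x) = x.
Proof.
apply: val_inj; apply/funext => a.
have H : normalizable (set_val x).
  rewrite /normalizable maxf_levels (_ : (fun _ => _) = set_val x); first exact: levelsP.
  by apply/funext => b; rewrite divr1.
by have := val_normalize p a H; rewrite maxf_levels divr1 set_valE.
Qed.

Lemma cvg_normalize p (T : Type) (G : set_system T) (FG : Filter G)
    (f : T -> A -> R) (l : A -> R) :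
  (forall a, (fun z => f z a) @ G --> l a) -> maxf l != 0 ->
  normalizable l -> (\forall z \near G, normalizable (f z)) ->
  (fun z => normalize p (f z)) @ G --> normalize p l.
Proof.
move=> fl l0 lP fP; apply: coord_cvg => a.
rewrite (val_normalize p a lP).
apply: cvg_trans (cvgM (fl a) (cvgV l0 (cvg_maxf FG fl))).
apply: near_eq_cvg; near=> z; rewrite /= val_normalize //.
by near: z.
Unshelve. all: by end_near. Qed.

End Normalization.

Section Cones.
Variables (R : realType) (Y : finType).
Implicit Type f : Y * Y -> R.

Lemma fuzzy_preorder_scale f c : 0 <= c -> fuzzy_preorder f ->
  fuzzy_preorder (fun p => c * f p).
Proof.
move=> c0 [f0 fd ft]; split=> [p|i|i j k ik]; first by rewrite mulr_ge0.
  by rewrite fd mulr0.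
by rewrite -minr_pMr // ler_wpM2l // ft.
Qed.

Lemma normalizable_strict_order f : fuzzy_preorder f -> 0 < maxf f ->
  (forall i j, Num.min (f (i, j)) (f (j, i)) = 0) -> normalizable (@strict_order Y) f.
Proof.
move=> fu m0 fa; apply/levels_strict_orderP; have mi := ltW m0; split.
- rewrite (_ : (fun _ => _) = fun p => (maxf f)^-1 * f p).
    by apply: fuzzy_preorder_scale => //; rewrite invr_ge0.
  by apply/funext => p; rewrite mulrC.
- by move=> p; rewrite ler_pdivrMr // mul1r le_maxf.
- by have [p fp] := maxf_attained m0; exists p; rewrite fp divff ?gt_eqF.
- by move=> i j; rewrite -minr_pMl ?fa ?mul0r // invr_ge0.
Qed.

Lemma normalizable_proper_preorder f : fuzzy_preorder f -> 0 < maxf f ->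
  (exists i j, i != j /\ f (i, j) = 0) -> normalizable (@proper_preorder Y) f.
Proof.
move=> fu m0 [i [j [ij fij]]]; apply/levels_proper_preorderP; have mi := ltW m0; split.
- rewrite (_ : (fun _ => _) = fun p => (maxf f)^-1 * f p).
    by apply: fuzzy_preorder_scale => //; rewrite invr_ge0.
  by apply/funext => p; rewrite mulrC.
- by move=> p; rewrite ler_pdivrMr // mul1r le_maxf.
- by have [p fp] := maxf_attained m0; exists p; rewrite fp divff ?gt_eqF.
- by exists i, j; rewrite fij mul0r.
Qed.

End Cones.

(** * Convergence and normalization in spheres *)

Section Sphere.
Variables (R : realType) (d : nat).

Lemma cvg_rV (n : nat) (T : Type) (G : set_system T) (FG : Filter G) (f : T -> 'rV[R]_n)
    (l : 'rV[R]_n) : (forall i, (fun z => f z 0 i) @ G --> l 0 i) -> f @ G --> l.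
Proof.
move=> fl U [Q nQ QU].
have : \forall z \near G, forall i, Q 0 i (f z 0 i).
  by apply: filter_forall => i; apply: (fl i); exact: nQ.
move=> H; apply: (@filterS _ G FG _ _ _ H) => z /= Qz; apply: QU => i j.
by rewrite ord1.
Qed.

Lemma cvg_sphere (T : Type) (G : set_system T) (FG : Filter G) (f : T -> sphere R d)
    (l : sphere R d) :
  (forall i, (fun z => set_val (f z) 0 i) @ G --> set_val l 0 i) -> f @ G --> l.
Proof. by move=> fl; apply: cvg_set_type; exact: cvg_rV. Qed.

Lemma sphere_cvg (T : Type) (G : set_system T) (FG : Filter G) (f : T -> sphere R d)
    (l : sphere R d) i :
  f @ G --> l -> (fun z => set_val (f z) 0 i) @ G --> set_val l 0 i.
Proof.
move=> fl; apply: (@cvg_comp _ _ _ (fun z => set_val (f z)) (fun x : 'rV[R]_d.+1 => x 0 i) _ _ _ _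
  (@coord_continuous R _ _ 0 i (set_val l))).
exact: (@cvg_set_val _ _ T G FG f l fl).
Qed.

Lemma hausdorff_sphere : hausdorff_space (sphere R d).
Proof. by apply: hausdorff_set_type; exact: norm_hausdorff. Qed.

Lemma sphereP (x : sphere R d) : \sum_i set_val x 0 i ^+ 2 = 1.
Proof. exact: set_mem (svalP x). Qed.

Definition sqnorm (y : 'I_d.+1 -> R) := \sum_i y i ^+ 2.

Definition to_sphere (y : 'I_d.+1 -> R) : sphere R d :=
  insubd (sphere_pt R d) (\row_i (y i / Num.sqrt (sqnorm y))).

Lemma sqnorm_ge0 y : 0 <= sqnorm y.
Proof. by apply: sumr_ge0 => i _; exact: sqr_ge0. Qed.

Lemma sqnorm_gt0 y i : y i != 0 -> 0 < sqnorm y.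
Proof.
move=> yi; rewrite /sqnorm (bigD1 i) //= ltr_wpDr ?sumr_ge0 // => [j _|].
  exact: sqr_ge0.
by rewrite lt_neqAle sqr_ge0 eq_sym sqrf_eq0 yi.
Qed.

Lemma val_to_sphere y i : 0 < sqnorm y ->
  set_val (to_sphere y) 0 i = y i / Num.sqrt (sqnorm y).
Proof.
move=> y0; rewrite /to_sphere set_valE val_insubd ifT ?mxE //.
apply/mem_set; rewrite /unit_sphere /=.
under eq_bigr do rewrite mxE expr_div_n sqr_sqrtr ?sqnorm_ge0 //.
by rewrite -mulr_suml divff // gt_eqF.
Qed.

Lemma to_sphere_id (x : sphere R d) : to_sphere (fun i => set_val x 0 i) = x.
Proof.
have x1 : sqnorm (fun i => set_val x 0 i) = 1 by exact: sphereP.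
apply: val_inj; apply/rowP => i.
have := @val_to_sphere (fun i => set_val x 0 i) i; rewrite x1 sqrtr1 divr1 => /(_ ltr01).
by rewrite !set_valE.
Qed.

Lemma cvg_to_sphere (T : Type) (G : set_system T) (FG : Filter G)
    (f : T -> 'I_d.+1 -> R) (l : 'I_d.+1 -> R) :
  (forall i, (fun z => f z i) @ G --> l i) -> 0 < sqnorm l ->
  (forall z, 0 < sqnorm (f z)) ->
  (fun z => to_sphere (f z)) @ G --> to_sphere l.
Proof.
move=> fl l0 f0; apply: cvg_sphere => i; rewrite val_to_sphere //.
under eq_fun do rewrite val_to_sphere //.
apply: cvgM; first exact: fl.
apply: cvgV; first by rewrite sqrtr_eq0 -ltNge.
apply: (@cvg_comp _ _ _ (fun z => sqnorm (f z)) (@Num.sqrt R) _ _ _ _ (@sqrt_continuous R (sqnorm l))).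
by apply: cvg_sumr => j; rewrite expr2; under eq_fun do rewrite expr2; apply: cvgM; exact: fl.
Qed.

End Sphere.

Section Clamp.
Variable R : realType.

(** Homotopies are given by formulas valid at all real times, so that their continuity needs no
    restriction to the unit interval. *)
Definition clamp (u : R) := Num.max 0 (Num.min 1 u).

Lemma clamp_ge0 u : 0 <= clamp u.
Proof. by rewrite le_max lexx. Qed.

Lemma clamp_le1 u : clamp u <= 1.
Proof. by rewrite ge_max ler01 ge_min lexx. Qed.

Lemma clamp0 u : u <= 0 -> clamp u = 0.
Proof. by move=> u0; apply: max_l; rewrite ge_min u0 orbT. Qed.

Lemma clamp1 u : 1 <= u -> clamp u = 1.
Proof. by move=> u1; rewrite /clamp (min_l u1) max_r. Qed.

Lemma cvg_clamp (T : Type) (G : set_system T) (FG : Filter G) (f : T -> R) l :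
  f @ G --> l -> (fun z => clamp (f z)) @ G --> clamp l.
Proof.
by move=> fl; apply: cvg_maxr; [exact: cvg_cst|apply: cvg_minr; [exact: cvg_cst|]].
Qed.

End Clamp.

(** * Partial orders *)

Section StrictOrders.
Variables (R : realType) (d : nat).

Notation Y := (option 'I_d.+1).
Notation F := (set_type (@levels R _ (@strict_order Y))).

(** Vectors indexed by [Y] up to constants are normalized to vanish at [None], hence also the
    subtraction in [height]. A nonconstant vector becomes a nonzero one with [d.+1] entries. *)
Let ext (x : 'I_d.+1 -> R) (i : Y) : R := oapp x 0 i.

Let slope (x : 'I_d.+1 -> R) (p : Y * Y) : R := Num.max 0 (ext x p.2 - ext x p.1).

Let height (f : Y * Y -> R) (i : 'I_d.+1) : R :=
  \sum_k f (k, Some i) - \sum_k f (k, None).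

Lemma ext_height f i j :
  ext (height f) j - ext (height f) i = \sum_k f (k, j) - \sum_k f (k, i).
Proof. by case: i j => [i|] [j|] //=; rewrite /height; lra. Qed.

(** Along [i], [j], [k], either the first slope vanishes or the total rise exceeds the second
    rise. *)
Lemma fuzzy_slope x : fuzzy_preorder (slope x).
Proof.
split=> [p|i|i j k _]; rewrite /slope /=; first by rewrite le_max lexx.
  by rewrite subrr maxxx.
rewrite !ge_min !ge_max !le_max !lexx /=.
case: (lerP (ext x j) (ext x i)) => ij.
  by apply/orP; left; apply/orP; left; rewrite subr_le0.
by apply/orP; right; apply/orP; right; lra.
Qed.

Lemma anti_slope x i j : Num.min (slope x (i, j)) (slope x (j, i)) = 0.
Proof.
rewrite /slope /=; case: (lerP (ext x j) (ext x i)) => ij.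
  have -> : Num.max 0 (ext x j - ext x i) = 0 by apply: max_l; rewrite subr_le0.
  by apply: min_l; rewrite le_max lexx.
have -> : Num.max 0 (ext x i - ext x j) = 0 by apply: max_l; rewrite subr_le0 ltW.
by apply: min_r; rewrite le_max lexx.
Qed.

Lemma maxf_slope_gt0 (x : 'I_d.+1 -> R) i : x i != 0 -> 0 < maxf (slope x).
Proof.
move=> xi; case: (ltrgtP (x i) 0) => // h; last by rewrite h eqxx in xi.
  apply: lt_le_trans (le_maxf _ (Some i, None)).
  by rewrite /slope /= lt_max sub0r oppr_gt0 h orbT.
apply: lt_le_trans (le_maxf _ (None, Some i)).
by rewrite /slope /= lt_max subr0 h orbT.
Qed.

Lemma normalizable_slope (x : 'I_d.+1 -> R) : 0 < maxf (slope x) ->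
  normalizable (@strict_order Y) (slope x).
Proof.
move=> m0; apply: normalizable_strict_order => //; first exact: fuzzy_slope.
exact: anti_slope.
Qed.

(** By transitivity through the full step, each [x (k, j)] is at least [x (k, i)], and [k = i]
    contributes 1; at [k = j], antisymmetry gives [x (j, i) = 0]. Such a pair is the witness that
    neither homotopy below degenerates. *)
Lemma height_step (x : F) i j : set_val x (i, j) = 1 ->
  0 < \sum_k set_val x (k, j) - \sum_k set_val x (k, i).
Proof.
move=> xij; have /levels_strict_orderP[[x0 xd xt] x1 _ xa] := levelsP x.
rewrite -sumrB (bigD1 i) //= xd xij subr0 ltr_pwDl ?sumr_ge0 // => k ki.
rewrite subr_ge0; have [->|kj] := eqVneq k j; first last.
  have := xt k i j kj; rewrite xij min_l //; exact: x1.
by have := xa i j; rewrite xd xij (min_r (x1 _)) => ->.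
Qed.

Lemma ext_neq0 (x : 'I_d.+1 -> R) i j : ext x i < ext x j -> exists k, x k != 0.
Proof.
case: i j => [i|] [j|] /=; rewrite ?ltxx // => ij.
- by have [xi|] := eqVneq (x i) 0; [exists j; rewrite gt_eqF // -xi|exists i].
- by exists i; rewrite lt_eqF.
- by exists j; rewrite gt_eqF.
Qed.

Lemma levels_max (x : F) : exists i j, set_val x (i, j) = 1.
Proof. by have [_ [[i j] xij] _] := levelsP x; exists i, j. Qed.

Lemma sqnorm_height (x : F) : 0 < sqnorm (height (set_val x)).
Proof.
have [i [j /height_step]] := levels_max x.
by rewrite -ext_height subr_gt0 => /ext_neq0[k /sqnorm_gt0].
Qed.

Let base : F := exist (fun f => f \in @levels R _ (@strict_order Y)) _
  (mem_set (normalizable_slope (@maxf_slope_gt0 (fun=> 1) 0 (oner_neq0 R)))).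

Let to_level (x : sphere R d) : F := normalize base (slope (fun i => set_val x 0 i)).

Let to_sph (x : F) : sphere R d := to_sphere (height (set_val x)).

Lemma maxf_slope_sphere (x : sphere R d) : 0 < maxf (slope (fun i => set_val x 0 i)).
Proof.
have [/existsP[i /maxf_slope_gt0//]|/existsPn h] := boolP [exists i, set_val x 0 i != 0].
have := sphereP x; rewrite big1 => [/eqP|i _]; first by rewrite eq_sym oner_eq0.
by apply/eqP; rewrite sqrf_eq0; have := h i; rewrite negbK.
Qed.

Lemma cvg_slope (T : Type) (G : set_system T) (FG : Filter G) (f : T -> 'I_d.+1 -> R) l p :
  (forall i, (fun z => f z i) @ G --> l i) ->
  (fun z => slope (f z) p) @ G --> slope l p.
Proof.
move=> fl; apply: cvg_maxr; first exact: cvg_cst.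
have fe i : (fun z => ext (f z) i) @ G --> ext l i.
  by case: i => [i|] /=; [exact: fl|exact: cvg_cst].
exact: cvgB.
Qed.

Lemma cvg_height (T : Type) (G : set_system T) (FG : Filter G) (f : T -> Y * Y -> R) l i :
  (forall p, (fun z => f z p) @ G --> l p) ->
  (fun z => height (f z) i) @ G --> height l i.
Proof. by move=> fl; apply: cvgB; apply: cvg_sumr => k; exact: fl. Qed.

Lemma cvg_to_level (T : Type) (G : set_system T) (FG : Filter G) (f : T -> sphere R d) l :
  f @ G --> l -> (fun z => to_level (f z)) @ G --> to_level l.
Proof.
move=> fl; apply: (@cvg_normalize R _ _ base T G FG (fun z => slope (fun i => set_val (f z) 0 i))).
- move=> p; apply: (@cvg_slope T G FG (fun z i => set_val (f z) 0 i)) => i.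
  exact: (@sphere_cvg R d T G FG f l i fl).
- by rewrite gt_eqF // maxf_slope_sphere.
- exact: normalizable_slope (maxf_slope_sphere l).
- by apply: nearW => z; exact: normalizable_slope (maxf_slope_sphere _).
Qed.

Lemma cvg_to_sph (T : Type) (G : set_system T) (FG : Filter G) (f : T -> F) l :
  f @ G --> l -> (fun z => to_sph (f z)) @ G --> to_sph l.
Proof.
move=> fl; apply: (@cvg_to_sphere R d T G FG (fun z => height (set_val (f z)))).
- move=> i; apply: (@cvg_height T G FG (fun z => set_val (f z))) => p.
  exact: (@cvg_coord R _ _ T G FG f l p fl).
- exact: sqnorm_height.
- by move=> z; exact: sqnorm_height.
Qed.

Let segment (x : sphere R d) (u : R) (i : 'I_d.+1) : R :=
  (1 - clamp u) * height (set_val (to_level x)) i + clamp u * set_val x 0 i.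

Lemma ext_lin a b (x y : 'I_d.+1 -> R) i :
  ext (fun k => a * x k + b * y k) i = a * ext x i + b * ext y i.
Proof. by case: i => [i|] //=; rewrite !mulr0 addr0. Qed.

(** A pair of steepest slope is separated in the same direction by [x] and by the heights of its
    image, hence by every point of the segment between them. *)
Lemma sqnorm_segment x u : 0 < sqnorm (segment x u).
Proof.
have [i [j xij]] := levels_max (to_level x).
have : ext (segment x u) i < ext (segment x u) j.
  rewrite /segment !ext_lin -subr_gt0.
  have := height_step xij; rewrite -ext_height.
  have : 0 < ext (fun i => set_val x 0 i) j - ext (fun i => set_val x 0 i) i.
    rewrite ltNge; apply/negP => h; move: xij.
    rewrite val_normalize; last exact: normalizable_slope (maxf_slope_sphere _).
    by rewrite {1}/slope /= (max_l h) mul0r => /eqP; rewrite eq_sym oner_eq0.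
  set a := ext _ j; set b := ext _ i; set a' := ext _ j; set b' := ext _ i => ab ab'.
  have := clamp_ge0 u; have := clamp_le1 u; set v := clamp u => v1 v0.
  have -> : (1 - v) * a' + v * a - ((1 - v) * b' + v * b) = (1 - v) * (a' - b') + v * (a - b).
    by lra.
  have [->|vn0] := eqVneq v 0; first by lra.
  have h1 : 0 <= (1 - v) * (a' - b') by apply: mulr_ge0; [lra|exact: ltW].
  apply: (ltr_wpDl h1); apply: mulr_gt0 => //.
  by rewrite lt_neqAle eq_sym vn0.
by move/ext_neq0 => [k /sqnorm_gt0].
Qed.

(* Capping [f] and [g] by constants keeps superlevel sets transitive; since one
   of the two caps vanishes, they also remain antisymmetric. *)
Let cap (f g : Y * Y -> R) (v w : R) (p : Y * Y) : R :=
  Num.min (Num.max (f p) v) (Num.max (g p) w).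

Lemma normalizable_cap (x y : F) v w p : 0 <= v -> 0 <= w -> v = 0 \/ w = 0 ->
  set_val x p = 1 -> 0 < set_val y p ->
  normalizable (@strict_order Y) (cap (set_val x) (set_val y) v w) /\
  0 < maxf (cap (set_val x) (set_val y) v w).
Proof.
move=> v0 w0 vw xp yp.
have /levels_strict_orderP[[x0 xd xt] x1 _ xa] : levels (@strict_order Y) (set_val x).
  exact: levelsP.
have /levels_strict_orderP[[y0 yd yt] y1 _ ya] : levels (@strict_order Y) (set_val y).
  exact: levelsP.
have c0 q : 0 <= cap (set_val x) (set_val y) v w q.
  by rewrite /cap le_min !le_max x0 y0.
have m0 : 0 < maxf (cap (set_val x) (set_val y) v w).
  apply: lt_le_trans (le_maxf _ p).
  by rewrite /cap lt_min !lt_max yp xp ltr01.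
split=> //; apply: normalizable_strict_order => //.
- split=> // [i|i j k ik].
  + by rewrite /cap xd yd (max_r v0) (max_r w0); case: vw => ->; rewrite ?(min_l w0) ?(min_r v0).
  + rewrite /cap minACA -!max_minl; apply: le_min2; apply: le_max2 => //.
      exact: xt.
    exact: yt.
- move=> i j; apply/eqP; rewrite eq_le le_min !c0 !andbT.
  case: vw => E.
    rewrite -(xa i j) /cap E !(max_l (x0 _)).
    by apply: le_min2; rewrite ge_min lexx.
  rewrite -(ya i j) /cap E !(max_l (y0 _)).
  by apply: le_min2; rewrite ge_min lexx orbT.
Qed.

Lemma to_level_to_sph_gt0 (x : F) p : set_val x p = 1 ->
  0 < set_val (to_level (to_sph x)) p.
Proof.
case: p => i j xp.
rewrite val_normalize; last exact: normalizable_slope (maxf_slope_sphere _).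
rewrite divr_gt0 ?maxf_slope_sphere // /slope /= lt_max subr_gt0; apply/orP; right.
have -> : (fun k => set_val (to_sph x) 0 k) =
    (fun k => (Num.sqrt (sqnorm (height (set_val x))))^-1 * height (set_val x) k + 0 * 0).
  by apply/funext => k; rewrite val_to_sphere ?sqnorm_height // mul0r addr0 mulrC.
rewrite (@ext_lin _ 0 (height (set_val x)) (fun=> 0)) (@ext_lin _ 0 (height (set_val x)) (fun=> 0)).
rewrite !mul0r !addr0 ltr_pM2l; last by rewrite invr_gt0 sqrtr_gt0 sqnorm_height.
by rewrite -subr_gt0 ext_height height_step.
Qed.

Lemma homotopy_equivalent_strict_order : homotopy_equivalent R F (sphere R d).
Proof.
exists to_sph, to_level; split.
- by move=> x; exact: (@cvg_to_sph F (nbhs x) _ id x cvg_id).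
- by move=> x; exact: (@cvg_to_level (sphere R d) (nbhs x) _ id x cvg_id).
(* At time 0 the caps are 1 and 0, which leaves [to_level (to_sph x)]. At time 1/2 both are 0, which
   gives the pointwise minimum of the two functions, and at time 1 only [x] is left. *)
- pose H (z : F * R) : F := normalize base
    (cap (set_val z.1) (set_val (to_level (to_sph z.1)))
         (clamp (1 - 2 * z.2)) (clamp (2 * z.2 - 1))).
  have vw u : clamp (1 - 2 * u) = 0 \/ clamp (2 * u - 1 : R) = 0.
    by case: (lerP (2 * u) 1) => h; [right|left]; apply: clamp0; lra.
  have nH (z : F * R) := let: ex_intro i (ex_intro j xij) := levels_max z.1 in
    normalizable_cap (clamp_ge0 _) (clamp_ge0 _) (vw z.2) xij (to_level_to_sph_gt0 xij).
  apply: (@homotopic_continuous R _ _ _ _ H) => [[x u]|x|x].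
  + have cx : (fun z : F * R => z.1) @ nbhs (x, u) --> x by exact: cvg_fst.
    have cu : (fun z : F * R => z.2) @ nbhs (x, u) --> u by exact: cvg_snd.
    apply: (@cvg_normalize R _ _ base _ (nbhs (x, u)) _ (fun z : F * R =>
      cap (set_val z.1) (set_val (to_level (to_sph z.1)))
         (clamp (1 - 2 * z.2)) (clamp (2 * z.2 - 1)))).
    * move=> p; apply: cvg_minr; apply: cvg_maxr.
      - exact: (@cvg_coord R _ _ _ (nbhs (x, u)) _ fst x p cx).
      - apply: cvg_clamp; apply: cvgB; first exact: cvg_cst.
        by apply: cvgM; [exact: cvg_cst|exact: cu].
      - apply: (@cvg_coord R _ _ _ (nbhs (x, u)) _ (fun z => to_level (to_sph z.1)) (to_level (to_sph x)) p).
        apply: (@cvg_to_level _ (nbhs (x, u)) _ (fun z => to_sph z.1)).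
        exact: (@cvg_to_sph _ (nbhs (x, u)) _ (fun z => z.1)).
      - apply: cvg_clamp; apply: cvgB; last exact: cvg_cst.
        by apply: cvgM; [exact: cvg_cst|exact: cu].
    * by rewrite gt_eqF //; have [] := nH (x, u).
    * by have [] := nH (x, u).
    * by apply: nearW => z; have [] := nH z.
  + rewrite /H /= mulr0 subr0 sub0r clamp1 // (@clamp0 _ (-1)) ?oppr_le0 //.
    rewrite -[RHS](normalize_id base); congr normalize; apply/funext => p.
    have /levels_strict_orderP[[y0 _ _] y1 _ _] := levelsP (to_level (to_sph x)).
    have /levels_strict_orderP[_ x1 _ _] := levelsP x.
    by rewrite /cap (max_r (x1 p)) (max_l (y0 p)) (min_r (y1 p)).
  + rewrite /H /= (@clamp0 _ (1 - 2 * 1)) ?clamp1; [|lra|lra].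
    rewrite -[RHS](normalize_id base); congr normalize; apply/funext => p.
    have /levels_strict_orderP[_ y1 _ _] := levelsP (to_level (to_sph x)).
    have /levels_strict_orderP[[x0 _ _] x1 _ _] := levelsP x.
    by rewrite /cap (max_r (y1 p)) (max_l (x0 p)) (min_l (x1 p)).
- pose H (z : sphere R d * R) : sphere R d := to_sphere (segment z.1 z.2).
  apply: (@homotopic_continuous R _ _ _ _ H) => [[x u]|x|x].
  + have cx : (fun z : sphere R d * R => z.1) @ nbhs (x, u) --> x by exact: cvg_fst.
    have cu : (fun z : sphere R d * R => clamp z.2) @ nbhs (x, u) --> clamp u.
      by apply: cvg_clamp; exact: cvg_snd.
    apply: (@cvg_to_sphere R d _ (nbhs (x, u)) _ (fun z : sphere R d * R => segment z.1 z.2)).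
    * move=> i; apply: cvgD; apply: cvgM.
      - by apply: cvgB; [exact: cvg_cst|exact: cu].
      - apply: (@cvg_height _ (nbhs (x, u)) _ (fun z => set_val (to_level z.1))) => p.
        apply: (@cvg_coord R _ _ _ (nbhs (x, u)) _ (fun z => to_level z.1) (to_level x) p).
        exact: (@cvg_to_level _ (nbhs (x, u)) _ (fun z => z.1)).
      - exact: cu.
      - exact: (@sphere_cvg R d _ (nbhs (x, u)) _ (fun z => z.1) x i cx).
    * exact: sqnorm_segment.
    * by move=> z; exact: sqnorm_segment.
  + rewrite /H /= /to_sph; congr to_sphere; apply/funext => i.
    by rewrite /segment clamp0 // subr0 mul1r mul0r addr0.
  + rewrite /H /= -[RHS](to_sphere_id x); congr to_sphere; apply/funext => i.
    by rewrite /segment clamp1 // subrr mul0r mul1r add0r.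
Qed.

End StrictOrders.

(** * Proper preorders *)

Section FuzzyProper.
Variables (R : realType) (Y : finType).
Implicit Type f : Y * Y -> R.

(** With no condition on the maximum, this is the infinite cone over the space of levels, its apex
    being the zero function. *)
Definition fuzzy_proper f := fuzzy_preorder f /\ exists i j, i != j /\ f (i, j) = 0.

Lemma fuzzy_proper_levels (z : set_type (@levels R _ (@proper_preorder Y))) :
  fuzzy_proper (set_val z).
Proof. by have /levels_proper_preorderP[] := levelsP z. Qed.

Lemma normalizable_fuzzy_proper f : fuzzy_proper f -> 0 < maxf f ->
  normalizable (@proper_preorder Y) f.
Proof. by move=> [fu fz] m0; apply: normalizable_proper_preorder. Qed.

Lemma fuzzy_proper_scale f c : 0 <= c -> fuzzy_proper f -> fuzzy_proper (fun p => c * f p).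
Proof.
move=> c0 [fu [i [j [ij fij]]]]; split; first exact: fuzzy_preorder_scale.
by exists i, j; rewrite fij mulr0.
Qed.

Lemma fuzzy_proper_ge0 f p : fuzzy_proper f -> 0 <= f p.
Proof. by case=> -[]. Qed.

Lemma maxf0 f p : fuzzy_proper f -> maxf f <= 0 -> f p = 0.
Proof.
move=> fp m0; apply/eqP; rewrite eq_le (le_trans (le_maxf f p)) //=.
exact: fuzzy_proper_ge0.
Qed.

Lemma maxf_scale (A : finType) (f : A -> R) c : 0 <= c ->
  maxf (fun p => c * f p) = c * maxf f.
Proof.
move=> c0; apply/eqP; rewrite eq_le maxf_le ?mulr_ge0 ?maxf_ge0 //=; last first.
  by move=> a; rewrite ler_wpM2l // le_maxf.
have [m0|] := ltP 0 (maxf f); last first.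
  move=> m0; apply: le_trans (maxf_ge0 _); rewrite -(mulr0 c) ler_wpM2l //.
by have [a <-] := maxf_attained m0; exact: (le_maxf (fun p => c * f p)).
Qed.

Lemma normalize_scale (A : finType) (P : pred {set A}) (p : set_type (levels P))
    (f : A -> R) c : 0 < c -> normalize p (fun a => c * f a) = normalize p f.
Proof.
move=> c0; congr insubd; apply/funext => a; rewrite maxf_scale ?ltW //.
by rewrite -mulf_div divff ?mul1r // gt_eqF.
Qed.

End FuzzyProper.

(* The cone over [F] is made of the functions [s] with [maxf s <= m], [F] itself
   corresponding to [maxf s = m]. Given a contraction [h] of [D] to [p], [cone_map]
   moves, relative to [F], the cone over [D] into [F]: the ray through [z] is sent
   to the path that goes down the ray of [p], then, with directions [h (h (z, 1), _)]
   and [h (z, _)], up to [z]. The path goes down to the apex only where [psi] vanishes. *)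
Section ConeMap.
Variables (R : realType) (Y : finType).
Notation F := (set_type (@levels R _ (@proper_preorder Y))).
Variables (p : F) (psi : F -> R) (h : F * R -> F) (D : set F).
Hypotheses (psi_cont : continuous psi) (psi01 : forall z, 0 <= psi z <= 1).
Hypotheses (psi_p : psi p = 1) (psiD : forall z, 0 < psi z -> D z).
Hypotheses (h_cont : continuous h) (h0 : forall z, h (z, 0) = z).
Hypotheses (hD : forall z u, D z -> D (h (z, u))) (h1 : forall z, D z -> h (z, 1) = p).
Implicit Types (s : Y * Y -> R) (m u : R).

(** The constants cut the radius [maxf s / m] into thirds. From time 1/2 on, [h (z, _)] is run
    through in the outer third and [h (h (z, 1), _)] in the middle one; the direction is constant in
    the inner one. *)
Let dir m u s : F :=
  h (h (normalize p s, clamp (2 * u) * clamp (3 - 3 * (maxf s / m))),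
     clamp (2 * u) * clamp (2 - 3 * (maxf s / m))).

(** Where it is positive, [h (z, 1)] lies in [D], so that a second run of the contraction ends at
    [p]. *)
Let bump s : R := psi (h (normalize p s, 1)).

(** By time 1/2, the inner two thirds of the radius are sent to the apex and the outer third is
    stretched over the full height. The second half of the time lifts this towards [m] in proportion
    to [bump s]. *)
Let height m u s : R := (1 - clamp (2 * u)) * maxf s + clamp (2 * u) *
  (clamp (2 * u - 1) * bump s * m +
   (1 - clamp (2 * u - 1) * bump s) * Num.max 0 (3 * maxf s - 2 * m)).

(** Supported in the inner third. It completes [height] so that the image of the apex,
    [clamp (2 * u - 1) * m] times [p], does not depend on the ray, although [bump s] does. *)
Let drop m u s : R := clamp (2 * u - 1) * Num.max 0 (m - 3 * maxf s) * (1 - bump s).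

Definition cone_map m u s (q : Y * Y) : R :=
  height m u s * set_val (dir m u s) q + drop m u s * set_val p q.

Lemma bump_itv s : 0 <= bump s <= 1. Proof. exact: psi01. Qed.

Lemma clamp_split u : clamp (2 * u - 1) = 0 \/ clamp (2 * u) = 1 :> R.
Proof. by case: (lerP (2 * u) 1) => h'; [left; apply: clamp0|right; apply: clamp1]; lra. Qed.

Lemma height_bound m u s : maxf s <= m -> 0 <= height m u s <= m.
Proof.
move=> sm; rewrite /height; have /andP[b0 b1] := bump_itv s.
have := maxf_ge0 s; have := clamp_ge0 (2 * u); have := clamp_le1 (2 * u).
have := clamp_ge0 (2 * u - 1); have := clamp_le1 (2 * u - 1).
set v := clamp (2 * u); set w := clamp (2 * u - 1); set b := bump s.
set M := maxf s in sm * => w1 w0 v1 v0 M0.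
have m0 : 0 <= m by lra.
have [k0 km] : 0 <= Num.max 0 (3 * M - 2 * m) /\ Num.max 0 (3 * M - 2 * m) <= m.
  by rewrite le_max lexx ge_max m0 /=; split=> //; lra.
set k := Num.max _ _ in k0 km *.
have wb0 : 0 <= w * b by rewrite mulr_ge0.
have wb1 : w * b <= 1 by rewrite mulr_ile1.
have [j0 jm] : 0 <= w * b * m + (1 - w * b) * k /\ w * b * m + (1 - w * b) * k <= m.
  split; first by rewrite addr_ge0 // mulr_ge0 // subr_ge0.
  have : (1 - w * b) * k <= (1 - w * b) * m by rewrite ler_wpM2l // subr_ge0.
  lra.
set j := _ + _ in j0 jm *.
apply/andP; split; first by rewrite addr_ge0 // mulr_ge0 // subr_ge0.
have : (1 - v) * M <= (1 - v) * m by rewrite ler_wpM2l // subr_ge0.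
have : v * j <= v * m by rewrite ler_wpM2l.
lra.
Qed.

Lemma drop_eq0 m u s : clamp (2 * u - 1) = 0 \/ m <= 3 * maxf s -> drop m u s = 0.
Proof.
rewrite /drop; case=> [->|ms]; first by rewrite !mul0r.
by rewrite (max_l _) ?mulr0 ?mul0r // subr_le0.
Qed.

(** In the inner third, either [bump s] is 0 and the height vanishes, or the direction has reached
    [p]; both terms are multiples of [p]. *)
Lemma cone_map_apex m u s q : 0 <= maxf s -> 3 * maxf s < m -> clamp (2 * u - 1) != 0 ->
  cone_map m u s q =
  clamp (2 * u - 1) * (m - 3 * maxf s * (1 - bump s)) * set_val p q.
Proof.
move=> M0 sm w0; case: (clamp_split u) => [w0'|v1]; first by rewrite w0' eqxx in w0.
have m0 : 0 < m by lra.
have l1 : maxf s / m <= 1 / 3 by rewrite ler_pdivrMr //; lra.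
have l0 : 0 <= maxf s / m by rewrite divr_ge0 // ltW.
have b0 : bump s != 0 -> dir m u s = p.
  have c3 : clamp (3 - 3 * (maxf s / m)) = 1 by apply: clamp1; lra.
  have c2 : clamp (2 - 3 * (maxf s / m)) = 1 by apply: clamp1; lra.
  move=> bn; rewrite /dir v1 c3 c2 !mulr1.
  apply/h1/psiD; rewrite lt_neqAle eq_sym bn /=; by have /andP[] := bump_itv s.
rewrite /cone_map /height /drop v1 (max_l _) ?(max_r _); try lra.
rewrite subrr mul0r add0r mul1r mulr0 addr0.
have [->|/b0 ->] := eqVneq (bump s) 0; last by ring.
by rewrite !mulr0 !mul0r add0r !subr0 !mulr1.
Qed.

(** A sum of two fuzzy preorders need not be one; here both terms always lie on a common ray, from
    which the required properties are read off. *)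
Lemma cone_map_ray m u s : fuzzy_proper s -> maxf s <= m ->
  exists k (e : F), [/\ forall q, cone_map m u s q = k * set_val e q, 0 <= k <= m &
    (0 < maxf s -> D (normalize p s)) -> k = 0 \/ D e].
Proof.
move=> sp sm; have M0 := maxf_ge0 s.
have [dr|ndr] := pselect (clamp (2 * u - 1) = 0 \/ m <= 3 * maxf s).
  exists (height m u s), (dir m u s); split.
  - by move=> q; rewrite /cone_map drop_eq0 // mul0r addr0.
  - exact: height_bound.
  move=> Dz; have [M1|M1] := ltP 0 (maxf s); first by right; apply/hD/hD/Dz.
  have M00 : maxf s = 0 by lra.
  left; rewrite /height M00 mulr0 add0r mulr0 sub0r (max_l _); last by lra.
  rewrite mulr0 addr0; case: dr => [->|]; first by rewrite !mul0r mulr0.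
  rewrite M00 => m0; have -> : m = 0 by lra.
  by rewrite !mulr0.
have w0 : clamp (2 * u - 1) != 0 by apply/eqP => w0; apply: ndr; left.
have ms : 3 * maxf s < m by rewrite ltNge; apply/negP => ms; apply: ndr; right.
exists (clamp (2 * u - 1) * (m - 3 * maxf s * (1 - bump s))), p; split.
- by move=> q; rewrite cone_map_apex.
- have /andP[b0 b1] := bump_itv s.
  have a0 : 0 <= 3 * maxf s * (1 - bump s) by rewrite mulr_ge0 ?subr_ge0 // mulr_ge0.
  have a1 : 3 * maxf s * (1 - bump s) <= 3 * maxf s * 1.
    by rewrite ler_wpM2l ?mulr_ge0 //; lra.
  apply/andP; split; first by rewrite mulr_ge0 ?clamp_ge0 //; lra.
  by rewrite -[leRHS]mul1r ler_pM ?clamp_ge0 ?clamp_le1 //; lra.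
- by right; apply/psiD; rewrite psi_p.
Qed.

Lemma maxf_val (e : F) k : 0 <= k -> maxf (fun q => k * set_val e q) = k.
Proof. by move=> k0; rewrite maxf_scale // maxf_levels mulr1. Qed.

Lemma fuzzy_proper_cone_map m u s : fuzzy_proper s -> maxf s <= m ->
  fuzzy_proper (cone_map m u s) /\ maxf (cone_map m u s) <= m.
Proof.
move=> sp sm; have [k [e [E /andP[k0 km] _]]] := cone_map_ray u sp sm.
have -> : cone_map m u s = fun q => k * set_val e q by exact/funext.
rewrite maxf_val //; split=> //.
by apply: fuzzy_proper_scale => //; exact: fuzzy_proper_levels.
Qed.

Lemma cone_map_D m u s : fuzzy_proper s -> maxf s <= m ->
  (0 < maxf s -> D (normalize p s)) ->
  0 < maxf (cone_map m u s) -> D (normalize p (cone_map m u s)).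
Proof.
move=> sp sm Dz; have [k [e [E /andP[k0 km] De]]] := cone_map_ray u sp sm.
have -> : cone_map m u s = fun q => k * set_val e q by exact/funext.
rewrite maxf_val // => k1; rewrite normalize_scale // normalize_id.
by case: (De Dz) => // k00; rewrite k00 ltxx in k1.
Qed.

Lemma normalize_valK s q : fuzzy_proper s ->
  maxf s * set_val (normalize p s) q = s q.
Proof.
move=> sp; have [M0|M0] := ltP 0 (maxf s); last first.
  rewrite (maxf0 q sp M0) (_ : maxf s = 0) ?mul0r //.
  by apply/eqP; rewrite eq_le M0 maxf_ge0.
rewrite val_normalize; last exact: normalizable_fuzzy_proper.
by rewrite mulrC divfK // gt_eqF.
Qed.

Lemma cone_map_start m s : fuzzy_proper s -> cone_map m 0 s = s.
Proof.
move=> sp; apply/funext => q; rewrite /cone_map drop_eq0; last by left; apply: clamp0; lra.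
rewrite mul0r addr0 /height /dir mulr0 !(@clamp0 R 0) // !mul0r !h0 subr0 mul1r addr0.
exact: normalize_valK.
Qed.

Lemma cone_map_boundary m u s : fuzzy_proper s -> maxf s = m -> cone_map m u s = s.
Proof.
move=> sp sm; apply/funext => q; have M0 := maxf_ge0 s.
rewrite /cone_map drop_eq0; last by right; lra.
have [M1|M1] := ltP 0 (maxf s); last first.
  have m0 : m = 0 by lra.
  rewrite (maxf0 q sp M1) /height sm m0 !mulr0 subrr maxxx mulr0 !addr0 mulr0.
  by rewrite addr0 !mul0r addr0.
have mm : maxf s / m = 1 by rewrite sm divff // gt_eqF // -sm.
have c3 : clamp (3 - 3 * (maxf s / m)) = 0 by rewrite mm; apply: clamp0; lra.
have c2 : clamp (2 - 3 * (maxf s / m)) = 0 by rewrite mm; apply: clamp0; lra.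
rewrite mul0r addr0 /dir c3 c2 !mulr0 !h0 -sm.
rewrite /height (max_r _); last by lra.
set v := clamp _; set w := clamp _ * _.
have -> : (1 - v) * maxf s + v * (w * maxf s + (1 - w) * (3 * maxf s - 2 * maxf s)) = maxf s.
  by ring.
exact: normalize_valK.
Qed.

Lemma cone_map_end m s : fuzzy_proper s -> maxf s <= m ->
  (0 < maxf s -> D (normalize p s)) -> maxf (cone_map m 1 s) = m.
Proof.
move=> sp sm Dz; have M0 := maxf_ge0 s.
have [v1 w1] : clamp (2 * 1) = 1 :> R /\ clamp (2 * 1 - 1) = 1 :> R.
  by rewrite !clamp1 //; lra.
have [M1|M1] := ltP 0 (maxf s).
  have b1 : bump s = 1 by rewrite /bump h1 ?psi_p //; exact: Dz.
  have -> : cone_map m 1 s = fun q => m * set_val (dir m 1 s) q.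
    apply/funext => q; rewrite /cone_map /height /drop b1 v1 w1 !subrr !mulr1 !mul0r mulr0.
    by ring.
  by rewrite maxf_val //; lra.
have Ms : maxf s = 0 by lra.
have [m0|m0] := ltP 0 m; last first.
  have [_] := fuzzy_proper_cone_map 1 sp sm.
  by have := maxf_ge0 (cone_map m 1 s); lra.
have -> : cone_map m 1 s = fun q => m * set_val p q.
  apply/funext => q; rewrite cone_map_apex ?w1 ?oner_neq0 //; last by lra.
  by rewrite Ms mulr0 mul0r subr0 mul1r.
by rewrite maxf_val //; lra.
Qed.

(** The direction has no limit at the apex. Continuity there comes from this bound, whose constant
    only has to be uniform. *)
Lemma cone_map_near_apex m u s q : fuzzy_proper s -> maxf s <= m ->
  `|cone_map m u s q - clamp (2 * u - 1) * m * set_val p q| <= 6 * maxf s.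
Proof.
move=> sp sm; have M0 := maxf_ge0 s.
have w0 := clamp_ge0 (2 * u - 1); have w1 := clamp_le1 (2 * u - 1).
have /andP[p0 p1] : 0 <= set_val p q <= 1 by have [] := levelsP p.
have m0 : 0 <= m by lra.
have [ms|ms] := lerP m (3 * maxf s).
  have wm : clamp (2 * u - 1) * m <= m by rewrite -[leRHS]mul1r ler_wpM2r.
  have wm0 : 0 <= clamp (2 * u - 1) * m by rewrite mulr_ge0.
  have wp1 : clamp (2 * u - 1) * m * set_val p q <= m.
    by apply: le_trans wm; rewrite -[leRHS]mulr1 ler_wpM2l.
  have wp0 : 0 <= clamp (2 * u - 1) * m * set_val p q by rewrite mulr_ge0.
  have [k [e [-> /andP[k0 km] _]]] := cone_map_ray u sp sm.
  have /andP[e0 e1] : 0 <= set_val e q <= 1 by have [] := levelsP e.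
  have ke1 : k * set_val e q <= m by apply: le_trans km; rewrite -[leRHS]mulr1 ler_wpM2l.
  have ke0 : 0 <= k * set_val e q by rewrite mulr_ge0.
  by rewrite ler_norml; apply/andP; split; lra.
have [w00|wn0] := eqVneq (clamp (2 * u - 1)) 0.
  rewrite /cone_map drop_eq0; last by left.
  rewrite w00 !mul0r subr0 addr0 /height w00 (max_l _); last by lra.
  rewrite mulr0 mul0r mul0r addr0 mulr0 addr0.
  have /andP[e0 e1] : 0 <= set_val (dir m u s) q <= 1 by have [] := levelsP (dir m u s).
  have := clamp_ge0 (2 * u); have := clamp_le1 (2 * u); set v := clamp _ => v1 v0.
  have vM : (1 - v) * maxf s <= maxf s by rewrite -[leRHS]mul1r ler_wpM2r //; lra.
  have vM0 : 0 <= (1 - v) * maxf s by rewrite mulr_ge0 // subr_ge0.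
  rewrite ger0_norm ?(mulr_ge0 vM0 e0) //.
  have : (1 - v) * maxf s * set_val (dir m u s) q <= (1 - v) * maxf s.
    by rewrite -[leRHS]mulr1 ler_wpM2l.
  lra.
rewrite cone_map_apex //; have /andP[b0 b1] := bump_itv s.
set w := clamp _ in w0 w1 *; set b := bump s in b0 b1 *.
have -> : w * (m - 3 * maxf s * (1 - b)) * set_val p q - w * m * set_val p q =
  - (w * (3 * maxf s * (1 - b)) * set_val p q) by ring.
have b4 : 0 <= 1 - b by lra.
have b2 : 0 <= 3 * maxf s * (1 - b) by apply: mulr_ge0 => //; apply: mulr_ge0.
have b3 : 3 * maxf s * (1 - b) <= 3 * maxf s by rewrite -[leRHS]mulr1 ler_wpM2l ?mulr_ge0 //; lra.
have wb0 : 0 <= w * (3 * maxf s * (1 - b)) by exact: mulr_ge0.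
rewrite normrN ger0_norm ?(mulr_ge0 wb0 p0) //.
have : w * (3 * maxf s * (1 - b)) * set_val p q <= w * (3 * maxf s * (1 - b)).
  by rewrite -[leRHS]mulr1 ler_wpM2l.
have : w * (3 * maxf s * (1 - b)) <= 3 * maxf s * (1 - b) by rewrite -[leRHS]mul1r ler_wpM2r.
lra.
Qed.

Lemma cvg_cone_map (T : Type) (G : set_system T) (FG : Filter G)
    (m u : T -> R) (s : T -> Y * Y -> R) m0 u0 s0 q :
  m @ G --> m0 -> u @ G --> u0 -> (forall q, (fun z => s z q) @ G --> s0 q) ->
  fuzzy_proper s0 -> maxf s0 <= m0 ->
  (\forall z \near G, fuzzy_proper (s z) /\ maxf (s z) <= m z) ->
  (fun z => cone_map (m z) (u z) (s z) q) @ G --> cone_map m0 u0 s0 q.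
Proof.
move=> mm uu ss sp0 sm0 sp.
have MM : (fun z => maxf (s z)) @ G --> maxf s0 by exact: cvg_maxf.
have c2 c : (fun z => clamp (2 * u z - c)) @ G --> clamp (2 * u0 - c).
  by apply: cvg_clamp; apply: cvgB; [apply: cvgM; [exact: cvg_cst|]|exact: cvg_cst].
have c20 : (fun z => clamp (2 * u z)) @ G --> clamp (2 * u0).
  by apply: cvg_clamp; apply: cvgM; [exact: cvg_cst|].
have M0 := maxf_ge0 s0.
have [M1|M1] := ltP 0 (maxf s0); last first.
  have M00 : maxf s0 = 0 by lra.
  have E : cone_map m0 u0 s0 q = clamp (2 * u0 - 1) * m0 * set_val p q.
    apply/eqP; rewrite -subr_eq0 -normr_le0.
    by have := cone_map_near_apex u0 q sp0 sm0; rewrite M00 mulr0.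
  rewrite E -[X in _ --> X]add0r.
  have -> : (fun z => cone_map (m z) (u z) (s z) q) = (fun z =>
      (cone_map (m z) (u z) (s z) q - clamp (2 * u z - 1) * m z * set_val p q)
      + clamp (2 * u z - 1) * m z * set_val p q) by apply/funext => z; rewrite subrK.
  apply: cvgD; last first.
    apply: cvgM; last exact: cvg_cst.
    by apply: cvgM.
  apply/norm_cvg0P.
  apply: (@squeeze_cvgr _ _ _ _ (fun=> 0) (fun z => 6 * maxf (s z))).
  - near=> z; rewrite normr_ge0 /=.
    have [sp' sm'] : fuzzy_proper (s z) /\ maxf (s z) <= m z by near: z.
    exact: cone_map_near_apex.
  - exact: cvg_cst.
  - have MM6 : (fun z => 6 * maxf (s z)) @ G --> 6 * maxf s0.
      by apply: cvgM => //; exact: cvg_cst.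
    by rewrite M00 mulr0 in MM6.
have m1 : 0 < m0 by lra.
have nn : (fun z => normalize p (s z)) @ G --> normalize p s0.
  apply: (@cvg_normalize R _ _ p T G FG s s0) => //; first by rewrite gt_eqF.
    exact: normalizable_fuzzy_proper.
  have gt0 : \forall z \near G, 0 < maxf (s z) by exact: (cvgr_gt _ MM).
  near=> z; apply: normalizable_fuzzy_proper; last by near: z.
  by have [] : fuzzy_proper (s z) /\ maxf (s z) <= m z by near: z.
have hh (f : T -> F) (g : T -> R) (f0 : F) (g0 : R) : f @ G --> f0 -> g @ G --> g0 ->
    (fun z => h (f z, g z)) @ G --> h (f0, g0).
  move=> ff gg; apply: (@cvg_comp _ _ _ (fun z => (f z, g z)) h _ _ _ _ (@h_cont (f0, g0))).
  exact: cvg_pairT.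
have ll c : (fun z => clamp (2 * u z) * clamp (c - 3 * (maxf (s z) / m z))) @ G -->
    clamp (2 * u0) * clamp (c - 3 * (maxf s0 / m0)).
  apply: cvgM => //; apply: cvg_clamp; apply: cvgB; first exact: cvg_cst.
  apply: cvgM; first exact: cvg_cst.
  by apply: cvgM => //; apply: cvgV => //; rewrite gt_eqF.
have dd : (fun z => dir (m z) (u z) (s z)) @ G --> dir m0 u0 s0.
  exact: (hh _ _ _ _ (hh _ _ _ _ nn (ll 3)) (ll 2)).
have bb : (fun z => bump (s z)) @ G --> bump s0.
  apply: (@cvg_comp _ _ _ (fun z => h (normalize p (s z), 1)) psi _ _ _ _ (@psi_cont _)).
  exact: (hh _ _ _ _ nn (@cvg_cst R 1 T G FG)).
apply: cvgD; apply: cvgM.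
- apply: cvgD; apply: cvgM => //; first by apply: cvgB => //; exact: cvg_cst.
  apply: cvgD; apply: cvgM => //; first by apply: cvgM.
    by apply: cvgB; [exact: cvg_cst|exact: cvgM].
  apply: cvg_maxr; first exact: cvg_cst.
  by apply: cvgB; apply: cvgM => //; exact: cvg_cst.
- exact: (@cvg_coord R _ _ T G FG _ _ q dd).
- apply: cvgM; last by apply: cvgB => //; exact: cvg_cst.
  apply: cvgM => //; apply: cvg_maxr; first exact: cvg_cst.
  by apply: cvgB => //; apply: cvgM => //; exact: cvg_cst.
- exact: cvg_cst.
Unshelve. all: by end_near. Qed.

End ConeMap.

(** * Adding a point *)

Section NewPoint.
Variables (R : realType) (Y : finType).
Notation X := (option Y).
Implicit Types (t : X * X -> R) (s : Y * Y -> R) (a b : Y).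

(** When [upper t a < lower t a], the superlevel set at height [upper t a] identifies [None] with
    [a] and relates nothing else. *)
Definition lower t a := Num.min (t (None, Some a)) (t (Some a, None)).

Definition others a : pred (X * X) :=
  fun q => (q != (None, Some a)) && (q != (Some a, None)).

Definition upper t a := \big[Num.max/0]_(q | others a q) t q.

Definition restrict t (q : Y * Y) : R := t (Some q.1, Some q.2).

(* [None] is a twin of [a], up to its relations with [a] itself. *)
Definition twin a (al be : R) s (q : X * X) : R :=
  match q with
  | (Some i, Some j) => s (i, j)
  | (None, Some j) => if j == a then al else s (a, j)
  | (Some i, None) => if i == a then be else s (i, a)
  | (None, None) => 0
  end.

Lemma le_upper t a q : others a q -> t q <= upper t a.
Proof. by move=> oq; rewrite /upper (bigD1 q) //= le_max lexx. Qed.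

Lemma upper_ge0 t a : 0 <= upper t a.
Proof. exact: bigmax_ge_id. Qed.

Lemma upper_le t a c : 0 <= c -> (forall q, others a q -> t q <= c) -> upper t a <= c.
Proof. by move=> c0 tc; apply/bigmax_leP. Qed.

(** The pairs formed by [None] and [b] belong to [others a]. Hence [None] is a strict twin of at
    most one point. *)
Lemma lower_upper t a b : a != b -> lower t b <= upper t a.
Proof.
move=> ab; rewrite /lower ge_min; apply/orP; left; apply: le_upper.
by rewrite /others !xpair_eqE /= andbT; apply: contra ab => /eqP[->].
Qed.

Lemma upper_lower_uniq t a b : upper t a < lower t a -> upper t b < lower t b -> a = b.
Proof.
move=> ha hb; apply/eqP; apply: contraT => ab.
have := lower_upper t ab; have := lower_upper t (a := b) (b := a).
by rewrite eq_sym ab => /(_ isT); lra.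
Qed.

Lemma lower_scale t a (k : R) : 0 < k ->
  lower (fun q => k * t q) a = k * lower t a.
Proof. by move=> /ltW k0; rewrite /lower minr_pMr. Qed.

Lemma upper_scale t a (k : R) : 0 < k ->
  upper (fun q => k * t q) a = k * upper t a.
Proof.
move=> k0; have kk := ltW k0.
apply/eqP; rewrite eq_le upper_le ?mulr_ge0 ?upper_ge0 //=; last first.
  by move=> q oq; rewrite ler_pM2l // le_upper.
rewrite mulrC -ler_pdivlMr //; apply: upper_le => [|q oq].
  by rewrite divr_ge0 // upper_ge0.
by rewrite ler_pdivlMr // mulrC (le_upper (fun q => k * t q)).
Qed.

Lemma maxf_restrict_upper t a : maxf (restrict t) <= upper t a.
Proof.
apply: maxf_le; first exact: upper_ge0.
by move=> [i j]; apply: le_upper; rewrite /others !xpair_eqE andbF.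
Qed.

Lemma restrict_twin a al be s : restrict (twin a al be s) = s.
Proof. by apply/funext => -[i j]. Qed.

Lemma upper_twin a al be s : (forall i, s (i, i) = 0) -> upper (twin a al be s) a = maxf s.
Proof.
move=> sd; apply/eqP; rewrite eq_le; apply/andP; split; last first.
  by rewrite -{1}(restrict_twin a al be s); exact: maxf_restrict_upper.
apply: upper_le; first exact: maxf_ge0.
move=> [[i|] [j|]] /andP[] /=; rewrite ?maxf_ge0 ?le_maxf //.
  by move=> _; case: (i =P a) => [->|_]; rewrite ?eqxx ?le_maxf.
by case: (j =P a) => [->|_]; rewrite ?eqxx ?le_maxf.
Qed.

Lemma lower_twin a al be s : lower (twin a al be s) a = Num.min al be.
Proof. by rewrite /lower /= eqxx. Qed.

(** Transitivity is pulled back from [s] along the map [pi] that sends [None] to [a]; the two pairs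
    that [pi] collapses carry values that dominate [s]. *)
Lemma fuzzy_proper_twin a al be s : fuzzy_proper s -> maxf s <= Num.min al be ->
  fuzzy_proper (twin a al be s).
Proof.
move=> [[s0 sd st] [i0 [j0 [ij0 sij0]]]] sm.
have m0 : 0 <= Num.min al be by apply: le_trans sm; exact: maxf_ge0.
have /andP[al0 be0] : (0 <= al) && (0 <= be) by rewrite -le_min.
pose pi (i : X) := odflt a i.
have tE i j : twin a al be s (i, j) =
    if i == j then 0 else if pi i == pi j then (if i == None then al else be) else s (pi i, pi j).
  case: i j => [i|] [j|] //=; rewrite /pi /=.
  - have [/eqP[->]|ne] := boolP (Some i == Some j :> X); first by rewrite sd.
    by rewrite ifN //; apply: contra ne => /eqP ->.
  - by rewrite eq_sym.
have sM q : s q <= Num.min al be by apply: le_trans sm; exact: le_maxf.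
have alM : Num.min al be <= al by rewrite ge_min lexx.
have beM : Num.min al be <= be by rewrite ge_min lexx orbT.
split; last by exists (Some i0), (Some j0).
split.
- move=> [i j]; rewrite tE; case: ifP => // _; case: ifP => // _; by case: ifP.
- by move=> i; rewrite tE eqxx.
move=> i j k ik; rewrite !tE (negPf ik).
have mle (x y c : R) : (x <= c) || (y <= c) -> Num.min x y <= c by rewrite ge_min.
have pos : 0 <= (if pi i == pi k then if i == None then al else be else s (pi i, pi k)).
  by case: ifP => // _; case: ifP.
case: (boolP (i == j)) => [_|ij]; first by apply: mle; rewrite pos.
case: (boolP (j == k)) => [_|jk]; first by apply: mle; rewrite pos orbT.
case: (boolP (pi i == pi k)) => [/eqP pik|npik].
  have M : Num.min al be <= (if i == None then al else be) by case: ifP.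
  case: (boolP (pi i == pi j)) => [/eqP pij|_].
    exfalso; move: ik ij jk pij pik; rewrite /pi.
    by case: (i) => [i1|]; case: (j) => [j1|]; case: (k) => [k1|] //= + + + e1 e2;
      rewrite -?e1 -?e2 ?eqxx.
  by apply: mle; rewrite (le_trans (sM _) M).
case: (boolP (pi i == pi j)) => [/eqP pij|pij].
  by rewrite -pij (negPf npik); apply: mle; rewrite lexx orbT.
case: (boolP (pi j == pi k)) => [/eqP pjk|pjk]; first by apply: mle; rewrite pjk lexx.
exact: st.
Qed.

(** The entries between [None] and [a] dominate, so transitivity carries any other relation from one
    to the other without loss. If the zero of [t] lies between [None] and [a], then [t] vanishes on
    [Y], and the two given points provide a zero there. The inequality is weak in order to cover a
    closed set. *)
Lemma restrict_twin_eq t a : (exists y1 y2 : Y, y1 != y2) -> fuzzy_proper t ->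
  upper t a <= lower t a ->
  fuzzy_proper (restrict t) /\ t = twin a (t (None, Some a)) (t (Some a, None)) (restrict t).
Proof.
move=> [y1 [y2 y12]] [[t0 td tt] [i0 [j0 [ij0 tij0]]]] ul.
have up q : others a q -> t q <= lower t a by move=> /(le_upper t) h; exact: le_trans h ul.
have lal : lower t a <= t (None, Some a) by rewrite /lower ge_min lexx.
have lbe : lower t a <= t (Some a, None) by rewrite /lower ge_min lexx orbT.
have out j : j != a -> t (None, Some j) = t (Some a, Some j).
  move=> ja; have o1 : others a (None, Some j).
    by rewrite /others !xpair_eqE /= andbT; apply: contra ja => /eqP[->].
  have o2 : others a (Some a, Some j) by rewrite /others !xpair_eqE andbF.
  apply/eqP; rewrite eq_le; apply/andP; split.
    have : (Some a : X) != Some j by apply: contra ja => /eqP[->].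
    move=> /(tt (Some a) None (Some j)); rewrite min_r //; exact: le_trans (up _ o1) lbe.
  have := tt None (Some a) (Some j) isT; rewrite min_r //; exact: le_trans (up _ o2) lal.
have inn i : i != a -> t (Some i, None) = t (Some i, Some a).
  move=> ia; have o1 : others a (Some i, None).
    by rewrite /others !xpair_eqE /= andbT; apply: contra ia => /eqP[->].
  have o2 : others a (Some i, Some a) by rewrite /others !xpair_eqE andbF.
  apply/eqP; rewrite eq_le; apply/andP; split.
    have : (Some i : X) != Some a by apply: contra ia => /eqP[->].
    move=> /(tt (Some i) None (Some a)); rewrite min_l //; exact: le_trans (up _ o1) lal.
  have := tt (Some i) (Some a) None isT; rewrite min_l //; exact: le_trans (up _ o2) lbe.
have tE : t = twin a (t (None, Some a)) (t (Some a, None)) (restrict t).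
  apply/funext => -[[i|] [j|]] //=.
    by have [->|/inn] := eqVneq i a.
  by have [->|/out] := eqVneq j a.
split=> //; split.
  split=> [q|i|i j k ik]; [exact: t0|exact: td|].
  by apply: (tt (Some i) (Some j) (Some k)); apply: contra ik => /eqP[->].
have small : lower t a <= 0 -> restrict t (y1, y2) = 0.
  move=> l0; apply/eqP; rewrite eq_le t0 andbT; apply: le_trans l0; apply: le_trans ul.
  by apply: le_upper; rewrite /others !xpair_eqE andbF.
case: i0 j0 ij0 tij0 => [i|] [j|] //.
- by move=> ij tij; exists i, j; split=> //; apply: contra ij => /eqP ->.
- have [-> _ tij|ia _] := eqVneq i a; last by rewrite inn // => tij; exists i, a.
  by exists y1, y2; split=> //; apply: small; rewrite -tij.
- have [-> _ tij|ja _] := eqVneq j a; last first.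
    by rewrite out // => tij; exists a, j; rewrite eq_sym.
  by exists y1, y2; split=> //; apply: small; rewrite -tij.
Qed.

Lemma upper_maxf t a : (exists y1 y2 : Y, y1 != y2) -> fuzzy_proper t ->
  upper t a <= lower t a -> upper t a = maxf (restrict t).
Proof.
move=> hY tp ul; have [[[s0 sd st] _] tE] := restrict_twin_eq hY tp ul.
by rewrite {1}tE upper_twin.
Qed.

Lemma maxf_option t a : upper t a <= lower t a -> (forall p, 0 <= t p) ->
  maxf t = Num.max (t (None, Some a)) (t (Some a, None)).
Proof.
move=> ul t0; set al := t (None, Some a); set be := t (Some a, None).
apply/eqP; rewrite eq_le ge_max !le_maxf !andbT; apply: maxf_le.
  by rewrite le_max t0.
move=> q; have [oq|] := boolP (others a q).
  apply: le_trans (le_upper t oq) _; apply: le_trans ul _.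
  by rewrite /lower -/al -/be ge_min !le_max lexx.
by rewrite /others negb_and !negbK => /orP[] /eqP ->; rewrite le_max lexx ?orbT.
Qed.

Lemma cvg_lower (T : Type) (G : set_system T) (FG : Filter G) (f : T -> X * X -> R) l a :
  (forall q, (fun z => f z q) @ G --> l q) -> (fun z => lower (f z) a) @ G --> lower l a.
Proof. by move=> fl; apply: cvg_minr. Qed.

Lemma cvg_upper (T : Type) (G : set_system T) (FG : Filter G) (f : T -> X * X -> R) l a :
  (forall q, (fun z => f z q) @ G --> l q) -> (fun z => upper (f z) a) @ G --> upper l a.
Proof. by move=> fl; apply: cvg_bigmaxr. Qed.

Lemma cvg_twin (T : Type) (G : set_system T) (FG : Filter G) (al be : T -> R)
    (s : T -> Y * Y -> R) al0 be0 s0 a q :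
  al @ G --> al0 -> be @ G --> be0 -> (forall q, (fun z => s z q) @ G --> s0 q) ->
  (fun z => twin a (al z) (be z) (s z) q) @ G --> twin a al0 be0 s0 q.
Proof.
move=> ala beb ss; case: q => [[i|] [j|]] /=; first exact: ss.
- by case: (i == a).
- by case: (j == a).
- exact: cvg_cst.
Qed.

End NewPoint.

(** Gluing along a finite closed cover, in terms of filters: a closed member either contains the
    limit point or is eventually avoided. *)
Lemma cvg_cover (T : Type) (X : topologicalType) (I : finType) (G : set_system T)
    (FG : Filter G) (C : I -> T -> Prop) (f : T -> X) (l : X) :
  (\forall z \near G, exists i, C i z) ->
  (forall i, (\forall z \near G, ~ C i z) \/ f @ within (C i) G --> l) -> f @ G --> l.
Proof.
move=> Cov fC N nN.
have H : \forall z \near G, forall i, C i z -> N (f z).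
  apply: filter_forall => i; case: (fC i) => [nC|fl].
    by apply: filterS nC => z nCz /nCz.
  exact: (fl N nN).
exact: (@filterS2 _ G FG _ _ _ (fun z '(ex_intro i Ci) Hz => Hz i Ci) Cov H).
Qed.

(** * Motion of the cones attached to the twins of the new point *)

Section Push.
Variables (R : realType) (Y : finType).
Notation F := (set_type (@levels R _ (@proper_preorder Y))).
Notation X := (option Y).
Variables (p : F) (psi : F -> R) (h : F * R -> F) (D : set F).
Hypotheses (psi_cont : continuous psi) (psi01 : forall z, 0 <= psi z <= 1).
Hypotheses (psi_p : psi p = 1) (psiD : forall z, 0 < psi z -> D z).
Hypotheses (h_cont : continuous h) (h0 : forall z, h (z, 0) = z).
Hypotheses (hD : forall z u, D z -> D (h (z, u))) (h1 : forall z, D z -> h (z, 1) = p).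
Implicit Types (t : X * X -> R) (u : R).

(* Where [None] is a twin of [a], moves the restriction to [Y] in the cone over [F]
   of height [lower t a]. *)
Definition push u t : X * X -> R :=
  if [pick a | upper t a < lower t a] is Some a
  then twin a (t (None, Some a)) (t (Some a, None))
         (cone_map p psi h (lower t a) u (restrict t))
  else t.

(** The complement of the new cells, stated so as to be insensitive to scaling. *)
Definition outside t := forall a, upper t a < lower t a -> 0 < maxf (restrict t) ->
  D (normalize p (restrict t)).

Lemma two_points : exists y1 y2 : Y, y1 != y2.
Proof. by have [_ [i [j [ij _]]]] := fuzzy_proper_levels p; exists i, j. Qed.

(** In case of equality the restriction lies on the boundary of the cone, which [cone_map] fixes.
    The formula thus extends to a closed set, where it can be glued with the identity. *)
Lemma push_twin u t a : fuzzy_proper t -> upper t a <= lower t a ->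
  push u t = twin a (t (None, Some a)) (t (Some a, None))
    (cone_map p psi h (lower t a) u (restrict t)).
Proof.
move=> tp ul; rewrite /push; case: pickP => [b hb|/(_ a) nul].
  suff -> : b = a by [].
  apply/eqP; apply: contraT => ba; have := lower_upper t ba.
  by have := @lower_upper R Y t a b; rewrite eq_sym ba => /(_ isT); lra.
have [rp tE] := restrict_twin_eq two_points tp ul.
have um := upper_maxf two_points tp ul.
rewrite (cone_map_boundary p psi h0) //.
by apply/eqP; rewrite eq_le -um ul leNgt nul.
Qed.

Lemma push_outer u t : (forall a, lower t a <= upper t a) -> push u t = t.
Proof. by move=> lu; rewrite /push; case: pickP => // a; rewrite ltNge lu. Qed.

Lemma push_cases t : (exists a, upper t a < lower t a) \/ forall a, lower t a <= upper t a.
Proof.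
have [/existsP[a ul]|/existsPn h'] := boolP [exists a, upper t a < lower t a].
  by left; exists a.
by right => a; rewrite leNgt; exact: h'.
Qed.

Lemma restrict_cone t a : fuzzy_proper t -> upper t a <= lower t a ->
  fuzzy_proper (restrict t) /\ maxf (restrict t) <= lower t a.
Proof.
move=> tp ul; have [rp _] := restrict_twin_eq two_points tp ul.
by rewrite -(upper_maxf two_points tp ul).
Qed.

Lemma fuzzy_proper_push u t : fuzzy_proper t ->
  fuzzy_proper (push u t) /\ maxf (push u t) = maxf t.
Proof.
move=> tp; case: (push_cases t) => [[a /ltW ul]|/push_outer -> //].
have [rp rm] := restrict_cone tp ul.
have [cp cm] := fuzzy_proper_cone_map psi01 psi_p psiD hD h1 u rp rm.
rewrite (push_twin u tp ul); set s := cone_map _ _ _ _ _ _ in cp cm *.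
have sp : fuzzy_proper (twin a (t (None, Some a)) (t (Some a, None)) s).
  exact: fuzzy_proper_twin.
split=> //; have [[tw0 _ _] _] := sp; have [[t0 _ _] _] := tp.
rewrite (maxf_option ul t0) (@maxf_option _ _ _ a) //= ?eqxx //.
rewrite upper_twin; last by have [[_ sd _] _] := cp.
by rewrite lower_twin.
Qed.

Lemma push0 t : fuzzy_proper t -> push 0 t = t.
Proof.
move=> tp; case: (push_cases t) => [[a /ltW ul]|/push_outer -> //].
have [rp rm] := restrict_cone tp ul; rewrite (push_twin 0 tp ul).
rewrite (cone_map_start p psi h0) //.
by have [_ <-] := restrict_twin_eq two_points tp ul.
Qed.

(** Changing the restriction or the two large entries cannot make [None] a strict twin of another
    point. *)
Lemma lower_twin_other (s : Y * Y -> R) a b (al be : R) : (forall i, s (i, i) = 0) ->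
  maxf s <= Num.min al be -> a != b ->
  lower (twin a al be s) b <= upper (twin a al be s) b.
Proof.
move=> sd sm ab; apply: le_trans (lower_upper _ ab) _; rewrite upper_twin //.
apply: le_trans sm _; rewrite -(lower_twin a al be s).
by apply: lower_upper; rewrite eq_sym.
Qed.

Lemma outside_push u t : fuzzy_proper t -> outside t -> outside (push u t).
Proof.
move=> tp ot; case: (push_cases t) => [[a ult]|/push_outer -> //].
have ul := ltW ult; have [rp rm] := restrict_cone tp ul.
have [cp cm] := fuzzy_proper_cone_map psi01 psi_p psiD hD h1 u rp rm.
rewrite (push_twin u tp ul) => b.
have [<-|ab] := eqVneq a b; last first.
  by rewrite ltNge lower_twin_other //; have [[_ sd _] _] := cp.
rewrite restrict_twin => _ m0; apply: (cone_map_D psi01 psi_p psiD hD h1) m0 => //.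
exact: (ot a ult).
Qed.

(** Over [D] the final restriction has maximum [lower t a], so the strict inequality has turned into
    an equality. *)
Lemma push1 t : fuzzy_proper t -> outside t ->
  forall a, lower (push 1 t) a <= upper (push 1 t) a.
Proof.
move=> tp ot; case: (push_cases t) => [[a ult] b|lu b]; last by rewrite push_outer.
have ul := ltW ult; have [rp rm] := restrict_cone tp ul.
have [cp cm] := fuzzy_proper_cone_map psi01 psi_p psiD hD h1 1 rp rm.
have [[_ cd _] _] := cp; rewrite (push_twin 1 tp ul).
have [<-|ab] := eqVneq a b; last exact: lower_twin_other.
rewrite upper_twin // lower_twin (cone_map_end psi01 psi_p psiD hD h1) //; exact: (ot a ult).
Qed.

Lemma cvg_push (T : Type) (G : set_system T) (FG : Filter G)
    (f : T -> X * X -> R) (l : X * X -> R) (u : T -> R) (u0 : R) q :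
  (forall q, (fun z => f z q) @ G --> l q) -> u @ G --> u0 ->
  fuzzy_proper l -> (forall z, fuzzy_proper (f z)) ->
  (fun z => push (u z) (f z) q) @ G --> push u0 l q.
Proof.
move=> fl uu lp fp.
have lo a : (fun z => lower (f z) a) @ G --> lower l a by exact: cvg_lower.
have up a : (fun z => upper (f z) a) @ G --> upper l a by exact: cvg_upper.
have near_lt a : upper l a < lower l a -> \forall z \near G, upper (f z) a < lower (f z) a.
  rewrite -subr_gt0 => lt0.
  have d : (fun z => lower (f z) a - upper (f z) a) @ G --> lower l a - upper l a by exact: cvgB.
  near=> z; rewrite -subr_gt0; near: z; exact: (cvgr_gt _ d).
have near_gt a : lower l a < upper l a -> \forall z \near G, lower (f z) a < upper (f z) a.
  rewrite -subr_gt0 => lt0.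
  have d : (fun z => upper (f z) a - lower (f z) a) @ G --> upper l a - lower l a by exact: cvgB.
  near=> z; rewrite -subr_gt0; near: z; exact: (cvgr_gt _ d).
(* Weak inequalities on both sides, so that these are preimages of closed sets. *)
pose C (i : option Y) (z : T) : Prop :=
  if i is Some a then upper (f z) a <= lower (f z) a
  else forall a, lower (f z) a <= upper (f z) a.
apply: (@cvg_cover _ _ (option Y) _ _ C).
  apply: nearW => z; case: (push_cases (f z)) => [[a /ltW ul]|lu].
    by exists (Some a).
  by exists None.
have FC i : Filter (within (C i) G) by exact: within_filter.
have inC i : \forall z \near within (C i) G, C i z by exact: withinT.
have sub i (Z : topologicalType) (g : T -> Z) (y : Z) : g @ G --> y -> g @ within (C i) G --> y.
  by move=> gy; apply: cvg_within_filter.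
case=> [a|].
  have [ul|/near_gt lu] := lerP (upper l a) (lower l a); last first.
    by left; apply: filterS lu => z; rewrite /C /= leNgt => ->.
  right; rewrite (push_twin u0 lp ul); have [rp rm] := restrict_cone lp ul.
  have : (fun z => twin a (f z (None, Some a)) (f z (Some a, None))
      (cone_map p psi h (lower (f z) a) (u z) (restrict (f z))) q)
      @ within (C (Some a)) G --> twin a (l (None, Some a)) (l (Some a, None))
      (cone_map p psi h (lower l a) u0 (restrict l)) q.
    apply: (@cvg_twin R Y T (within (C (Some a)) G) (FC (Some a))
      (fun z => f z (None, Some a)) (fun z => f z (Some a, None))
      (fun z => cone_map p psi h (lower (f z) a) (u z) (restrict (f z)))).
    - exact: (sub (Some a) R (fun z => f z (None, Some a)) _ (fl _)).
    - exact: (sub (Some a) R (fun z => f z (Some a, None)) _ (fl _)).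
    move=> r; apply: (cvg_cone_map psi_cont psi01 psi_p psiD h_cont hD h1 (FC (Some a))) => //.
    - exact: (sub (Some a) R (fun z => lower (f z) a) _ (lo a)).
    - exact: (sub (Some a) R u _ uu).
    - by move=> [i j]; exact: (sub (Some a) R (fun z => f z (Some i, Some j)) _ (fl _)).
    - by apply: filterS (inC (Some a)) => z ulz; apply: restrict_cone.
  apply: cvg_trans; apply: near_eq_cvg; apply: filterS (inC (Some a)) => z ulz.
  by rewrite (push_twin (u z) (fp z) ulz).
case: (push_cases l) => [[a /near_lt ul]|lu].
  by left; apply: filterS ul => z; rewrite ltNge => /negP ul /(_ a).
right; rewrite (push_outer u0 lu).
apply: cvg_trans (sub None R (fun z => f z q) _ (fl q)); apply: near_eq_cvg.
by apply: filterS (inC None) => z luz; rewrite push_outer.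
Unshelve. all: by end_near. Qed.

End Push.

(** * Separating the new point from the old ones and identifying the latter *)

Section Spread.
Variables (R : realType) (Y : finType).
Notation X := (option Y).
Hypothesis hY : exists y1 y2 : Y, y1 != y2.
Implicit Types (t : X * X -> R) (u v e : R).

Definition outer t := forall a, lower t a <= upper t a.

(** At most one term is positive, and the default 0 of [maxf] makes this vanish exactly on
    [outer]. *)
Definition excess t := maxf (fun a => lower t a - upper t a).

(** Lowers both dominant entries by the same amount, at most [e], until the smaller one meets the
    other values. *)
Definition retract e t (q : X * X) : R :=
  match q with
  | (None, Some a) | (Some a, None) =>
      t q - Num.min (Num.max 0 (lower t a - upper t a)) e
  | _ => t q
  end.

Lemma retract_twin e t a : 0 <= e -> fuzzy_proper t -> upper t a < lower t a ->
  retract e t = twin a (t (None, Some a) - Num.min (lower t a - upper t a) e)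
    (t (Some a, None) - Num.min (lower t a - upper t a) e) (restrict t) /\
  excess t = lower t a - upper t a.
Proof.
move=> e0 tp ult; have [_ tE] := restrict_twin_eq hY tp (ltW ult).
have other b : b != a -> lower t b - upper t b <= 0.
  move=> ba; rewrite subr_le0; have := lower_upper t ba.
  by have := @lower_upper R Y t a b; rewrite eq_sym ba => /(_ isT); lra.
have noth b : b != a -> Num.min (Num.max 0 (lower t b - upper t b)) e = 0.
  by move=> /other h; rewrite (max_l h) min_l.
have tha : Num.max 0 (lower t a - upper t a) = lower t a - upper t a.
  by rewrite max_r // subr_ge0 ltW.
split.
  apply/funext => -[[i|] [j|]] //=.
  - have [->|ia] := eqVneq i a; first by rewrite tha.
    by rewrite noth // subr0 [in LHS]tE /= (negPf ia).
  - have [->|ja] := eqVneq j a; first by rewrite tha.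
    by rewrite noth // subr0 [in LHS]tE /= (negPf ja).
  - by have [[_ td _] _] := tp; rewrite td.
apply: (@maxfE _ _ _ _ a) => //; first by rewrite subr_ge0 ltW.
move=> b; have [->//|/other] := eqVneq b a; rewrite -subr_gt0 in ult; lra.
Qed.

Lemma outer_excess t : outer t -> excess t = 0.
Proof.
move=> ot; apply/eqP; rewrite eq_le maxf_ge0 andbT maxf_le // => a.
by rewrite subr_le0.
Qed.

Lemma retract_outer e t : 0 <= e -> outer t -> retract e t = t.
Proof.
move=> e0 ot; have z a : Num.min (Num.max 0 (lower t a - upper t a)) e = 0.
  by rewrite max_l ?min_l // subr_le0.
by apply/funext => -[[i|] [j|]] //=; rewrite z subr0.
Qed.

Lemma outer_cases t : (exists a, upper t a < lower t a) \/ outer t.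
Proof.
have [/existsP[a ul]|/existsPn h'] := boolP [exists a, upper t a < lower t a].
  by left; exists a.
by right => a; rewrite leNgt; exact: h'.
Qed.

Lemma excess_ge0 t : 0 <= excess t. Proof. exact: maxf_ge0. Qed.

Lemma retractP e t : 0 <= e -> fuzzy_proper t ->
  [/\ fuzzy_proper (retract e t), maxf t - e <= maxf (retract e t),
      restrict (retract e t) = restrict t,
      forall q, retract e t q <= t q &
      (excess t <= e -> outer (retract e t)) /\
      forall a, upper (retract e t) a < lower (retract e t) a -> upper t a < lower t a].
Proof.
move=> e0 tp; have [[t0 _ _] _] := tp.
case: (outer_cases t) => [[a ult]|ot]; last first.
  by rewrite retract_outer //; split=> //; lra.
have [-> ex] := retract_twin e0 tp ult; have ul := ltW ult.
have [rp rtE] := restrict_twin_eq hY tp ul; have um := upper_maxf hY tp ul.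
set al := t (None, Some a); set be := t (Some a, None).
set d := Num.min _ e.
have de : d <= e by rewrite ge_min lexx orbT.
have dx : d <= lower t a - upper t a by rewrite ge_min lexx.
have d0 : 0 <= d by rewrite le_min e0 subr_ge0 ul.
have mE : Num.min (al - d) (be - d) = lower t a - d by rewrite -addr_minl.
have sm : maxf (restrict t) <= Num.min (al - d) (be - d) by rewrite mE -um; lra.
have [[_ rd _] _] := rp.
split.
- exact: fuzzy_proper_twin.
- rewrite (maxf_option ul t0) -/al -/be.
  have h1 := le_maxf (twin a (al - d) (be - d) (restrict t)) (None, Some a).
  have h2 := le_maxf (twin a (al - d) (be - d) (restrict t)) (Some a, None).
  move: h1 h2; rewrite /= eqxx; case: (lerP al be); lra.
- exact: restrict_twin.
- move=> q; rewrite [in leRHS]rtE; case: q => [[i|] [j|]] //=.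
    by case: ifP => // _; rewrite gerBl.
  by case: ifP => // _; rewrite gerBl.
split.
- rewrite ex => xe b; have [<-|ab] := eqVneq a b; last exact: lower_twin_other.
  rewrite lower_twin mE upper_twin // -um /d min_l //; lra.
- move=> b; have [<- //|ab] := eqVneq a b.
  by rewrite ltNge lower_twin_other.
Qed.

Definition inmax t := maxf (fun a => t (Some a, None)).

Definition outmax t := maxf (fun a => t (None, Some a)).

(* Meet with the preorders in which [None] is maximal, minimal, or isolated. *)
Definition cap_new u t (q : X * X) : R :=
  match q with
  | (Some a, None) => Num.min (t q) (1 - u + u * Num.max 0 (inmax t - outmax t))
  | (None, Some a) => Num.min (t q) (1 - u + u * Num.max 0 (outmax t - inmax t))
  | _ => t q
  end.

Lemma cap_ge0 u (c : R) : 0 <= u <= 1 -> 0 <= 1 - u + u * Num.max 0 c.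
Proof. by move=> /andP[u0 u1]; rewrite addr_ge0 ?subr_ge0 // mulr_ge0 // le_max lexx. Qed.

Lemma cap_new_le u t q : cap_new u t q <= t q.
Proof. by case: q => [[i|] [j|]] //=; rewrite ge_min lexx. Qed.

Lemma fuzzy_proper_cap_new u t : 0 <= u <= 1 -> fuzzy_proper t -> fuzzy_proper (cap_new u t).
Proof.
move=> u01 [[t0 td tt] [i0 [j0 [ij0 tij0]]]].
have c0 q : 0 <= cap_new u t q.
  by case: q => [[i|] [j|]] /=; rewrite ?t0 // le_min t0 cap_ge0.
split; last first.
  exists i0, j0; split=> //; apply/eqP; rewrite eq_le c0 andbT -tij0.
  exact: cap_new_le.
split=> // [[i|]|i j k ik]; rewrite /= ?td //.
set ci := 1 - u + u * Num.max 0 (inmax t - outmax t).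
set co := 1 - u + u * Num.max 0 (outmax t - inmax t).
have le2 x y : Num.min (cap_new u t (i, x)) (cap_new u t (y, k)) <= Num.min (t (i, x)) (t (y, k)).
  by apply: le_min2; exact: cap_new_le.
case: i k ik le2 => [i|] [k|] // ik le2.
- exact: le_trans (le2 j j) (tt _ j _ ik).
- rewrite [leRHS]/= -/ci le_min (le_trans (le2 j j) (tt _ j _ ik)) /= ge_min.
  by case: j => [j|] /=; rewrite -/ci ge_min lexx ?orbT // ge_min lexx !orbT.
- rewrite [leRHS]/= -/co le_min (le_trans (le2 j j) (tt _ j _ ik)) /= ge_min.
  by case: j => [j|] /=; rewrite -/co ge_min lexx ?orbT // ge_min lexx !orbT.
Qed.

Lemma cap_new0 t : (forall q, t q <= 1) -> cap_new 0 t = t.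
Proof.
move=> t1; apply/funext => -[[i|] [j|]] //=; rewrite subr0 mul0r addr0 min_l //.
Qed.

(** The new [lower] is bounded by both caps, hence by the capped value of an entry that realizes
    [upper t a]. *)
Lemma outer_cap_new u t : outer t -> outer (cap_new u t).
Proof.
move=> ot a; set ci := 1 - u + u * Num.max 0 (inmax t - outmax t).
set co := 1 - u + u * Num.max 0 (outmax t - inmax t).
have lE : lower (cap_new u t) a = Num.min (lower t a) (Num.min ci co).
  by rewrite /lower /= -/ci -/co minACA (minC co).
rewrite lE; have [u0|u0] := leP (upper t a) 0.
  apply: le_trans (upper_ge0 _ _); rewrite ge_min (le_trans (ot a)) //.
have [q oq tq] : exists2 q, others a q & t q = upper t a.
  apply: contrapT => h; have : upper t a < upper t a; last by rewrite ltxx.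
  apply/bigmax_ltP; split=> // q oq; rewrite lt_neqAle le_upper // andbT.
  by apply/eqP => tq; apply: h; exists q.
apply: le_trans (le_upper _ oq).
have : Num.min (lower t a) (Num.min ci co) <= t q by rewrite ge_min tq ot.
case: q {oq tq} => [[i|] [j|]] //= ltq; rewrite le_min ltq /= !ge_min lexx ?orbT //.
Qed.

(** The full caps kill everything only if the entries to and from [None] have the same maximum and
    [Y] carries no relation. By transitivity these entries then all involve a single point, of which
    [None] is a strict twin, and [outer] forbids this. *)
Lemma cap_new_gt0 u t : 0 <= u <= 1 -> fuzzy_proper t -> outer t -> 0 < maxf t ->
  0 < maxf (cap_new u t).
Proof.
move=> /andP[u0 u1] tp ot m0; have [[t0 td tt] _] := tp.
have some q : 0 < cap_new u t q -> 0 < maxf (cap_new u t).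
  by move=> h; exact: lt_le_trans h (le_maxf _ _).
have [q tq] := maxf_attained m0; rewrite -tq in m0.
have [u1'|u1'] := ltP u 1.
  have c0 (c : R) : 0 < 1 - u + u * Num.max 0 c.
    by rewrite ltr_wpDr ?subr_gt0 // mulr_ge0 // le_max lexx.
  by apply: (some q); case: q {tq} m0 => [[i|] [j|]] //= m0; rewrite lt_min m0 c0.
have uE : u = 1 by lra.
have [/existsP[[i j] /= rij]|/existsPn r0] := boolP [exists q, 0 < restrict t q].
  exact: (some (Some i, Some j)).
have rz i j : ~ (0 < t (Some i, Some j)) by apply/negP; exact: (r0 (i, j)).
have ine i : 0 < t (Some i, None) -> exists2 a, t (Some a, None) = inmax t & 0 < inmax t.
  move=> ti; have i0 : 0 < inmax t by exact: lt_le_trans ti (le_maxf (fun a => t (Some a, None)) i).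
  by have [a ta] := maxf_attained i0; exists a.
have oute i : 0 < t (None, Some i) -> exists2 a, t (None, Some a) = outmax t & 0 < outmax t.
  move=> ti; have i0 : 0 < outmax t by exact: lt_le_trans ti (le_maxf (fun a => t (None, Some a)) i).
  by have [a ta] := maxf_attained i0; exists a.
have io : 0 < inmax t \/ 0 < outmax t.
  case: q m0 {tq} => [[i|] [j|]] m0; first by case: (rz _ _ m0).
  - by left; have [] := ine _ m0.
  - by right; have [] := oute _ m0.
  - by rewrite td ltxx in m0.
case: (ltrgtP (inmax t) (outmax t)) => cmp.
- have o0 : 0 < outmax t by exact: le_lt_trans (maxf_ge0 _) cmp.
  have [a ta] := maxf_attained o0; apply: (some (None, Some a)).
  by rewrite /= uE subrr add0r mul1r lt_min lt_max subr_gt0 cmp orbT andbT ta.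
- have o0 : 0 < inmax t by exact: le_lt_trans (maxf_ge0 _) cmp.
  have [a ta] := maxf_attained o0; apply: (some (Some a, None)).
  by rewrite /= uE subrr add0r mul1r lt_min lt_max subr_gt0 cmp orbT andbT ta.
exfalso.
have i0 : 0 < inmax t by case: io; rewrite cmp.
have o0 : 0 < outmax t by rewrite -cmp.
have [a ta] := maxf_attained i0; have [b tb] := maxf_attained o0.
have tin i j : 0 < t (Some i, None) -> 0 < t (None, Some j) -> i = j.
  move=> ti tj; apply/eqP; apply: contraT => ij; case: (@rz i j).
  have ij' : Some i != Some j :> X by apply: contra ij => /eqP[->].
  by apply: lt_le_trans (tt _ None _ ij'); rewrite lt_min ti.
have ta0 : 0 < t (Some a, None) by rewrite ta.
have tb0 : 0 < t (None, Some b) by rewrite tb.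
have ab := tin _ _ ta0 tb0; rewrite -{b}ab in tb tb0.
have l0 : 0 < upper t a by apply: lt_le_trans (ot a); rewrite lt_min tb0.
have [|] := boolP [exists q', others a q' && (0 < t q')].
  case/existsP => -[[i|] [j|]] /andP[oq tq'].
  - exact: rz tq'.
  - by move: oq; rewrite (tin i a) // /others eqxx andbF.
  - by move: oq; rewrite -(tin a j) // /others eqxx.
  - by rewrite td ltxx in tq'.
move=> /existsPn h; move: l0; rewrite ltNge => /negP[].
by apply: upper_le => // q' oq; have := h q'; rewrite oq /= leNgt.
Qed.

Definition one_sided t := (forall a, t (Some a, None) = 0) \/ (forall a, t (None, Some a) = 0).

Lemma one_sided_cap_new t : fuzzy_proper t -> one_sided (cap_new 1 t).
Proof.
move=> [[t0 _ _] _]; case: (lerP (inmax t) (outmax t)) => io; [left|right] => a /=;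
  by rewrite subrr add0r mul1r (max_l _) ?(min_r (t0 _)) // subr_le0 // ltW.
Qed.

(* Join with the preorder that identifies the points of [Y]. *)
Definition join_old v t (q : X * X) : R :=
  match q with
  | (Some i, Some j) => if i == j then 0 else Num.max ((1 - v) * t q) v
  | (Some _, None) => Num.max ((1 - v) * t q) (Num.min v ((1 - v) * inmax t))
  | (None, Some _) => Num.max ((1 - v) * t q) (Num.min v ((1 - v) * outmax t))
  | (None, None) => 0
  end.

Definition old (q : X * X) : R :=
  if q is (Some i, Some j) then (i != j)%:R else 0.

Lemma one_sided_maxf t : fuzzy_proper t -> one_sided t -> inmax t = 0 \/ outmax t = 0.
Proof.
move=> tp; case=> t0; [left|right]; apply/eqP; rewrite eq_le maxf_ge0 andbT;
  by apply: maxf_le => // a; rewrite t0.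
Qed.

Lemma join_old0 t : fuzzy_proper t -> join_old 0 t = t.
Proof.
move=> [[t0 td _] _]; have i0 : 0 <= inmax t by exact: maxf_ge0.
have o0 : 0 <= outmax t by exact: maxf_ge0.
apply/funext => -[[i|] [j|]] /=; rewrite ?subr0 ?mul1r ?(min_l i0) ?(min_l o0) ?max_l ?td //.
by case: eqP => // ->; rewrite td.
Qed.

Lemma join_old1 t : join_old 1 t = old.
Proof.
apply/funext => -[[i|] [j|]] //=; rewrite subrr !mul0r ?minr0 ?maxr0.
- by case: eqP => //= _; rewrite max_r.
- by rewrite min_r // maxxx.
- by rewrite min_r // maxxx.
Qed.

(** If [None] had relations in both directions, identifying the points of [Y] would relate all
    pairs. On one side of [None], the join of a one-sided function stays 0. *)
Lemma fuzzy_proper_join_old v t : 0 <= v <= 1 -> fuzzy_proper t -> v = 0 \/ one_sided t ->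
  fuzzy_proper (join_old v t).
Proof.
move=> v01 tp [->|os]; first by rewrite join_old0.
have /andP[v0 v1] := v01; have io := one_sided_maxf tp os.
have [[t0 td tt] _] := tp; have w0 : 0 <= 1 - v by lra.
have I0 : 0 <= inmax t by exact: maxf_ge0.
have O0 : 0 <= outmax t by exact: maxf_ge0.
have [y1 [y2 y12]] := hY.
pose g q := (1 - v) * t q.
have g0 q : 0 <= g q by exact: mulr_ge0.
have gt i j k : i != k -> Num.min (g (i, j)) (g (j, k)) <= g (i, k).
  by move=> ik; rewrite /g -minr_pMr // ler_wpM2l // tt.
have gin i : g (Some i, None) <= (1 - v) * inmax t.
  by rewrite ler_wpM2l // (le_maxf (fun a => t (Some a, None))).
have gout i : g (None, Some i) <= (1 - v) * outmax t.
  by rewrite ler_wpM2l // (le_maxf (fun a => t (None, Some a))).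
have vI : 0 <= Num.min v ((1 - v) * inmax t) by rewrite le_min v0 mulr_ge0.
have vO : 0 <= Num.min v ((1 - v) * outmax t) by rewrite le_min v0 mulr_ge0.
have c0 q : 0 <= join_old v t q.
  case: q => [[i|] [j|]] //=; rewrite -/(g _); last 2 first.
  - by rewrite le_max g0.
  - by rewrite le_max g0.
  by case: ifP => // _; rewrite le_max v0 orbT.
have in0 : inmax t = 0 -> forall i, join_old v t (Some i, None) = 0.
  move=> I i; have := gin i; rewrite /= -/(g _) I mulr0 (min_r v0) => gi.
  by apply: max_r.
have out0 : outmax t = 0 -> forall i, join_old v t (None, Some i) = 0.
  move=> I i; have := gout i; rewrite /= -/(g _) I mulr0 (min_r v0) => gi.
  by apply: max_r.
split; last first.
  by case: io => [/in0 I|/out0 I]; [exists (Some y1), None|exists None, (Some y1)].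
have diag j' : join_old v t (j', j') = 0 by case: j' => [j'|] //=; rewrite eqxx.
split=> // i j k ik.
(* Distributivity: a minimum of two maxima is bounded as soon as the four crossed minima are. *)
have four (x y x' y' z : R) : Num.min x x' <= z -> Num.min x y' <= z ->
    Num.min y x' <= z -> Num.min y y' <= z -> Num.min (Num.max x y) (Num.max x' y') <= z.
  by case: (lerP x y); case: (lerP x' y').
have [->|ij] := eqVneq i j; first by rewrite diag ge_min c0.
have [<-|jk] := eqVneq j k; first by rewrite diag ge_min c0 orbT.
have mono (x y c : R) : x <= c -> Num.min y x <= Num.min y c.
  by move=> xc; apply: le_min2.
case: i ik ij => [i|] ik ij; case: j jk ij => [j|] jk ij; case: k ik jk => [k|] ik jk //=;
  rewrite ?(negPf ij) ?(negPf ik) ?(negPf jk) -?/(g _).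
- have {}ij : i != j by apply: contra ij => /eqP ->.
  have {}jk : j != k by apply: contra jk => /eqP ->.
  have {}ik' : i != k by apply: contra ik => /eqP ->.
  rewrite (negPf ij) (negPf jk) (negPf ik').
  by apply: four; rewrite le_max ?(gt _ (Some j) _ ik) // !ge_min !lexx ?orbT.
- have {}ij : i != j by apply: contra ij => /eqP ->.
  rewrite (negPf ij); apply: four; rewrite le_max ?(gt _ (Some j) _ ik) //.
  + by apply/orP; right; rewrite ge_min ?lexx ?orbT // ge_min lexx ?orbT.
  + by rewrite (mono _ _ _ (gin j)) orbT.
  + by apply/orP; right; rewrite ge_min ?lexx ?orbT // ge_min lexx ?orbT.
- have {}ik' : i != k by apply: contra ik => /eqP ->.
  rewrite (negPf ik'); apply: four; rewrite le_max ?(gt _ None _ ik) //.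
  + by apply/orP; right; rewrite ge_min ?lexx ?orbT // ge_min lexx ?orbT.
  + by apply/orP; right; rewrite ge_min ?lexx ?orbT // ge_min lexx ?orbT.
  + by apply/orP; right; rewrite ge_min ?lexx ?orbT // ge_min lexx ?orbT.
- have {}jk : j != k by apply: contra jk => /eqP ->.
  rewrite (negPf jk); apply: four; rewrite le_max ?(gt _ (Some j) _ ik) //.
  + by rewrite minC (mono _ _ _ (gout j)) orbT.
  + by apply/orP; right; rewrite ge_min ?lexx ?orbT // ge_min lexx ?orbT.
  + by apply/orP; right; rewrite ge_min ?lexx ?orbT // ge_min lexx ?orbT.
Qed.

Lemma one_sided_join_old v t : 0 <= v <= 1 -> fuzzy_proper t -> one_sided t ->
  one_sided (join_old v t).
Proof.
move=> /andP[v0 v1] tp [t0|t0]; [left|right] => a /=; rewrite t0 mulr0.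
  have -> : inmax t = 0.
    by apply/eqP; rewrite eq_le maxf_ge0 andbT maxf_le // => b; rewrite t0.
  by rewrite mulr0 (min_r v0) maxxx.
have -> : outmax t = 0.
  by apply/eqP; rewrite eq_le maxf_ge0 andbT maxf_le // => b; rewrite t0.
by rewrite mulr0 (min_r v0) maxxx.
Qed.

Lemma one_sided_outer t : one_sided t -> outer t.
Proof.
move=> t0 a; apply: le_trans (upper_ge0 _ _); rewrite ge_min.
by case: t0 => ->; rewrite lexx ?orbT.
Qed.

Lemma join_old_gt0 v t : 0 <= v <= 1 -> fuzzy_proper t -> 0 < maxf t ->
  0 < maxf (join_old v t).
Proof.
move=> /andP[v0 v1] tp m0; have [->|vn0] := eqVneq v 0; first by rewrite join_old0.
have [y1 [y2 y12]] := hY; apply: lt_le_trans (le_maxf _ (Some y1, Some y2)).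
by rewrite /= (negPf y12) lt_max [0 < v]lt_neqAle eq_sym vn0 v0 orbT.
Qed.

(* Once [excess] has been brought down to 0, [None] is first made maximal, minimal or
   isolated, and then the points of [Y] are identified. *)
Definition spread u t : X * X -> R :=
  join_old (clamp (2 * clamp (clamp u - 2 * excess t) - 1))
    (cap_new (clamp (2 * clamp (clamp u - 2 * excess t))) (retract (clamp u / 2) t)).

Lemma clamp01 u : 0 <= clamp u <= 1.
Proof. by rewrite clamp_ge0 clamp_le1. Qed.

Lemma half_clamp_ge0 u : 0 <= clamp u / 2.
Proof. by rewrite divr_ge0 // clamp_ge0. Qed.

(** The amount [clamp u / 2] reaches [excess t] exactly when [clamp u - 2 * excess t] reaches 0:
    capping and joining wait for the retraction to end. *)
Lemma spread_small u t : fuzzy_proper t -> maxf t = 1 -> clamp u <= 2 * excess t ->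
  spread u t = retract (clamp u / 2) t.
Proof.
move=> tp t1 ue; have [rp _ _ rt _] := retractP (half_clamp_ge0 u) tp.
have w0 : clamp (clamp u - 2 * excess t) = 0 by apply: clamp0; lra.
rewrite /spread w0 !(@clamp0 _ (_ - 1)) ?(@clamp0 _ (2 * 0)) ?mulr0 ?sub0r ?oppr_le0 //.
rewrite cap_new0 ?join_old0 // => q; apply: le_trans (rt q) _.
by rewrite -t1 le_maxf.
Qed.

Lemma spread_large u t : fuzzy_proper t -> maxf t = 1 -> 2 * excess t <= clamp u ->
  [/\ fuzzy_proper (spread u t), 0 < maxf (spread u t) & outer (spread u t)].
Proof.
move=> tp t1 ue; have [rp rm _ _ [ro _]] := retractP (half_clamp_ge0 u) tp.
have {}ro : outer (retract (clamp u / 2) t) by apply: ro; lra.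
(* At most 1/2 has been taken from a maximum equal to 1. *)
have m0 : 0 < maxf (retract (clamp u / 2) t).
  by apply: lt_le_trans rm; have := clamp_le1 u; rewrite t1; lra.
rewrite /spread; set x := retract _ _ in rp rm ro m0 *; set w := clamp (clamp u - _).
have cp := fuzzy_proper_cap_new (clamp01 (2 * w)) rp.
have co : outer (cap_new (clamp (2 * w)) x) by exact: outer_cap_new.
have c0 := cap_new_gt0 (clamp01 (2 * w)) rp ro m0.
have vo : clamp (2 * w - 1) = 0 \/ one_sided (cap_new (clamp (2 * w)) x).
  case: (clamp_split w) => [->|->]; first by left.
  by right; exact: one_sided_cap_new.
split.
- exact: fuzzy_proper_join_old (clamp01 _) cp vo.
- exact: join_old_gt0 (clamp01 _) cp c0.
- case: vo => [->|os]; first by rewrite join_old0.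
  by apply/one_sided_outer/one_sided_join_old => //; exact: clamp01.
Qed.

Lemma fuzzy_proper_spread u t : fuzzy_proper t -> maxf t = 1 ->
  fuzzy_proper (spread u t) /\ 0 < maxf (spread u t).
Proof.
move=> tp t1; case: (lerP (clamp u) (2 * excess t)) => ue; last first.
  by have [] := spread_large tp t1 (ltW ue).
rewrite spread_small //; have [rp rm _ _ _] := retractP (half_clamp_ge0 u) tp.
by split=> //; apply: lt_le_trans rm; have := clamp_le1 u; rewrite t1; lra.
Qed.

Lemma spread0 t : fuzzy_proper t -> maxf t = 1 -> spread 0 t = t.
Proof.
move=> tp t1; rewrite spread_small ?clamp0 ?mulr_ge0 ?excess_ge0 // mul0r.
apply/funext => -[[i|] [j|]] //=; rewrite min_r ?subr0 // le_max lexx //.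
Qed.

Lemma spread1 t : outer t -> spread 1 t = old.
Proof.
move=> ot; rewrite /spread outer_excess // mulr0 subr0 !(@clamp1 _ 1) //.
rewrite mulr1 (@clamp1 _ (2 - 1)) ?join_old1 //; lra.
Qed.

Lemma fuzzy_proper_old : fuzzy_proper old /\ maxf old = 1.
Proof.
have [y1 [y2 y12]] := hY; split; last first.
  apply: (@maxfE _ _ _ _ (Some y1, Some y2)) => //=; first by rewrite y12.
  by move=> [[i|] [j|]] //=; case: (i == j).
split; last by exists None, (Some y1).
split=> [[[i|] [j|]]|[i|]|[i|] [j|] [k|] ik] //=; rewrite ?eqxx ?ler0n //.
- have -> : i != k by apply: contra ik => /eqP ->.
  by rewrite ge_min; case: (i != j); rewrite ?lexx ?ler01.
all: by rewrite ge_min ?lexx ?ler0n ?orbT.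
Qed.

Section Continuity.
Variables (T : Type) (G : set_system T) (FG : Filter G) (f : T -> X * X -> R) (l : X * X -> R).
Hypothesis fl : forall q, (fun z => f z q) @ G --> l q.

Let cst (c : R) := @cvg_cst R c T G FG.

Lemma cvg_excess : (fun z => excess (f z)) @ G --> excess l.
Proof. by apply: cvg_maxf => a; apply: cvgB; [exact: cvg_lower|exact: cvg_upper]. Qed.

Lemma cvg_retract (e : T -> R) e0 q : e @ G --> e0 ->
  (fun z => retract (e z) (f z) q) @ G --> retract e0 l q.
Proof.
move=> ee; have d a : (fun z => Num.min (Num.max 0 (lower (f z) a - upper (f z) a)) (e z)) @ G
    --> Num.min (Num.max 0 (lower l a - upper l a)) e0.
  apply: cvg_minr => //; apply: cvg_maxr; first exact: cst.
  by apply: cvgB; [exact: cvg_lower|exact: cvg_upper].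
by case: q => [[i|] [j|]] /=; [exact: fl|apply: cvgB|apply: cvgB|exact: fl].
Qed.

Lemma cvg_inmax : (fun z => inmax (f z)) @ G --> inmax l.
Proof. by apply: cvg_maxf. Qed.

Lemma cvg_outmax : (fun z => outmax (f z)) @ G --> outmax l.
Proof. by apply: cvg_maxf. Qed.

Lemma cvg_cap_new (u : T -> R) u0 q : u @ G --> u0 ->
  (fun z => cap_new (u z) (f z) q) @ G --> cap_new u0 l q.
Proof.
move=> uu; have i0 := cvg_inmax; have o0 := cvg_outmax.
case: q => [[i|] [j|]] /=; [exact: fl| | |exact: fl]; apply: cvg_minr => //;
  apply: cvgD; [apply: cvgB => //; exact: cst| |apply: cvgB => //; exact: cst|];
  by apply: cvgM => //; apply: cvg_maxr; [exact: cst|exact: cvgB].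
Qed.

Lemma cvg_join_old (v : T -> R) v0 q : v @ G --> v0 ->
  (fun z => join_old (v z) (f z) q) @ G --> join_old v0 l q.
Proof.
move=> vv; have i0 := cvg_inmax; have o0 := cvg_outmax.
have w : (fun z => 1 - v z) @ G --> 1 - v0 by apply: cvgB => //; exact: cst.
case: q => [[i|] [j|]] /=; last exact: cst.
- by case: (i == j); [exact: cst|apply: cvg_maxr => //; exact: cvgM].
- by apply: cvg_maxr; [exact: cvgM|apply: cvg_minr => //; exact: cvgM].
- by apply: cvg_maxr; [exact: cvgM|apply: cvg_minr => //; exact: cvgM].
Qed.

End Continuity.

Lemma cvg_spread (T : Type) (G : set_system T) (FG : Filter G)
    (f : T -> X * X -> R) (l : X * X -> R) (u : T -> R) (u0 : R) q :
  (forall q, (fun z => f z q) @ G --> l q) -> u @ G --> u0 ->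
  (fun z => spread (u z) (f z) q) @ G --> spread u0 l q.
Proof.
move=> fl uu; have cst c := @cvg_cst R c T G FG.
have cu : (fun z => clamp (u z)) @ G --> clamp u0 by exact: cvg_clamp.
have w : (fun z => clamp (clamp (u z) - 2 * excess (f z))) @ G -->
    clamp (clamp u0 - 2 * excess l).
  apply: cvg_clamp; apply: cvgB => //; apply: cvgM; first exact: cst.
  exact: cvg_excess.
have w2 : (fun z => 2 * clamp (clamp (u z) - 2 * excess (f z))) @ G -->
    2 * clamp (clamp u0 - 2 * excess l) by apply: cvgM => //; exact: cst.
apply: (@cvg_join_old T G FG (fun z => cap_new _ _)) => [r|].
  apply: (@cvg_cap_new T G FG (fun z => retract _ _)) => [r'|].
    by apply: cvg_retract => //; apply: cvgM => //; exact: cst.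
  exact: cvg_clamp.
by apply: cvg_clamp; apply: cvgB => //; exact: cst.
Qed.

End Spread.

(** * Cells *)

Section Cells.
Variable R : realType.
Notation F Y := (set_type (@levels R _ (@proper_preorder Y))).

(* [coord] identifies each cell with [J -> R]; the complement of the cells is
   contracted within itself to [pole], around which it is a neighborhood. *)
Record cells (Y I J : finType) := Cells {
  pole : F Y;
  bump : F Y -> R;
  contraction : F Y * R -> F Y;
  cell : F Y -> option I;
  coord : F Y -> J -> R;
  bump_continuous : continuous bump;
  bump01 : forall z, 0 <= bump z <= 1;
  bump_pole : bump pole = 1;
  bump_cell : forall z, 0 < bump z -> cell z = None;
  contraction_continuous : continuous contraction;
  contraction0 : forall z, contraction (z, 0) = z;
  contraction_cell : forall z u, cell z = None -> cell (contraction (z, u)) = None;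
  contraction1 : forall z, cell z = None -> contraction (z, 1) = pole;
  cell_open : forall z i, cell z = Some i -> \forall w \near z, cell w = Some i;
  coord_continuous : forall z i j, cell z = Some i ->
    (fun w => coord w j) @ z --> coord z j;
  coord_proper : forall z (B : R), cell z = None ->
    \forall w \near z, cell w = None \/ exists j, B < `|coord w j|;
  coord_surj : forall i y, exists z, cell z = Some i /\ coord z =1 y;
  coord_inj : forall z z' i, cell z = Some i -> cell z' = Some i ->
    coord z =1 coord z' -> z = z' }.

Section Step.
Variables (Y I J : finType) (c : cells Y I J).
Notation X := (option Y).

Let D := [set z : F Y | cell c z = None].
Let hY : exists y1 y2 : Y, y1 != y2 := two_points (pole c).

Lemma old_levels : levels (@proper_preorder X) (@old R Y : {ptws X * X -> R}).
Proof.
have [op o1] := fuzzy_proper_old R hY.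
have := normalizable_fuzzy_proper op; rewrite o1 => /(_ ltr01).
rewrite /normalizable o1 (_ : (fun _ => _) = @old R Y) //.
by apply/funext => q; rewrite divr1.
Qed.

Definition new_pole : F X :=
  exist (fun f => f \in @levels R _ (@proper_preorder X)) _ (mem_set old_levels).

Definition direction (t : F X) : F Y := normalize (pole c) (restrict (set_val t)).

(** The test on [maxf] excludes the apex of the cone, where [direction] is only a default value. *)
Definition new_cell (t : F X) : option (Y * I) :=
  if [pick a | upper (set_val t) a < lower (set_val t) a] is Some a then
    if 0 < maxf (restrict (set_val t)) then omap (pair a) (cell c (direction t)) else None
  else None.

(* With [M] the maximum over [Y], the two logarithms are unbounded near the boundary
   of a cell, where an entry decreases to [M] or [M] vanishes. *)
Definition new_coord (t : F X) (j : option (option J)) : R :=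
  if [pick a | upper (set_val t) a < lower (set_val t) a] is Some a then
    let M := maxf (restrict (set_val t)) in
    match j with
    | None => ln ((set_val t (None, Some a) - M) / M)
    | Some None => ln ((set_val t (Some a, None) - M) / M)
    | Some (Some j) => coord c (direction t) j
    end
  else 0.

(* Positive only if the maximum is attained on [Y], which forbids twins of [None]. *)
Definition new_bump (t : F X) : R := 1 - Num.max (inmax (set_val t)) (outmax (set_val t)).

Let push_c (u : R) := push (pole c) (bump c) (contraction c) u.

(** Both motions run simultaneously: [push] preserves the maximum, as [spread] requires, and at time
    1 it has made the points outside the cells [outer], which [spread] then sends to [old]. *)
Definition new_contraction (z : F X * R) : F X :=
  normalize new_pole (spread z.2 (push_c z.2 (set_val z.1))).

Lemma pickE (t : X * X -> R) a : upper t a < lower t a ->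
  [pick b | upper t b < lower t b] = Some a.
Proof.
move=> ha; case: pickP => [b hb|/(_ a)]; last by rewrite ha.
by rewrite (upper_lower_uniq ha hb).
Qed.

Lemma new_cellP t a i : new_cell t = Some (a, i) <->
  [/\ upper (set_val t) a < lower (set_val t) a, 0 < maxf (restrict (set_val t)) &
      cell c (direction t) = Some i].
Proof.
split=> [|[ul m0 ci]]; last by rewrite /new_cell (pickE ul) m0 ci.
rewrite /new_cell; case: pickP => // b ub; case: ifP => // m0.
by case E : (cell c (direction t)) => [i'|] //= -[<- <-].
Qed.

Lemma new_cell_None t : new_cell t = None <-> outside (pole c) D (set_val t).
Proof.
split=> [|o].
  rewrite /new_cell; case: pickP => [b ub|nu _ a ua]; last by have := nu a; rewrite ua.
  case: ifP => [m0|m0 _ a ua]; last by rewrite m0.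
  case E : (cell c (direction t)) => [i'|] // _ a ua _; exact: E.
case E : (new_cell t) => [[a i]|] //; have [ul m0 ci] := (new_cellP t a i).1 E.
by have := o a ul m0; rewrite /D /= -/(direction t) ci.
Qed.

Lemma new_coordE t a j : upper (set_val t) a < lower (set_val t) a ->
  new_coord t j = let M := maxf (restrict (set_val t)) in
    match j with
    | None => ln ((set_val t (None, Some a) - M) / M)
    | Some None => ln ((set_val t (Some a, None) - M) / M)
    | Some (Some j) => coord c (direction t) j
    end.
Proof. by move=> ul; rewrite /new_coord (pickE ul). Qed.

Lemma outer_cell t : outer (set_val t) -> new_cell t = None.
Proof. by move=> ot; rewrite /new_cell; case: pickP => // a; rewrite ltNge ot. Qed.

Lemma cvg_val (t : F X) q : (fun w : F X => set_val w q) @ t --> set_val t q.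
Proof. exact: (@cvg_coord R _ _ (F X) (nbhs t) _ id t q cvg_id). Qed.

Lemma new_bump_continuous : continuous new_bump.
Proof.
move=> t.
have i0 := @cvg_inmax R Y (F X) (nbhs t) (nbhs_filter t) (fun w => set_val w) (set_val t) (@cvg_val t).
have o0 := @cvg_outmax R Y (F X) (nbhs t) (nbhs_filter t) (fun w => set_val w) (set_val t) (@cvg_val t).
have m0 := cvg_maxr (nbhs_filter t) i0 o0.
have c1 := @cvg_cst R 1 (F X) (nbhs t) (nbhs_filter t).
exact: (cvgB c1 m0).
Qed.

Lemma val_le1 (t : F X) q : set_val t q <= 1.
Proof. by rewrite -(maxf_levels t) le_maxf. Qed.

Lemma new_bump01 t : 0 <= new_bump t <= 1.
Proof.
rewrite /new_bump subr_ge0 gerBl ge_max le_max !maxf_ge0 /= andbT.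
by rewrite !maxf_le // => a; exact: val_le1.
Qed.

Lemma new_bump_pole : new_bump new_pole = 1.
Proof.
have [y _] := hY; rewrite /new_bump /inmax /outmax.
by rewrite !(@maxfE _ _ _ 0 y) ?maxxx ?subr0.
Qed.

Lemma new_bump_cell t : 0 < new_bump t -> new_cell t = None.
Proof.
rewrite /new_bump subr_gt0 gt_max => /andP[i1 o1]; apply: outer_cell => a.
have out1 b : set_val t (None, Some b) < 1.
  exact: le_lt_trans (le_maxf (fun a => set_val t (None, Some a)) b) o1.
have in1 b : set_val t (Some b, None) < 1.
  exact: le_lt_trans (le_maxf (fun a => set_val t (Some a, None)) b) i1.
have m1 := maxf_levels t; have [|q tq] := @maxf_attained _ _ (set_val t).
  by rewrite m1.
have oq : others a q.
  case: q tq => [[i|] [j|]]; rewrite m1 => tq.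
  - by rewrite /others !xpair_eqE andbF.
  - by have := in1 i; rewrite tq ltxx.
  - by have := out1 j; rewrite tq ltxx.
  - by have [[_ td _] _] := fuzzy_proper_levels t; have := @ltr01 R; rewrite -tq td ltxx.
apply: le_trans (le_upper (set_val t) oq); rewrite tq m1 ge_min ltW //.
Qed.

Let D_contraction z u : D z -> D (contraction c (z, u)).
Proof. exact: contraction_cell. Qed.

Let D_contraction1 z : D z -> contraction c (z, 1) = pole c.
Proof. exact: contraction1. Qed.

Let D_bump z : 0 < bump c z -> D z.
Proof. exact: bump_cell. Qed.

Let pushP u t : fuzzy_proper t ->
  fuzzy_proper (push_c u t) /\ maxf (push_c u t) = maxf t.
Proof.
exact: (fuzzy_proper_push (bump01 c) (bump_pole c) D_bump (contraction0 c) D_contraction D_contraction1).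
Qed.

Let pushP1 (t : F X) u : fuzzy_proper (push_c u (set_val t)) /\ maxf (push_c u (set_val t)) = 1.
Proof. by have := pushP u (fuzzy_proper_levels t); rewrite maxf_levels. Qed.

Let spreadP (t : F X) v u : fuzzy_proper (spread v (push_c u (set_val t))) /\
  0 < maxf (spread v (push_c u (set_val t))).
Proof. have [tp t1] := pushP1 t u; exact: (fuzzy_proper_spread hY). Qed.

Lemma new_contraction_continuous : continuous new_contraction.
Proof.
move=> [t u]; have snd0 : (fun z : F X * R => z.2) @ nbhs (t, u) --> u by exact: cvg_snd.
apply: (@cvg_normalize R _ _ new_pole (F X * R)%type (nbhs (t, u)) _
  (fun z => spread z.2 (push_c z.2 (set_val z.1)))).
- move=> q; apply: (@cvg_spread R Y _ (nbhs (t, u)) _ (fun z => push_c z.2 (set_val z.1))) => // r.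
  apply: (@cvg_push R Y (pole c) (bump c) (contraction c) D (@bump_continuous _ _ _ c) (bump01 c)
    (bump_pole c) D_bump (@contraction_continuous _ _ _ c) (contraction0 c) D_contraction
    D_contraction1 (F X * R)%type (nbhs (t, u)) (nbhs_filter (t, u)) (fun z => set_val z.1)) => //.
  + move=> r'; apply: (@cvg_coord R _ _ _ (nbhs (t, u)) _ (fun z : F X * R => z.1) t r').
    exact: cvg_fst.
  + exact: fuzzy_proper_levels.
  + by move=> z; exact: fuzzy_proper_levels.
- by have [_ m0] := spreadP t u u; rewrite gt_eqF.
- by have [sp m0] := spreadP t u u; exact: normalizable_fuzzy_proper.
- by apply: nearW => z; have [sp m0] := spreadP z.1 z.2 z.2; exact: normalizable_fuzzy_proper.
Qed.

Lemma new_contraction0 t : new_contraction (t, 0) = t.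
Proof.
have tp := fuzzy_proper_levels t; rewrite /new_contraction /= /push_c.
by rewrite (push0 (pole c) (bump c) (contraction0 c) tp) spread0 ?maxf_levels ?normalize_id.
Qed.

Lemma outside_scale (t : X * X -> R) (k : R) : 0 < k -> outside (pole c) D t ->
  outside (pole c) D (fun q => k * t q).
Proof.
move=> k0 ot a; have kk := ltW k0.
rewrite lower_scale // upper_scale //.
have -> : restrict (fun q => k * t q) = fun q => k * restrict t q by [].
rewrite ltr_pM2l // maxf_scale // pmulr_rgt0 // normalize_scale //; exact: ot.
Qed.

(** As long as only the retraction acts, the restriction is unchanged and no new twin appears;
    afterwards the function is [outer]. *)
Lemma outside_spread (t : X * X -> R) (u : R) : fuzzy_proper t -> maxf t = 1 ->
  outside (pole c) D t -> outside (pole c) D (spread u t).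
Proof.
move=> tp t1 ot; case: (lerP (clamp u) (2 * excess t)) => ue; last first.
  have [_ _ os] := spread_large hY tp t1 (ltW ue) => a.
  by rewrite ltNge os.
rewrite (spread_small hY) // => a.
have [_ _ rE _ [_ rl]] := retractP hY (half_clamp_ge0 u) tp.
by move=> /rl; rewrite rE; exact: ot.
Qed.

Lemma new_contraction_cell t u : new_cell t = None -> new_cell (new_contraction (t, u)) = None.
Proof.
move=> /new_cell_None ot; apply/new_cell_None; rewrite /new_contraction /=.
have [sp m0] := spreadP t u u; have [pp p1] := pushP1 t u.
have := normalizable_fuzzy_proper sp m0.
set s := spread _ _ in sp m0 * => sn.
have -> : set_val (normalize new_pole s) = fun q => (maxf s)^-1 * s q.
  by apply/funext => q; rewrite val_normalize // mulrC.
apply: outside_scale; first by rewrite invr_gt0.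
apply: outside_spread => //.
exact: (outside_push (bump01 c) (bump_pole c) D_bump (contraction0 c) D_contraction D_contraction1
  (fuzzy_proper_levels t) ot).
Qed.

Lemma new_contraction1 t : new_cell t = None -> new_contraction (t, 1) = new_pole.
Proof.
move=> /new_cell_None ot; rewrite /new_contraction /= spread1.
  by rewrite -[RHS](normalize_id new_pole) set_valE.
exact: (push1 (bump01 c) (bump_pole c) D_bump (contraction0 c) D_contraction D_contraction1
  (fuzzy_proper_levels t) ot).
Qed.

End Step.
End Cells.

(** * Openness of the new cells and continuity of their coordinates *)

Section Coordinates.
Variables (R : realType) (Y I J : finType) (c : cells R Y I J).
Notation F Y := (set_type (@levels R _ (@proper_preorder Y))).
Notation X := (option Y).

Lemma restrictP (t : F X) a : upper (set_val t) a < lower (set_val t) a ->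
  fuzzy_proper (restrict (set_val t)) /\ upper (set_val t) a = maxf (restrict (set_val t)).
Proof.
move=> /ltW ul; have tp := fuzzy_proper_levels t.
have [rp _] := restrict_cone (pole c) tp ul.
by split=> //; apply: upper_maxf => //; exact: two_points (pole c).
Qed.

Lemma lower_lt_entries (t : X * X -> R) a (m : R) : m < lower t a ->
  m < t (None, Some a) /\ m < t (Some a, None).
Proof. by rewrite /lower lt_min => /andP. Qed.

Section Limits.
Variables (T : Type) (G : set_system T) (FG : Filter G) (f : T -> F X) (t : F X).
Hypothesis ft : f @ G --> t.

Let val_cvg q : (fun z => set_val (f z) q) @ G --> set_val t q.
Proof. exact: (@cvg_coord R _ _ T G FG f t q ft). Qed.

Let gap_cvg a : (fun z => lower (set_val (f z)) a - upper (set_val (f z)) a) @ G -->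
  lower (set_val t) a - upper (set_val t) a.
Proof. by apply: cvgB; [exact: cvg_lower|exact: cvg_upper]. Qed.

Lemma near_inside a : upper (set_val t) a < lower (set_val t) a ->
  \forall z \near G, upper (set_val (f z)) a < lower (set_val (f z)) a.
Proof.
rewrite -subr_gt0 => ul; near=> z; rewrite -subr_gt0; near: z; exact: (cvgr_gt _ (@gap_cvg a)).
Unshelve. all: by end_near. Qed.

Lemma near_gap_lt a (k : R) : lower (set_val t) a - upper (set_val t) a < k ->
  \forall z \near G, lower (set_val (f z)) a - upper (set_val (f z)) a < k.
Proof. exact: cvgr_lt _ (gap_cvg (a := a)) _. Qed.

Lemma cvg_maxf_restrict :
  (fun z => maxf (restrict (set_val (f z)))) @ G --> maxf (restrict (set_val t)).
Proof. by apply: cvg_maxf => q; exact: val_cvg. Qed.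

Lemma near_restrict : 0 < maxf (restrict (set_val t)) ->
  \forall z \near G, 0 < maxf (restrict (set_val (f z))).
Proof. by move=> m0; exact: cvgr_gt cvg_maxf_restrict _ _. Qed.

Lemma cvg_direction a : upper (set_val t) a < lower (set_val t) a ->
  0 < maxf (restrict (set_val t)) -> (fun z => direction c (f z)) @ G --> direction c t.
Proof.
move=> ul m0; apply: (@cvg_normalize R _ _ (pole c) T G FG (fun z => restrict (set_val (f z)))).
- by move=> q; exact: val_cvg.
- by rewrite gt_eqF.
- by apply: normalizable_fuzzy_proper => //; have [] := restrictP ul.
have H1 := near_inside ul; have H2 := near_restrict m0.
near=> z; apply: normalizable_fuzzy_proper; last by near: z.
have ulw : upper (set_val (f z)) a < lower (set_val (f z)) a by near: z.
by have [] := restrictP ulw.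
Unshelve. all: by end_near. Qed.

Lemma near_new_cell i : new_cell c t = Some i -> \forall z \near G, new_cell c (f z) = Some i.
Proof.
case: i => a i /new_cellP[ul m0 ci].
have H1 := near_inside ul; have H2 := near_restrict m0.
have H3 : \forall z \near G, cell c (direction c (f z)) = Some i.
  exact: (cvg_direction ul m0 (cell_open ci)).
by near=> z; apply/new_cellP; split; near: z.
Unshelve. all: by end_near. Qed.

Lemma cvg_log_ratio (x M : T -> R) (x0 M0 : R) :
  x @ G --> x0 -> M @ G --> M0 -> 0 < M0 -> M0 < x0 ->
  (fun z => ln ((x z - M z) / M z)) @ G --> ln ((x0 - M0) / M0).
Proof.
move=> xx MM M0gt Mx; have r0 : 0 < (x0 - M0) / M0 by rewrite divr_gt0 // subr_gt0.
apply: (@cvg_comp _ _ _ (fun z => (x z - M z) / M z) (@ln R) _ _ _ _ (continuous_ln r0)).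
by apply: cvgM; [exact: cvgB|apply: cvgV => //; rewrite gt_eqF].
Qed.

Lemma cvg_new_coord i j : new_cell c t = Some i ->
  (fun z => new_coord c (f z) j) @ G --> new_coord c t j.
Proof.
case: i => a i /new_cellP[ul m0 ci].
have [rp um] := restrictP ul; have MM := cvg_maxf_restrict.
have [|al be] := @lower_lt_entries (set_val t) a (maxf (restrict (set_val t))).
  by rewrite -um.
have ne : \forall z \near G, new_coord c (f z) j = let M := maxf (restrict (set_val (f z))) in
    match j with
    | None => ln ((set_val (f z) (None, Some a) - M) / M)
    | Some None => ln ((set_val (f z) (Some a, None) - M) / M)
    | Some (Some j) => coord c (direction c (f z)) j
    end.
  by apply: (@filterS _ G FG _ _ _ (near_inside ul)) => z ulz; exact: new_coordE.
rewrite (new_coordE c j ul) /=; apply: cvg_trans; first by apply: near_eq_cvg; near=> z;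
  apply/esym; near: z; exact: ne.
case: j {ne} => [[j|]|] /=.
- apply: (@cvg_comp _ _ _ (fun z => direction c (f z)) (fun z => coord c z j) _ _ _ (cvg_direction ul m0)).
  exact: coord_continuous ci.
- exact: cvg_log_ratio.
- exact: cvg_log_ratio.
Unshelve. all: by end_near. Qed.

End Limits.

End Coordinates.

Section CellsStep.
Variables (R : realType) (Y I J : finType) (c : cells R Y I J).
Notation F Y := (set_type (@levels R _ (@proper_preorder Y))).
Notation X := (option Y).
Implicit Type t : F X.

Lemma ratio_bounds (x M B : R) : 0 < M -> M < x -> `|ln ((x - M) / M)| <= B ->
  M <= expR B * (x - M) /\ x - M <= expR B * M.
Proof.
move=> M0 Mx; have r0 : 0 < (x - M) / M by rewrite divr_gt0 // subr_gt0.
rewrite ler_norml -(ler_expR (- B)) -(ler_expR _ B) expRN lnK ?posrE // => /andP[h1 h2].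
split; last by rewrite -ler_pdivrMr.
have e0 : 0 < expR B by exact: expR_gt0.
by rewrite mulrC -ler_pdivrMr // mulrC -ler_pdivlMr.
Qed.

Lemma max_entries t a : upper (set_val t) a < lower (set_val t) a ->
  Num.max (set_val t (None, Some a)) (set_val t (Some a, None)) = 1.
Proof.
move=> ul; rewrite -(maxf_levels t) (@maxf_option _ _ (set_val t) a (ltW ul)) // => q.
exact: fuzzy_proper_ge0 (fuzzy_proper_levels t).
Qed.

(** Let [M] be the maximum over [Y]. The larger dominant entry is 1 and exceeds [M] by at most
    [expR B * M], whence the first bound; the smaller one exceeds [M] by at least [M / expR B],
    whence the second. *)
Lemma coord_bounds t a B : upper (set_val t) a < lower (set_val t) a ->
  0 < maxf (restrict (set_val t)) -> (forall j, `|new_coord c t j| <= B) ->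
  (1 + expR B)^-1 <= maxf (restrict (set_val t)) /\
  (expR B * (1 + expR B))^-1 <= lower (set_val t) a - upper (set_val t) a.
Proof.
move=> ul m0 tB; have [rp um] := restrictP c ul; set M := maxf _ in m0 um *.
have [|al be] := @lower_lt_entries _ _ (set_val t) a M; first by rewrite -um.
have := tB (Some None); have := tB None; rewrite !(new_coordE c _ ul) /= -/M.
move=> /(ratio_bounds m0 al)[a1 a2] /(ratio_bounds m0 be)[b1 b2].
have e0 : 0 < expR B by exact: expR_gt0.
have mx := max_entries ul.
have M1 : (1 + expR B)^-1 <= M.
  rewrite -[_^-1]mul1r ler_pdivrMr ?ltr_pwDl // mulrDr mulr1 [M * _]mulrC -mx.
  by rewrite ge_max; apply/andP; split; lra.
split=> //; rewrite invfM mulrC ler_pdivrMr // um mulrC; apply: le_trans M1 _.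
by rewrite /lower; case: (lerP (set_val t (None, Some a)) _).
Qed.

Section Limits.
Variables (T : Type) (G : set_system T) (FG : Filter G) (f : T -> F X) (t : F X).
Hypothesis ft : f @ G --> t.

(** A limit outside the cells comes from a vanishing gap, a vanishing restriction, or a direction
    outside the cells of [F Y]. The first two are incompatible with bounded coordinates by
    [coord_bounds], and the third is the properness assumed for [c]. *)
Lemma near_proper_at a (B : R) : new_cell c t = None ->
  \forall z \near G, upper (set_val (f z)) a < lower (set_val (f z)) a ->
    new_cell c (f z) = None \/ exists j, B < `|new_coord c (f z) j|.
Proof.
move=> tN; pose E := expR B; have E0 : 0 < E by exact: expR_gt0.
have k0 : 0 < (E * (1 + E))^-1 by rewrite invr_gt0 mulr_gt0 // ltr_pwDl // ltW.
have l0 : 0 < (1 + E)^-1 by rewrite invr_gt0 ltr_pwDl // ltW.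
have dich z : (maxf (restrict (set_val (f z))) < (1 + E)^-1) \/
     (lower (set_val (f z)) a - upper (set_val (f z)) a < (E * (1 + E))^-1) ->
   upper (set_val (f z)) a < lower (set_val (f z)) a ->
   new_cell c (f z) = None \/ exists j, B < `|new_coord c (f z) j|.
  move=> sm ul; case C : (new_cell c (f z)) => [[b i]|]; [right|by left].
  have [ulb m0 _] := (new_cellP c (f z) b i).1 C.
  apply: contrapT => /forallNP nj.
  have [|h1 h2] := @coord_bounds (f z) a B ul m0.
    by move=> j; rewrite leNgt; apply/negP; exact: nj.
  by case: sm; rewrite ltNge ?h1 ?h2.
have [ul|lu] := ltP (upper (set_val t) a) (lower (set_val t) a); last first.
  have H : \forall z \near G, lower (set_val (f z)) a - upper (set_val (f z)) a < (E * (1 + E))^-1.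
    by apply: (near_gap_lt FG ft); apply: le_lt_trans k0; rewrite subr_le0.
  by near=> z; apply: dich; right; near: z.
have [m0|m0] := ltP 0 (maxf (restrict (set_val t))); last first.
  have H : \forall z \near G, maxf (restrict (set_val (f z))) < (1 + E)^-1.
    exact: (cvgr_lt _ (cvg_maxf_restrict FG ft) _ (le_lt_trans m0 l0)).
  by near=> z; apply: dich; left; near: z.
have ci : cell c (direction c t) = None by move/new_cell_None : tN => /(_ a ul m0).
have H : \forall z \near G, cell c (direction c (f z)) = None \/
    exists j, B < `|coord c (direction c (f z)) j|.
  exact: (@cvg_direction _ _ _ _ c T G FG f t ft a ul m0 _ (coord_proper B ci)).
near=> z => ulz.
have [cz|[j jB]] : cell c (direction c (f z)) = None \/
    exists j, B < `|coord c (direction c (f z)) j| by near: z.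
  by left; rewrite /new_cell (pickE ulz) cz; case: ifP.
by right; exists (Some (Some j)); rewrite (new_coordE c _ ulz).
Unshelve. all: by end_near. Qed.

Lemma near_proper (B : R) : new_cell c t = None ->
  \forall z \near G, new_cell c (f z) = None \/ exists j, B < `|new_coord c (f z) j|.
Proof.
move=> tN.
have H : \forall z \near G, forall a, upper (set_val (f z)) a < lower (set_val (f z)) a ->
    new_cell c (f z) = None \/ exists j, B < `|new_coord c (f z) j|.
  by apply: filter_forall => a; exact: near_proper_at.
apply: (@filterS _ G FG _ _ _ H) => z Hz.
case C : (new_cell c (f z)) => [[a i]|]; last by left.
by have [/Hz + _ _] := (new_cellP c (f z) a i).1 C; rewrite C.
Qed.

End Limits.

Lemma new_coord_surj i y : exists t, new_cell c t = Some i /\ new_coord c t =1 y.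
Proof.
case: i => a i; have [z [ci zy]] := coord_surj c i (fun j => y (Some (Some j))).
set p := expR (y None); set q := expR (y (Some None)).
have p0 : 0 < p by exact: expR_gt0.
have q0 : 0 < q by exact: expR_gt0.
(* Here the maximum over [Y] is 1, so the two ratios are [p] and [q], and normalization does not
   change them. *)
pose s := twin a (1 + p) (1 + q) (set_val z).
have zp := fuzzy_proper_levels z; have z1 := maxf_levels z; have [[_ zd _] _] := zp.
have mm : maxf (set_val z) < Num.min (1 + p) (1 + q) by rewrite z1 lt_min !ltrDl p0 q0.
have sp : fuzzy_proper s by apply: fuzzy_proper_twin => //; exact: ltW.
have m0 : 0 < maxf s.
  by apply: lt_le_trans (le_maxf s (None, Some a)); rewrite /s /= eqxx ltr_pwDl // ltW.
have k0 : 0 < (maxf s)^-1 by rewrite invr_gt0.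
pose t := normalize (new_pole c) s.
have tE : set_val t = fun q => (maxf s)^-1 * s q.
  have sn := normalizable_fuzzy_proper sp m0.
  by apply/funext => r; rewrite val_normalize // mulrC.
have rE : restrict (set_val t) = fun r => (maxf s)^-1 * set_val z r.
  by rewrite tE; apply/funext => -[i1 j1].
have mE : maxf (restrict (set_val t)) = (maxf s)^-1 by rewrite rE maxf_scale ?ltW // z1 mulr1.
have dE : direction c t = z by rewrite /direction rE normalize_scale // normalize_id.
have ul : upper (set_val t) a < lower (set_val t) a.
  by rewrite tE upper_scale // lower_scale // ltr_pM2l // upper_twin // lower_twin.
exists t; split; first by apply/new_cellP; rewrite mE dE.
have ratio (x : R) : ((maxf s)^-1 * (1 + x) - (maxf s)^-1) / (maxf s)^-1 = x.
  by rewrite mulrDr mulr1 addrAC subrr add0r mulrAC divff ?mul1r // gt_eqF.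
case=> [[j|]|]; rewrite (new_coordE c _ ul) /= ?mE.
- by rewrite dE zy.
- by rewrite tE /= eqxx ratio expRK.
- by rewrite tE /= eqxx ratio expRK.
Qed.

Lemma new_coord_inj t t' i : new_cell c t = Some i -> new_cell c t' = Some i ->
  new_coord c t =1 new_coord c t' -> t = t'.
Proof.
case: i => a i /new_cellP[ul m0 ci] /new_cellP[ul' m0' ci'] tt'.
have dE : direction c t = direction c t'.
  apply: coord_inj ci ci' _ => j.
  by have := tt' (Some (Some j)); rewrite !(new_coordE c _ ul) !(new_coordE c _ ul').
have hY := two_points (pole c).
have mx := max_entries ul; have mx' := max_entries ul'.
have [rp um] := restrictP c ul; have [rp' um'] := restrictP c ul'.
have [_ tE] := restrict_twin_eq hY (fuzzy_proper_levels t) (ltW ul).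
have [_ tE'] := restrict_twin_eq hY (fuzzy_proper_levels t') (ltW ul').
have := tt' None; have := tt' (Some None).
rewrite !(new_coordE c _ ul) !(new_coordE c _ ul') /=.
have [|al be] := @lower_lt_entries _ _ (set_val t) a (maxf (restrict (set_val t))).
  by rewrite -um.
have [|al' be'] := @lower_lt_entries _ _ (set_val t') a (maxf (restrict (set_val t'))).
  by rewrite -um'.
have rK q : maxf (restrict (set_val t)) * set_val (direction c t) q = restrict (set_val t) q.
  exact: normalize_valK.
have rK' q : maxf (restrict (set_val t')) * set_val (direction c t') q = restrict (set_val t') q.
  exact: normalize_valK.
move: m0 m0' al be al' be' mx mx' tE tE' rK rK'; rewrite /direction.
set M := maxf (restrict (set_val t)); set M' := maxf (restrict (set_val t')).
set x := set_val t (None, Some a); set y := set_val t (Some a, None).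
set x' := set_val t' (None, Some a); set y' := set_val t' (Some a, None).
move=> m0 m0' al be al' be' mx mx' tE tE' rK rK'.
have cancel_ln (u u' : R) : M < u -> M' < u' -> ln ((u - M) / M) = ln ((u' - M') / M') ->
    u / M = u' / M'.
  move=> uM uM' /ln_inj; rewrite !posrE !divr_gt0 ?subr_gt0 // => /(_ isT isT).
  by rewrite !mulrBl !divff ?gt_eqF // => /addIr.
move=> /(cancel_ln _ _ be be') yE /(cancel_ln _ _ al al') xE.
(* The larger dominant entry is 1 on both sides, so the larger of the two common ratios is both
   [1 / M] and [1 / M']. *)
have ME : M = M'.
  apply: invr_inj; rewrite -[M^-1]mul1r -[M'^-1]mul1r -{1}mx -mx'.
  by rewrite !maxr_pMl ?invr_ge0 ?ltW // xE yE.
have xx : x = x' by move: xE; rewrite ME => /mulIf; apply; rewrite invr_eq0 gt_eqF.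
have yy : y = y' by move: yE; rewrite ME => /mulIf; apply; rewrite invr_eq0 gt_eqF.
apply: val_inj; rewrite -!set_valE tE tE' xx yy; congr twin.
by apply/funext => q; rewrite -rK -rK' -/(direction c t) -/(direction c t') dE ME.
Qed.

Definition step_cells : cells R X (Y * I)%type (option (option J)) :=
  Cells (@new_bump_continuous _ _) (@new_bump01 _ _) (new_bump_pole c) (@new_bump_cell _ _ _ _ c)
    (@new_contraction_continuous _ _ _ _ c) (new_contraction0 c) (@new_contraction_cell _ _ _ _ c)
    (@new_contraction1 _ _ _ _ c)
    (fun t i => @near_new_cell _ _ _ _ c _ (nbhs t) (nbhs_filter t) id t cvg_id i)
    (fun t i j => @cvg_new_coord _ _ _ _ c _ (nbhs t) (nbhs_filter t) id t cvg_id i j)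
    (fun t B => @near_proper _ (nbhs t) (nbhs_filter t) id t cvg_id B)
    new_coord_surj new_coord_inj.

End CellsStep.

(** * The case of two points, and the iteration *)

Section BaseCells.
Variable R : realType.
Notation F Y := (set_type (@levels R _ (@proper_preorder Y))).

(** On two points the space of levels has just two elements, one for each strict order: the pole and
    a cell of dimension 0. *)
Definition arrow (b : bool) (q : bool * bool) : R := (q == (b, ~~ b))%:R.

Lemma maxf_arrow b : maxf (arrow b) = 1.
Proof.
apply: (@maxfE _ _ _ _ (b, ~~ b)) => // [|q]; first by rewrite /arrow eqxx.
by rewrite /arrow; case: eqP.
Qed.

Lemma fuzzy_proper_arrow b : fuzzy_proper (arrow b).
Proof.
split; last by exists (~~ b), b; case: b.
have d i : arrow b (i, i) = 0 by rewrite /arrow; case: b i => [] [].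
split=> [q|//|i j k ik]; rewrite ?ler0n // ge_min.
have [->|ij] := eqVneq i j; first by rewrite d ler0n.
have -> : j = k by case: (i) (j) (k) ij ik => [] [] [].
by rewrite d ler0n orbT.
Qed.

Lemma arrow_levels b : levels (@proper_preorder bool) (arrow b : {ptws bool * bool -> R}).
Proof.
have := normalizable_fuzzy_proper (fuzzy_proper_arrow b); rewrite maxf_arrow => /(_ ltr01).
rewrite /normalizable maxf_arrow (_ : (fun _ => _) = arrow b) //.
by apply/funext => q; rewrite divr1.
Qed.

Definition arrow_pt b : F bool :=
  exist (fun f => f \in @levels R _ (@proper_preorder bool)) _ (mem_set (arrow_levels b)).

Lemma arrow_ptE (z : F bool) : z = arrow_pt (set_val z (true, false) == 1).
Proof.
have [[z0 zd _] [i [j [ij zij]]]] := fuzzy_proper_levels z.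
have z1 := maxf_levels z; have [|q zq] := @maxf_attained _ _ (set_val z).
  by rewrite z1.
rewrite z1 in zq.
have n10 : 1 <> 0 :> R by apply/eqP; rewrite oner_eq0.
have qE : q = (q.1, ~~ q.1) by case: q zq => [[] []] //=; rewrite zd => /esym.
have z0E : set_val z (~~ q.1, q.1) = 0.
  case: (q.1) qE zq => -> zq; case: i j ij zij => [] [] // _ zij //.
    by case: n10; rewrite -zq zij.
  by case: n10; rewrite -zq zij.
have E : set_val z = arrow q.1.
  apply/funext => r; rewrite /arrow; case: (q.1) qE zq z0E => -> zq zE;
    by case: r => [[] []] /=; rewrite ?zd ?zq ?zE.
have -> : (set_val z (true, false) == 1) = q.1.
  by rewrite E /arrow; case: (q.1); rewrite /= ?eqxx // eq_sym oner_eq0.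
by apply: val_inj; rewrite -set_valE E.
Qed.

Definition base_pole := arrow_pt false.

Definition base_bump (z : F bool) : R := set_val z (false, true).

Definition base_cell (z : F bool) : option unit :=
  if set_val z (true, false) == 1 then Some tt else None.

Definition base_coord (z : F bool) (j : void) : R := of_void R j.

Let val_cvg (z : F bool) q : (fun w : F bool => set_val w q) @ nbhs z --> set_val z q.
Proof. exact: (@cvg_coord R _ _ (F bool) (nbhs z) (nbhs_filter z) id z q cvg_id). Qed.

Lemma base_valE (z : F bool) :
  set_val z (true, false) = (set_val z (true, false) == 1)%:R /\
  set_val z (false, true) = (set_val z (true, false) != 1)%:R.
Proof.
rewrite {1 3}(arrow_ptE z) /= /arrow.
by case: (set_val z (true, false) == 1).
Qed.

Lemma base_cell_None z : base_cell z = None <-> set_val z (true, false) < 1.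
Proof.
rewrite /base_cell [in X in _ <-> X](base_valE z).1.
by case: eqP => _; rewrite /= ?ltxx ?ltr01; split.
Qed.

Lemma base_cell_Some z i : base_cell z = Some i <-> 0 < set_val z (true, false).
Proof.
rewrite /base_cell [in X in _ <-> X](base_valE z).1.
by case: eqP => _; rewrite /= ?ltxx ?ltr01; split=> //; case: i.
Qed.

Lemma base_near_None z : base_cell z = None -> \forall w \near z, base_cell w = None.
Proof.
move=> /base_cell_None z1.
have H : \forall w \near z, set_val w (true, false) < 1.
  exact: (@cvgr_lt R (F bool) (nbhs z) (nbhs_filter z) _ _ (@val_cvg z (true, false))).
by apply: (@filterS _ (nbhs z) (nbhs_filter z) _ _ _ H) => w /base_cell_None.
Qed.

Lemma base_near_Some z i : base_cell z = Some i -> \forall w \near z, base_cell w = Some i.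
Proof.
move=> /base_cell_Some z1.
have H : \forall w \near z, 0 < set_val w (true, false).
  exact: (@cvgr_gt R (F bool) (nbhs z) (nbhs_filter z) _ _ (@val_cvg z (true, false))).
by apply: (@filterS _ (nbhs z) (nbhs_filter z) _ _ _ H) => w /base_cell_Some.
Qed.

Lemma base_bump_cell z : 0 < base_bump z -> base_cell z = None.
Proof.
rewrite /base_bump /base_cell; have [_ ->] := base_valE z.
by case: eqP; rewrite /= ?ltxx.
Qed.

Lemma base_bump01 z : 0 <= base_bump z <= 1.
Proof.
rewrite /base_bump; have [_ ->] := base_valE z.
by case: eqP; rewrite /= ?lexx ler01.
Qed.

Lemma base_contraction1 z : base_cell z = None -> z = base_pole.
Proof. by rewrite /base_cell {2}(arrow_ptE z) /base_pole; case: eqP. Qed.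

Lemma base_coord_surj i (y : void -> R) : exists z, base_cell z = Some i /\ base_coord z =1 y.
Proof.
exists (arrow_pt true); split; last by case.
by apply/base_cell_Some; rewrite set_valE /= /arrow eqxx.
Qed.

Lemma base_coord_inj z z' i : base_cell z = Some i -> base_cell z' = Some i ->
  base_coord z =1 base_coord z' -> z = z'.
Proof.
rewrite /base_cell => + + _; rewrite {2}(arrow_ptE z) {2}(arrow_ptE z').
by case: eqP => // _; case: eqP.
Qed.

Definition base_cells : cells R bool unit void :=
  @Cells R bool unit void base_pole base_bump fst base_cell base_coord
    (fun z => @val_cvg z (false, true)) base_bump01 (erefl _) base_bump_cell
    (fun z => cvg_fst) (fun z => erefl) (fun z u zN => zN) base_contraction1
    base_near_Some (fun z i j => of_void _ j)
    (fun z B zN => filterS (fun w wN => or_introl wN) (base_near_None zN))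
    base_coord_surj base_coord_inj.

Definition iter_option k := iter k (fun T : finType => option T) bool.

Fixpoint cells_index k : finType :=
  if k is k'.+1 then (iter_option k' * cells_index k')%type else unit.

Fixpoint cells_dim k : finType :=
  if k is k'.+1 then option (option (cells_dim k')) else void.

Fixpoint iter_cells k : cells R (iter_option k) (cells_index k) (cells_dim k) :=
  if k is k'.+1 then step_cells (iter_cells k') else base_cells.

Lemma card_iter_option k : #|iter_option k| = k.+2.
Proof. by elim: k => [|k IH]; rewrite ?card_bool //= card_option IH. Qed.

Lemma card_cells_index k : #|cells_index k| = k.+1`!.
Proof. by elim: k => [|k IH]; rewrite ?card_unit //= card_prod card_iter_option IH. Qed.

Lemma card_cells_dim k : #|cells_dim k| = (2 * k)%N.
Proof. by elim: k => [|k IH]; rewrite ?card_void //= !card_option IH mulnS. Qed.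

End BaseCells.

(** * Wedges of spheres *)

Section Stereographic.
Variables (R : realType) (J : finType).
Implicit Type y : J -> R.

Notation S := (sphere R #|J|).

Definition sqsum y := \sum_j y j ^+ 2.

Lemma sqsum_ge0 y : 0 <= sqsum y.
Proof. by apply: sumr_ge0 => j _; exact: sqr_ge0. Qed.

Lemma le_sqsum y j : y j ^+ 2 <= sqsum y.
Proof.
rewrite /sqsum (bigD1 j) //= lerDl; apply: sumr_ge0 => i _; exact: sqr_ge0.
Qed.

Lemma sqsum_enum y : sqsum y = \sum_(i < #|J|) y (enum_val i) ^+ 2.
Proof.
rewrite /sqsum (reindex (fun i : 'I_#|J| => enum_val i)) //=.
by apply: onW_bij; exact: enum_val_bij.
Qed.

Let s1_gt0 y : 0 < sqsum y + 1.
Proof. by have := sqsum_ge0 y; lra. Qed.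

(* The inverse of the stereographic projection from [sphere_pt]. *)
Definition stereo y : S := insubd (sphere_pt R #|J|)
  (\row_i (if unlift 0 i is Some j then 2 * y (enum_val j) / (sqsum y + 1)
           else (sqsum y - 1) / (sqsum y + 1))).

Lemma stereoP y : \row_i (if unlift 0 i is Some j then 2 * y (enum_val j) / (sqsum y + 1)
    else (sqsum y - 1) / (sqsum y + 1)) \in @unit_sphere R #|J|.
Proof.
apply/mem_set; rewrite /unit_sphere /= big_ord_recl mxE unlift_none.
have -> : \sum_(i < #|J|) ((\row_i (if unlift 0 i is Some j then
    2 * y (enum_val j) / (sqsum y + 1) else (sqsum y - 1) / (sqsum y + 1)))
    0 (lift ord0 i)) ^+ 2 = 4 * sqsum y / (sqsum y + 1) ^+ 2 :> R.
  transitivity (4 * (\sum_(i < #|J|) y (enum_val i) ^+ 2) / (sqsum y + 1) ^+ 2).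
    rewrite mulr_sumr mulr_suml; apply: eq_bigr => i _; rewrite mxE liftK.
    by field; rewrite gt_eqF.
  by rewrite -sqsum_enum.
by field; rewrite gt_eqF.
Qed.

Lemma stereo0 y : set_val (stereo y) 0 0 = 1 - 2 / (sqsum y + 1).
Proof.
rewrite set_valE val_insubd stereoP mxE unlift_none.
by field; rewrite gt_eqF.
Qed.

Lemma stereoS y i : set_val (stereo y) 0 (lift 0 i) = 2 * y (enum_val i) / (sqsum y + 1).
Proof. by rewrite set_valE val_insubd stereoP mxE liftK. Qed.

Lemma sphere_ptE i : set_val (sphere_pt R #|J|) 0 i = (i == 0)%:R.
Proof. by rewrite set_valE /= mxE eqxx. Qed.

Lemma stereo_neq y : stereo y != sphere_pt R #|J|.
Proof.
apply/eqP => e; have := stereo0 y; rewrite e sphere_ptE eqxx => /eqP.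
rewrite eq_sym subr_eq addrC -subr_eq subrr eq_sym gt_eqF // divr_gt0 //.
Qed.

Lemma stereo_inj y y' : stereo y = stereo y' -> y =1 y'.
Proof.
move=> e j; have := stereo0 y; rewrite e stereo0 => /addrI/oppr_inj/mulfI.
rewrite pnatr_eq0 => /(_ isT)/invr_inj ss.
have := stereoS y (enum_rank j); rewrite e stereoS enum_rankK ss.
by move=> /mulIf; rewrite invr_eq0 gt_eqF // => /(_ isT)/mulfI; rewrite pnatr_eq0 => /(_ isT).
Qed.

Lemma stereo_surj (x : S) : x != sphere_pt R #|J| -> exists y, stereo y = x.
Proof.
move=> xp; have := sphereP x; rewrite big_ord_recl; set x0 := set_val x 0 0 => xs.
have r0 : 0 <= \sum_(i < #|J|) set_val x 0 (lift ord0 i) ^+ 2.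
  by apply: sumr_ge0 => i _; exact: sqr_ge0.
have x0n : 1 - x0 != 0.
  apply: contraNneq xp => /subr0_eq x01.
  have : \sum_(i < #|J|) set_val x 0 (lift ord0 i) ^+ 2 = 0 by rewrite -x01 in xs; lra.
  move=> /eqP; rewrite psumr_eq0 => [/allP h|i _]; last exact: sqr_ge0.
  apply/eqP/val_inj/rowP => i; rewrite -!set_valE sphere_ptE.
  case: (unliftP 0 i) => [k ->|->]; last by rewrite eqxx; exact: esym x01.
  by have := h k (mem_index_enum _); rewrite sqrf_eq0 => /eqP ->.
pose y j := set_val x 0 (lift 0 (enum_rank j)) / (1 - x0).
have sE : sqsum y = (1 + x0) / (1 - x0).
  rewrite sqsum_enum; under eq_bigr do rewrite /y enum_valK expr_div_n.
  rewrite -mulr_suml; set r := \sum_(i < _) _ in xs *.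
  have -> : r = 1 - x0 ^+ 2 by apply/eqP; rewrite eq_sym subr_eq addrC xs.
  by field.
have s1E : sqsum y + 1 = 2 / (1 - x0) by rewrite sE; field.
exists y; apply: val_inj; apply/rowP => i; rewrite -!set_valE.
case: (unliftP 0 i) => [k ->|->].
  by rewrite stereoS s1E /y enum_valK; field; rewrite x0n.
by rewrite stereo0 s1E -/x0; field; rewrite x0n.
Qed.

Lemma cvg_stereo (T : Type) (G : set_system T) (FG : Filter G) (f : T -> J -> R) (l : J -> R) :
  (forall j, (fun z => f z j) @ G --> l j) -> (fun z => stereo (f z)) @ G --> stereo l.
Proof.
move=> fl.
have cst (c : R) := @cvg_cst R c T G FG.
have ss : (fun z => sqsum (f z) + 1) @ G --> sqsum l + 1.
  apply: cvgD; last exact: cst.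
  by apply: cvg_sumr => j; under eq_fun do rewrite expr2; rewrite expr2; exact: cvgM.
have si : (fun z => (sqsum (f z) + 1)^-1) @ G --> (sqsum l + 1)^-1.
  by apply: cvgV => //; rewrite gt_eqF.
apply: cvg_sphere => i; case: (unliftP 0 i) => [k ->|->].
  under eq_fun do rewrite stereoS; rewrite stereoS.
  by apply: cvgM => //; apply: cvgM => //; exact: cst.
under eq_fun do rewrite stereo0; rewrite stereo0.
by apply: cvgB; [exact: cst|apply: cvgM => //; exact: cst].
Qed.

(** The neighborhoods of infinity. For empty [J] every set is one, in accordance with
    [coord_proper], which then makes the union of the cells closed. *)
Definition escape : set_system (J -> R) :=
  [set U | exists B : R, forall y, (exists j, B < `|y j|) -> U y].

Lemma escape_filter : Filter escape.
Proof.
split.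
- by exists 0.
- move=> U V [B BU] [C CV]; exists (Num.max B C) => y [j].
  by rewrite gt_max => /andP[Bj Cj]; split; [apply: BU|apply: CV]; exists j.
- by move=> U V UV [B BU]; exists B => y /BU; exact: UV.
Qed.

(** The threshold is chosen to bring every entry of [stereo y] within [e] of that of the base
    point. *)
Lemma escape_lt (e : R) : 0 < e -> \forall y \near escape, 4 / e ^+ 2 < sqsum y + 1.
Proof.
move=> e0; exists (2 / e) => y [j yj]; have := le_sqsum y j.
have : (2 / e) ^+ 2 < `|y j| ^+ 2.
  by rewrite ltr_pXn2r // nnegrE ?divr_ge0 ?ltW.
rewrite real_normK ?num_real // expr_div_n -natrX; lra.
Qed.

Lemma escape_stereo : stereo @ escape --> sphere_pt R #|J|.
Proof.
have FG := escape_filter; apply: (@cvg_sphere R _ _ escape FG stereo) => i.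
case: (unliftP 0 i) => [k ->|->]; rewrite sphere_ptE.
- under eq_fun do rewrite stereoS; apply/cvgr0Pnorm_lt => e e0.
  have H := escape_lt e0; apply: (@filterS _ _ FG _ _ _ H) => y ey.
  rewrite normrM normfV [`|sqsum y + 1|]gtr0_norm // ltr_pdivrMr // normrM gtr0_norm //.
  set a := y (enum_val k).
  have ya := le_sqsum y (enum_val k); rewrite -/a in ya.
  have s0 := s1_gt0 y.
  have : 4 / e ^+ 2 * e ^+ 2 < (sqsum y + 1) * e ^+ 2 by rewrite ltr_pM2r // exprn_gt0.
  rewrite divfK ?expf_neq0 ?gt_eqF // => ye.
  rewrite -(ltr_pM2r e0).
  (* Twice the target reads [4 * |a| * e < 2 * (sqsum y + 1) * e ^+ 2]; this square bounds the left
     side by [a ^+ 2 * e ^+ 2 + 4], and 4 is below [(sqsum y + 1) * e ^+ 2]. *)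
  have := sqr_ge0 (`|a| * e - 2); rewrite sqrrB exprMn real_normK ?num_real //.
  have : a ^+ 2 * e ^+ 2 <= sqsum y * e ^+ 2 by rewrite ler_wpM2r // sqr_ge0.
  nra.
- under eq_fun do rewrite stereo0; rewrite eqxx.
  suff H : (fun y => 1 - 2 / (sqsum y + 1)) @ escape --> (1 : R) - 0 by rewrite subr0 in H.
  apply: cvgB; first exact: (@cvg_cst R 1 _ escape FG).
  apply/cvgr0Pnorm_lt => e e0.
  have H := escape_lt e0; apply: (@filterS _ _ FG _ _ _ H) => y ey.
  have s0 := s1_gt0 y.
  rewrite gtr0_norm ?divr_gt0 // ltr_pdivrMr //.
  have : 4 / e ^+ 2 * e ^+ 2 < (sqsum y + 1) * e ^+ 2 by rewrite ltr_pM2r // exprn_gt0.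
  rewrite divfK ?expf_neq0 ?gt_eqF // => ye.
  have := sqsum_ge0 y; nra.
Qed.

End Stereographic.

(** * From a cell structure to a wedge of spheres *)

Section CellsWedge.
Variables (R : realType) (Y I J : finType) (c : cells R Y I J) (i0 : I).
Notation F Y := (set_type (@levels R _ (@proper_preorder Y))).

Notation pt := (sphere_pt R #|J|).
Notation W := (sphere_wedge R #|I| #|J|).

Definition wedge_in (i : I) (x : sphere R #|J|) : W :=
  @wedge_lift 'I_#|I| (fun=> sphere R #|J|) (fun=> pt) (enum_rank i) x.

Lemma wedge_in_pt i j : wedge_in i pt = wedge_in j pt.
Proof. exact: (@wedge_liftE 'I_#|I| (fun=> sphere R #|J|) (fun=> pt) (enum_rank j) pt _ pt). Qed.

Lemma wedge_in_inj i j x y : wedge_in i x = wedge_in j y -> x != pt -> i = j /\ x = y.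
Proof.
move=> /eqmodP/predU1P[e _|/andP[/eqP /= ->]]; last by rewrite eqxx.
have := congr1 (fun s : {i : 'I_#|I| & sphere R #|J|} => (projT1 s, projT2 s)) e.
by move=> [/enum_rank_inj -> ->].
Qed.

Lemma wedge_in_surj (w : W) : exists i x, w = wedge_in i x.
Proof.
have : [set: W] w by [].
rewrite -wedgeTE => -[i _ [x _ <-]].
by exists (enum_val i), x; rewrite /wedge_in enum_valK.
Qed.

Lemma wedge_in_continuous i : continuous (wedge_in i).
Proof. exact: (@wedge_lift_continuous 'I_#|I| (fun=> sphere R #|J|) (fun=> pt) (enum_rank i)). Qed.

Lemma nbhs_wedge_in_pt (N : set W) : nbhs (wedge_in i0 pt) N ->
  forall i, \forall x \near pt, N (wedge_in i x).
Proof. by move=> nN i; apply: (wedge_in_continuous (i := i)); rewrite (wedge_in_pt i i0). Qed.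

(** The index [i0] only serves to name the base point common to all spheres. *)
Definition to_wedge (z : F Y) : W :=
  if cell c z is Some i then wedge_in i (stereo (coord c z)) else wedge_in i0 pt.

(** Near the complement of the cells the coordinates escape to infinity, so their stereographic
    images approach the base point. Finiteness of [I] gives one neighborhood that suits all
    spheres. *)
Lemma to_wedge_continuous : continuous to_wedge.
Proof.
move=> z; case C : (cell c z) => [i|].
  have cs : (fun w => stereo (coord c w)) @ nbhs z --> stereo (coord c z).
    apply: (cvg_stereo (nbhs_filter z)) => j; exact: coord_continuous C.
  have cw : (fun w => wedge_in i (stereo (coord c w))) @ nbhs z --> wedge_in i (stereo (coord c z)).
    exact: (@cvg_comp _ _ _ _ _ _ _ _ cs (@wedge_in_continuous i _)).
  move=> N nN.
  have H : \forall w \near z, N (wedge_in i (stereo (coord c w))).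
    by apply: cw; move: nN; rewrite /to_wedge C.
  apply: (@filterS2 _ (nbhs z) (nbhs_filter z) _ _ _ _ (cell_open C) H) => w /= Cw.
  by rewrite /to_wedge Cw.
move=> N; rewrite /to_wedge C => nN.
have H : \forall w \near z, forall i, cell c w = None \/ N (wedge_in i (stereo (coord c w))).
  apply: (@filter_forall _ I _ (nbhs z) (nbhs_filter z)) => i.
  have [B BN] := escape_stereo (nbhs_wedge_in_pt nN i).
  apply: (@filterS _ (nbhs z) (nbhs_filter z) _ _ _ (coord_proper B C)) => w [|Bw]; first by left.
  by right; exact: BN.
apply: (@filterS _ (nbhs z) (nbhs_filter z) _ _ _ H) => w Hw /=.
case Cw : (cell c w) => [i|]; last exact: nbhs_singleton.
by case: (Hw i); rewrite ?Cw.
Qed.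

Lemma homotopy_equivalent_cells : compact [set: F Y] ->
  homotopy_equivalent R (F Y) W.
Proof.
move=> cF; have pole_None : cell c (pole c) = None by apply: bump_cell; rewrite bump_pole.
apply: (@homotopy_equivalent_collapse R _ _ to_wedge [set z | cell c z = None]
  (wedge_in i0 pt) (pole c) (contraction c)) => //.
- by apply: wedge_hausdorff => i; exact: hausdorff_sphere.
- exact: to_wedge_continuous.
- move=> w; have [i [x ->]] := wedge_in_surj w.
  have [->|xp] := eqVneq x pt.
    by exists (pole c); rewrite /to_wedge pole_None; exact: wedge_in_pt.
  have [y <-] := stereo_surj xp; have [z [cz zy]] := coord_surj c i y.
  by exists z; rewrite /to_wedge cz (funext zy).
- by move=> z; rewrite /to_wedge /= => ->.
- move=> z z'; rewrite /to_wedge /=; case C : (cell c z) => [i|]; last by left.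
  right; move: H; case C' : (cell c z') => [j|] /wedge_in_inj/(_ (stereo_neq _))[ij].
    by rewrite -{}ij in C' * => /stereo_inj; exact: coord_inj C C'.
  by move=> e; have := stereo_neq (coord c z); rewrite e eqxx.
- exact: contraction_continuous.
- exact: contraction0.
- exact: contraction_cell.
- exact: contraction1.
Qed.

End CellsWedge.

(** * The two homotopy types, after relabelling the points *)

Lemma exists_bij (A B : finType) : #|A| = #|B| -> exists f : A -> B, bijective f.
Proof.
move=> AB; exists (enum_val \o cast_ord AB \o enum_rank).
apply: bij_comp; [apply: bij_comp; first exact: enum_val_bij|exact: enum_rank_bij].
by exists (cast_ord (esym AB)); [exact: cast_ordK|exact: cast_ordKV].
Qed.

Theorem proposition5 (R : realType) (n : nat) (hn : (2 <= n)%N)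
    (X : finType) (hX : #|X| = n) :
  homotopy_equivalent R
    (realization R (order_complex (subposet
       (fun T : top X => (T != \bot)%O && (T != \top)%O))))
    (sphere_wedge R (n - 1)`! (2 * n - 4))
  /\
  homotopy_equivalent R
    (realization R (order_complex (subposet
       (fun T : top X => kolmogorov T && (T != \top)%O))))
    (sphere R (n - 2)).
Proof.
case: n hn hX => [|[|k]] // _ hX; split.
  have [|e eb] := @exists_bij (iter_option k) X; first by rewrite card_iter_option hX.
  apply: (homotopy_equivalent_proper_top eb) => cF.
  have := homotopy_equivalent_cells (iter_cells R k) _ cF.
  rewrite card_cells_index card_cells_dim.
  have -> : (2 * k.+2 - 4 = 2 * k)%N by rewrite !mulnS addnA addKn.
  rewrite subn1 /=; apply.
  have : (0 < #|cells_index k|)%N by rewrite card_cells_index fact_gt0.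
  by move=> /card_gt0P/sigW[].
have [|e eb] := @exists_bij (option 'I_k.+1) X; first by rewrite card_option card_ord hX.
apply: (homotopy_equivalent_kolmogorov eb); rewrite subn2 /=.
exact: homotopy_equivalent_strict_order.
Qed.
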